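(* Let $A\in\mathbb{R}^{d\times d}$ be an invertible matrix with $\rho(A)<1$, let $C=(I-A)^{-1}$, and let $P\in\mathbb{R}^{d\times d}$ be a (row-)stochastic matrix with $P_{i,j}>0$ if and only if $A_{i,j}\neq 0$, such that the Markov chain on $[d]=\{1,\dots,d\}$ with transition matrix $P$ is irreducible and aperiodic and such that $\rho(\widehat H)<1$, where $\widehat H_{i,j}=A_{i,j}^2/P_{i,j}$ if $P_{i,j}\ne 0$ and $\widehat H_{i,j}=0$ otherwise. Let $\Sigma^K$ be the $d\times d$ random matrix produced after $K$ iterations of the regenerative Ulam-von Neumann recursion described in the context. Then there exist a $d\times d$ matrix $\Gamma_s$ and a symmetric positive semi-definite $d^2\times d^2$ matrix $M_a$ such that, with $\widehat\Gamma_s$ the $d\times d$ matrix defined by $[\widehat\Gamma_s]_{i,j}=[\Gamma_s]_{i,j}C_{i,j}$ for $i,j\in[d]$, the quantity $$\sqrt K\left(\frac{\Sigma^K}{K}-\widehat\Gamma_s\right)$$ (viewed as a vector in $\mathbb{R}^{d^2}$) converges in distribution, as $K\to\infty$, to a $d^2$-variate normal variable with mean zero and covariance matrix $M_a$.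
   Context: $\rho(\cdot)$ denotes the spectral radius. Regenerative Ulam-von Neumann recursion. Maintain three $d\times d$ matrices $\Lambda,\Sigma$ (real) and $\Gamma$ (nonnegative integers), all initialized to zero, and a Markov chain on $[d]$ with transition matrix $P$, started at some (random) state $i\in[d]$. One iteration, with current state $i$, does the following in order: (a) for all $k\in[d]$: if $\Lambda_{i,k}=0$, set $\Lambda_{i,k}=1$ (otherwise leave it unchanged); (b) sample the next state $j$ of the chain with probabilities $P_{i,\cdot}$; (c) multiply the whole matrix $\Lambda$ by the scalar $A_{i,j}/P_{i,j}$; (d) for all $k\in[d]$: if $\Lambda_{k,j}\ne0$, increase $\Gamma_{k,j}$ by $1$; (e) for all $k\in[d]$: replace $\Sigma_{k,j}$ by $\Sigma_{k,j}+\Lambda_{k,j}$; (f) for all $k\in[d]$: set $\Lambda_{k,j}=0$; (g) set the current state to $j$. The iteration is repeated; $\Sigma^K,\Gamma^K$ denote the matrices $\Sigma,\Gamma$ after $K$ iterations (Markov transitions). *)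

(* Defs.v *)
From HB Require Import structures.
From mathcomp Require Import all_boot all_order all_algebra.
From mathcomp Require Import complex.
From mathcomp Require Import all_classical all_reals all_analysis.
Set Implicit Arguments.
Unset Strict Implicit.
Unset Printing Implicit Defensive.
Import Order.TTheory GRing.Theory Num.Theory.
Import numFieldNormedType.Exports.

Local Open Scope classical_set_scope.
Local Open Scope ring_scope.

(* The set below is finite, so for 0 < d the supremum is a maximum. *)
Definition spectral_radius (R : realType) (d : nat) (A : 'M[R]_d) : R :=
  sup [set ComplexField.Normc.normc z |
        z in [set z : R[i] | eigenvalue (map_mx (real_complex R) A) z]].

Definition stochastic (R : realType) (d : nat) (P : 'M[R]_d) : Prop :=
  (forall i j, 0 <= P i j) /\ (forall i, \sum_j P i j = 1).

Definition irreducible_chain (R : realType) (d : nat) (P : 'M[R]_d) : Prop :=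
  forall i j, exists n : nat, 0 < (P ^+ n) i j.

(* p is the gcd of the set of positive return times n of the state i. *)
Definition has_period (R : realType) (d : nat) (P : 'M[R]_d) (i : 'I_d)
    (p : nat) : Prop :=
  (forall n : nat, (0 < n)%N -> 0 < (P ^+ n) i i -> (p %| n)%N) /\
  (forall q : nat,
     (forall n : nat, (0 < n)%N -> 0 < (P ^+ n) i i -> (q %| n)%N) ->
     (q %| p)%N).

Definition aperiodic_chain (R : realType) (d : nat) (P : 'M[R]_d) : Prop :=
  forall i, has_period P i 1.

Definition Hhat (R : realType) (d : nat) (A P : 'M[R]_d) : 'M[R]_d :=
  \matrix_(i, j) (if P i j != 0 then A i j ^+ 2 / P i j else 0).

(* The Markov property is
   Pr(X_0 = x_0, .., X_{n+1} = x_{n+1})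
     = Pr(X_0 = x_0, .., X_n = x_n) P_{x_n, x_{n+1}},
   which avoids conditioning on null events; the law of X_0 is arbitrary. *)
Definition markov_chain (R : realType) (dO : measure_display)
    (Omega : measurableType dO) (Pr : probability Omega R) (d : nat)
    (P : 'M[R]_d) (X : nat -> Omega -> 'I_d) : Prop :=
  (forall (n : nat) (i : 'I_d), measurable (X n @^-1` [set i])) /\
  (forall (n : nat) (x : nat -> 'I_d),
     (Pr [set w | forall k : nat, (k <= n.+1)%N -> X k w = x k] =
      Pr [set w | forall k : nat, (k <= n)%N -> X k w = x k] *
        (P (x n) (x n.+1))%:E)%E).

Record ulam_state (R : realType) (d : nat) := UlamState {
  us_Lambda : 'M[R]_d;
  us_Sigma : 'M[R]_d;
  us_Gamma : 'M[nat]_d;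
  us_cur : 'I_d }.

Definition ulam_init (R : realType) (d : nat) (i : 'I_d) : ulam_state R d :=
  UlamState 0 0 (const_mx 0%N) i.

(* One iteration from the state i = us_cur s, j being the next state of the
   chain. Entry (k, l) of Lambda carries the weight of the current walk from k
   towards l: L1 starts the walks from i, L2 is Lambda after the transition
   i -> j, L3 ends the walks that have reached j. *)
Definition ulam_step (R : realType) (d : nat) (A P : 'M[R]_d)
    (s : ulam_state R d) (j : 'I_d) : ulam_state R d :=
  let i := us_cur s in
  let L1 : 'M[R]_d := \matrix_(l, k)
    (if (l == i) && (us_Lambda s l k == 0) then 1 else us_Lambda s l k) in
  let L2 : 'M[R]_d := (A i j / P i j) *: L1 in
  let G : 'M[nat]_d := \matrix_(k, l)
    (if (l == j) && (L2 k l != 0) then (us_Gamma s k l).+1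
     else us_Gamma s k l) in
  let S : 'M[R]_d := \matrix_(k, l)
    (if l == j then us_Sigma s k l + L2 k l else us_Sigma s k l) in
  let L3 : 'M[R]_d := \matrix_(k, l) (if l == j then 0 else L2 k l) in
  UlamState L3 S G j.

(* State of the recursion after K iterations along the trajectory x of the
   chain; all the randomness of the recursion lies in the trajectory. *)
Fixpoint ulam_run (R : realType) (d : nat) (A P : 'M[R]_d) (x : nat -> 'I_d)
    (K : nat) : ulam_state R d :=
  if K is K'.+1 then ulam_step A P (ulam_run A P x K') (x K)
  else ulam_init R (x 0%N).

Definition symmetric_psd (R : realType) (n : nat) (M : 'M[R]_n) : Prop :=
  M^T = M /\ (forall t : 'rV[R]_n, 0 <= (t *m M *m t^T) 0 0).

(* Univariate N(m, v), parametrized by the variance v. The degenerate case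
   must be separate: the library's [normal_prob m 0] is uniform on [0, 1]. *)
Definition normal_law (R : realType) (m v : R) : set R -> \bar R :=
  if v == 0 then \d_m else normal_prob m (Num.sqrt v).

(* Y ~ N(m, M), M possibly singular: for every t, the law of <t, Y> is
   N(<t, m>, t M t^T). *)
Definition multivariate_normal (R : realType) (dT : measure_display)
    (T : measurableType dT) (Q : probability T R) (n : nat)
    (Y : T -> 'rV[R]_n) (m : 'rV[R]_n) (M : 'M[R]_n) : Prop :=
  (forall i, measurable_fun [set: T] (fun w => Y w 0 i)) /\
  (forall (t : 'rV[R]_n) (B : set R), measurable B ->
     Q ((fun w => \sum_i t 0 i * Y w 0 i) @^-1` B) =
     normal_law (\sum_i t 0 i * m 0 i) ((t *m M *m t^T) 0 0) B).

(* Convergence in distribution (weak convergence of the laws) of random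
   vectors X_k to a random vector Y, possibly on another probability space. *)
Definition cvg_in_distribution (R : realType)
    (dO : measure_display) (Omega : measurableType dO)
    (Pr : probability Omega R) (dT : measure_display) (T : measurableType dT)
    (Q : probability T R) (n : nat)
    (X : nat -> Omega -> 'rV[R]_n) (Y : T -> 'rV[R]_n) : Prop :=
  forall f : 'rV[R]_n -> R, continuous f ->
    (exists b : R, forall x, `|f x| <= b) ->
    ('E_Pr[(fun w => f (X k w))] @[k --> \oo] --> 'E_Q[(fun w => f (Y w))])%E.

Definition cvg_to_normal (R : realType)
    (dO : measure_display) (Omega : measurableType dO)
    (Pr : probability Omega R) (n : nat)
    (X : nat -> Omega -> 'rV[R]_n) (m : 'rV[R]_n) (M : 'M[R]_n) : Prop :=
  exists (dT : measure_display) (T : measurableType dT) (Q : probability T R)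
         (Y : T -> 'rV[R]_n),
    multivariate_normal Q Y m M /\ cvg_in_distribution Pr Q X Y.

(* Main.v *)
(* Write Lambda_q, q = (k, l), for the weight of the current walk from k towards
   l, and put H = Hhat. The current state together with the set of nonzero
   entries of Lambda is a finite Markov chain. It may have transient states, but
   any two of its closed sets meet, because two copies driven by the same path
   of the original chain coalesce; hence its Poisson equation is solvable.
   Adding to Sigma_q the expected final weight of the pending walk and a
   solution of that equation makes every Sigma_q a martingale plus a linear
   drift; the drift carries the factor F_kl of the first-passage decomposition
   C_kl = [k = l] + C_ll F_kl, so it vanishes with C_kl and can be written
   Gamma_s * C.
   The condition rho(H) < 1 yields h > 0 with H h <= r h and r < 1. By
   Cauchy-Schwarz, sqrt h is a strict supersolution for |A|, so that
   conditional covariances of the martingale increments, which are quadratic in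
   Lambda, again admit Poisson solutions; and by continuity in the exponent, h
   gives a Lyapunov function of order |Lambda|^(2 + e), hence uniform
   integrability of |Lambda|^2.
   Multiplying cos (a + th * U), for the martingale U, by 1 - th^2 w / 2 with w
   the Poisson solution for the conditional variance replaces that variance by
   its mean s2 up to an error o(th^2) per step, so characteristic functions
   behave as (1 - s2 / (2 n))^n. Fejer-type kernels turn convergence of characteristic
   functions together with bounded second moments into weak convergence. *)

Require Import Defs.
From HB Require Import structures.
From mathcomp Require Import all_boot all_order all_algebra.
From mathcomp Require Import complex.
From mathcomp Require Import all_classical all_reals all_analysis.
From mathcomp Require Import measurable_realfun.
From mathcomp Require Import ring lra.
Set Implicit Arguments.
Unset Strict Implicit.
Unset Printing Implicit Defensive.
Import Order.TTheory GRing.Theory Num.Theory.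
Import numFieldNormedType.Exports.

Local Open Scope classical_set_scope.
Local Open Scope ring_scope.

(** * Finite linear systems and Perron supersolutions *)

(** [Lambda] may take infinitely many values and need not stay bounded. Two facts restore
    finiteness: which entries restart depends only on the zero pattern of [Lambda], and a step maps
    a monomial in [Lambda], in conditional mean, to a polynomial of the same degree whose
    coefficients depend on that pattern. Every Poisson equation thus reduces to finite linear
    systems, one for each degree 0, 1, 2. Moments are controlled only slightly beyond order two;
    hence errors are measured by [y ^ 2 * min 1 |y|] and not by third moments. At a fixed time the
    state has finitely many possible values, so expectations can be treated as positive linear
    functionals on all functions; measure theory enters only with the trajectory and with the limit
    law. The Gaussian limit may be singular: it is built as a linear image of independent normals,
    and its characteristic function is never put in exponential form but identified as the limit of
    the same powers [(1 - s2 / (2 n)) ^ n] that the chain produces. Cosines with a free phase stand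
    in for complex exponentials throughout. *)

Lemma finite_strict_bound (R : realType) (I : finType) (f : I -> R) (c : R) :
  (forall i, f i < c) -> exists2 r, r < c & forall i, f i <= r.
Proof.
(* The default [c - 1] keeps the maximum below [c] when [I] is empty. *)
move=> fc; exists (\big[Order.max/(c - 1)]_i f i).
  by apply: bigmax_lt => //; rewrite ltrBlDr ltrDl.
by move=> i; apply: le_bigmax.
Qed.

Lemma finite_solvable (R : fieldType) (Z : finType) (T : Z -> Z -> R) :
  (forall f : Z -> R, (forall z, \sum_y T z y * f y = 0) ->
     forall z, f z = 0) ->
  forall g : Z -> R, exists f : Z -> R, forall z, \sum_y T z y * f y = g z.
Proof.
move=> injT g.
pose M : 'M[R]_#|Z| := \matrix_(i, j) T (enum_val i) (enum_val j).
have reE (F : Z -> R) : \sum_y F y = \sum_(j < #|Z|) F (enum_val j).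
  by rewrite (reindex (@enum_val Z Z)) //=; exact/onW_bij/enum_val_bij.
have MtU : M^T \in unitmx.
  rewrite -row_free_unit -kermx_eq0; apply/eqP/row_matrixP => i.
  rewrite row0; set u := row i _.
  have uM : u *m M^T = 0 by apply: sub_kermxP; exact: row_sub.
  clearbody u.
  apply/rowP => j; rewrite [RHS]mxE -(enum_valK j).
  apply: (injT (fun z => u 0 (enum_rank z))) => z.
  rewrite reE; move/rowP/(_ (enum_rank z)): uM; rewrite !mxE => uM; rewrite -[RHS]uM.
  by apply: eq_bigr => k _; rewrite !mxE enum_valK enum_rankK mulrC.
have MU : M \in unitmx by rewrite -unitmx_tr.
pose x := invmx M *m \col_i g (enum_val i).
exists (fun z => x (enum_rank z) 0) => z.
have : M *m x = \col_i g (enum_val i) by rewrite mulKVmx.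
move/colP/(_ (enum_rank z)); rewrite !mxE enum_rankK => <-.
by rewrite reE; apply: eq_bigr => k _; rewrite !mxE enum_valK enum_rankK.
Qed.

(** In the norm [max |f z| / h z] the operator [T] has norm at most [r < 1]; evaluating the
    fixed-point equation at a maximizer is enough. *)
Lemma contraction_unique (R : realType) (Z : finType) (T : Z -> Z -> R)
    (h : Z -> R) (r : R) : r < 1 -> (forall z, 0 < h z) ->
  (forall z, \sum_y `|T z y| * h y <= r * h z) ->
  forall f : Z -> R, (forall z, f z = \sum_y T z y * f y) -> forall z, f z = 0.
Proof.
move=> r1 h0 Th f Hf z0.
have [z _ zmax] : exists2 z, true & forall y, `|f y| / h y <= `|f z| / h z.
  have /= := @arg_maxP _ _ _ z0 xpredT (fun y => `|f y| / h y) isT.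
  by case=> z _ H; exists z => // y; exact: H.
have : `|f z| <= `|f z| / h z * (r * h z).
  rewrite {1}Hf (le_trans (ler_norm_sum _ _ _)) //.
  apply: le_trans (ler_wpM2l _ (Th z)); last by rewrite divr_ge0 // ltW.
  rewrite mulr_sumr; apply: ler_sum => y _; rewrite normrM mulrCA.
  rewrite ler_wpM2l // -ler_pdivrMr //; exact: zmax.
rewrite mulrCA divfK ?gt_eqF // => fz.
have fz0 : `|f z| = 0.
  apply/eqP; rewrite eq_le normr_ge0 andbT leNgt; apply/negP => fz_gt0.
  by move: fz; rewrite leNgt gtr_pMl ?r1.
apply/normr0_eq0/eqP; rewrite eq_le normr_ge0 andbT.
by have := zmax z0; rewrite fz0 mul0r ler_pdivrMr // mul0r.
Qed.

Lemma contraction_solvable (R : realType) (Z : finType) (T : Z -> Z -> R)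
    (h : Z -> R) (r : R) : r < 1 -> (forall z, 0 < h z) ->
  (forall z, \sum_y `|T z y| * h y <= r * h z) ->
  forall g : Z -> R,
    exists f : Z -> R, forall z, f z = g z + \sum_y T z y * f y.
Proof.
move=> r1 h0 Th g.
have sumD (f : Z -> R) z : \sum_y ((y == z)%:R - T z y) * f y =
    f z - \sum_y T z y * f y.
  under eq_bigr do rewrite mulrBl.
  rewrite sumrB (bigD1 z) //= eqxx mul1r big1 ?addr0 // => y /negbTE ->.
  by rewrite mul0r.
have [f Hf|f Hf] := @finite_solvable R Z (fun z y => (y == z)%:R - T z y) _ g;
  last by exists f => z; rewrite -Hf sumD subrK.
apply: (contraction_unique r1 h0 Th) => z.
by apply/eqP; rewrite -subr_eq0 -sumD Hf.
Qed.

(** * From the spectral radius to a strict positive supersolution *)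

Section Perron.
Variables (R : realType) (d : nat) (H : 'M[R]_d).
Hypothesis H_ge0 : forall i j, 0 <= H i j.

(** [sup] dominates its set only when an upper bound exists; the sum of the moduli of all roots of
    the characteristic polynomial is one. *)
Lemma normc_eigenvalue_le_spectral_radius (A : 'M[R]_d) (z : R[i]) :
  eigenvalue (map_mx (real_complex R) A) z ->
  ComplexField.Normc.normc z <= spectral_radius A.
Proof.
move=> Az; apply: sup_ubound; last by exists z.
set M := map_mx _ A in Az *.
have [s Hs] := closed_field_poly_normal (char_poly M).
exists (\sum_(y <- s) ComplexField.Normc.normc y) => _ [y My <-].
have ys : y \in s.
  move: My; rewrite /= eigenvalue_root_char Hs.
  by rewrite (monicP (char_poly_monic _)) scale1r root_prod_XsubC.
rewrite (big_rem y) //= lerDl; apply: sumr_ge0 => {Az My ys Hs}[[a b]] _.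
exact: sqrtr_ge0.
Qed.

Lemma char_poly_neq0 (l : R) : spectral_radius H < 1 -> 1 <= l ->
  (char_poly H).[l] != 0.
Proof.
move=> rho1 l1; apply/negP => Hl.
have : eigenvalue (map_mx (real_complex R) H) (real_complex R l).
  by rewrite eigenvalue_root_char -map_char_poly fmorph_root.
move/normc_eigenvalue_le_spectral_radius; rewrite /= expr0n addr0 sqrtr_sqr.
by move/(le_trans (ler_norm _))/(le_trans l1); rewrite leNgt rho1.
Qed.

Definition subinvariant (l : R) := exists h : 'I_d -> R,
  (forall i, 0 < h i) /\ forall i, \sum_j H i j * h j < l * h i.

(** Minimum principle for [l - H]: at a minimizer of [x / h] with negative value, strictness of the
    supersolution would make [l x - H x] negative. *)
Lemma subinvariant_monotone (h : 'I_d -> R) (l : R) : (forall i, 0 < h i) ->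
  (forall i, \sum_j H i j * h j < l * h i) ->
  forall x : 'I_d -> R, (forall i, 0 <= l * x i - \sum_j H i j * x j) ->
  forall i, 0 <= x i.
Proof.
move=> h0 Hh x Hx i0.
have [i _ imin] : exists2 i, true & forall j, x i / h i <= x j / h j.
  have /= := @arg_minP _ _ _ i0 xpredT (fun y => x y / h y) isT.
  by case=> z _ K; exists z => // y; exact: K.
have xh j : x j = x j / h j * h j by rewrite divfK // gt_eqF.
rewrite xh mulr_ge0 ?(ltW (h0 _)) //; apply: le_trans (imin i0).
rewrite leNgt; apply/negP => m0.
have := Hx i; rewrite leNgt => /negP; apply; rewrite subr_lt0.
rewrite [X in l * X]xh mulrCA; apply: (@lt_le_trans _ _ (x i / h i * \sum_j H i j * h j)).
  by rewrite ltr_nM2l.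
rewrite mulr_sumr; apply: ler_sum => j _; rewrite mulrCA ler_wpM2l //.
by rewrite [leRHS]xh ler_wpM2r // ltW.
Qed.

(** Row sums of the adjugate of [l - H]. Where the characteristic polynomial does not vanish,
    [q / char_poly H] is the resolvent of [H] applied to the constant 1, with entries rational in
    [l]. *)
Let q (i : 'I_d) := \sum_j (\adj (char_poly_mx H)) i j.

Let qP (l : R) i :
  l * (q i).[l] - \sum_j H i j * (q j).[l] = (char_poly H).[l].
Proof.
have: char_poly_mx H *m \adj (char_poly_mx H) = (char_poly H)%:M.
  exact: mul_mx_adj.
move/(congr1 (fun M : 'M[{poly R}]_d => \sum_k (M i k).[l])).
rewrite [RHS](bigD1 i) //= mxE eqxx mulr1n [X in _ = _ + X]big1 ?addr0; last first.
  by move=> k /negbTE ik; rewrite mxE eq_sym ik mulr0n horner0.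
move=> <-; rewrite -horner_sum.
have -> : \sum_k (char_poly_mx H *m \adj (char_poly_mx H)) i k =
          \sum_j (char_poly_mx H) i j * q j.
  under eq_bigr do rewrite mxE.
  by rewrite exchange_big /=; apply: eq_bigr => j _; rewrite mulr_sumr.
clearbody q.
rewrite [RHS]horner_sum; under [RHS]eq_bigr do rewrite hornerM !mxE hornerD hornerN hornerC mulrBl.
rewrite [RHS]sumrB; congr (_ - _).
rewrite [RHS](bigD1 i) //= eqxx mulr1n hornerX big1 ?addr0 // => j /negbTE ij.
by rewrite eq_sym ij mulr0n horner0 mul0r.
Qed.

(** Continuation in [l] from large values down to 1. Let [l0] be the supremum of the [l >= 1]
    without strict supersolution. Above [l0] the minimum principle makes the resolvent applied to 1
    nonnegative; this persists at [l0] by continuity, and [l0 y = 1 + H y] makes it a strict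
    supersolution there. Strictness leaves room below [l0], a contradiction. *)
Lemma perron_subinvariant : spectral_radius H < 1 ->
  exists (h : 'I_d -> R) (r : R), [/\ 0 < r < 1, forall i, 0 < h i &
    forall i, \sum_j H i j * h j <= r * h i].
Proof.
move=> rho1.
suff [h [h0 Hh]] : subinvariant 1.
  have [i|r0 r01 Hr] := @finite_strict_bound R _
      (fun i => (\sum_j H i j * h j) / h i) 1.
    by rewrite ltr_pdivrMr.
  exists h, (Num.max (2^-1) r0); split => // [|i].
    by rewrite lt_max invr_gt0 ltr0n /= gt_max r01 andbT invf_lt1 // ltr1n.
  by rewrite -ler_pdivrMr // le_max Hr orbT.
apply/not_notP => n1.
pose T := [set l : R | 1 <= l /\ ~ subinvariant l].
have subS l l' : l <= l' -> subinvariant l -> subinvariant l'.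
  move=> ll' [h [h0 Hh]]; exists h; split=> // i.
  by apply: lt_le_trans (Hh i) _; rewrite ler_wpM2r // ltW.
have T1 : T 1 by [].
have [b Tb] : exists b, subinvariant b.
  exists (1 + \sum_i \sum_j H i j), (fun=> 1); split => // i; rewrite mulr1.
  apply: (@le_lt_trans _ _ (\sum_i \sum_j H i j)); last by rewrite ltrDr.
  under eq_bigr do rewrite mulr1.
  by rewrite [leRHS](bigD1 i) //= lerDl sumr_ge0 // => k _; exact: sumr_ge0.
have ubT : has_sup T.
  split; first by exists 1.
  exists b => l [_ nl]; rewrite leNgt; apply/negP => bl.
  exact/nl/(subS b)/Tb/ltW.
set l0 := sup T.
have l0_ge1 : 1 <= l0 by apply: sup_ubound => //; exact: ubT.2.
have above l : l0 < l -> subinvariant l.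
  move=> l0l; apply/not_notP => nl; move: (l0l); apply/negP; rewrite -leNgt.
  apply: sup_ubound; first exact: ubT.2.
  by split => //; apply: le_trans l0_ge1 (ltW l0l).
have pn0 l : 1 <= l -> (char_poly H).[l] != 0 by move=> ?; exact: char_poly_neq0.
(* The product with the characteristic polynomial has the sign of the quotient and is itself a
   polynomial, so continuity applies to it. *)
have yP l i : 1 <= l -> subinvariant l -> 0 <= (q i * char_poly H).[l].
  move=> l1 [h [h0 Hh]].
  have := subinvariant_monotone h0 Hh
    (x := fun i => (q i).[l] / (char_poly H).[l]) _ i.
  have sq k : (q k * char_poly H).[l] =
      (q k).[l] / (char_poly H).[l] * (char_poly H).[l] ^+ 2.
    by rewrite hornerM expr2 mulrA divfK ?pn0.
  rewrite sq => K; apply: mulr_ge0; last exact: sqr_ge0.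
  apply: K => k; under eq_bigr do rewrite mulrA.
  by rewrite -mulr_suml mulrA -mulrBl qP divff ?pn0.
have yl0 i : 0 <= (q i * char_poly H).[l0].
  rewrite leNgt; apply/negP => neg.
  have : \forall l \near l0, (q i * char_poly H).[l] < 0.
    have := @continuous_horner R (q i * char_poly H) l0.
    by move/cvgr_lt; apply.
  case/nbhs_ballP => e /= e0 /(_ (l0 + e / 2)).
  rewrite /ball /= opprD addNKr normrN gtr0_norm ?divr_gt0 // ltr_pdivrMr //.
  rewrite mulr_natr mulr2n ltrDl e0 => /(_ isT); apply/negP; rewrite -leNgt.
  apply: yP; last by apply: above; rewrite ltrDl divr_gt0.
  by rewrite (le_trans l0_ge1) // lerDl ltW // divr_gt0.
have Sl0 : subinvariant l0.
  pose y i := (q i).[l0] / (char_poly H).[l0].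
  have yeq i : l0 * y i - \sum_j H i j * y j = 1.
    rewrite /y; under eq_bigr do rewrite mulrA.
    by rewrite -mulr_suml mulrA -mulrBl qP divff ?pn0.
  have y0 i : 0 <= y i.
    have /= : 0 <= (q i * char_poly H).[l0] / (char_poly H).[l0] ^+ 2.
      by rewrite divr_ge0 ?sqr_ge0.
    by rewrite hornerM expr2 invfM mulrA mulfK ?pn0.
  have yE i : l0 * y i = 1 + \sum_j H i j * y j by rewrite -(yeq i) subrK.
  exists y; split => i; last by rewrite yE ltrDr.
  have : 0 < l0 * y i.
    by rewrite yE ltr_pwDl // sumr_ge0 // => j _; rewrite mulr_ge0.
  by rewrite pmulr_rgt0 // (lt_le_trans _ l0_ge1).
case: Sl0 => h [h0 Hh].
have [i|r rl0 Hr] := @finite_strict_bound R _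
    (fun i => (\sum_j H i j * h j) / h i) l0.
  by rewrite ltr_pdivrMr.
(* The supersolution at [l0] has ratios at most [r < l0], so it serves every [l] above the
   midpoint. *)
have : l0 <= (r + l0) / 2.
  apply: sup_le_ub; first by exists 1.
  move=> l [l1 nl]; rewrite leNgt; apply/negP => rl; apply: nl.
  exists h; split => // i; rewrite -ltr_pdivrMr //.
  by apply: le_lt_trans (Hr i) _; apply: lt_trans rl; rewrite ltr_pdivlMr //; lra.
by rewrite ler_pdivlMr //; lra.
Qed.
End Perron.

(** * Importance-sampling weights and first passage *)

Section Weights.
Variables (R : realType) (d : nat) (A P : 'M[R]_d).
Hypothesis P_stoch : stochastic P.
Hypothesis P_supp : forall i j, 0 < P i j <-> A i j <> 0.

Lemma P_ge0 i j : 0 <= P i j. Proof. exact: P_stoch.1. Qed.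

Lemma P_sum1 i : \sum_j P i j = 1. Proof. exact: P_stoch.2. Qed.

Lemma P_eq0 i j : (P i j == 0) = (A i j == 0).
Proof.
apply/eqP/eqP => [P0|A0].
  by apply/not_notP => /P_supp; rewrite P0 ltxx.
apply/eqP; rewrite eq_le P_ge0 andbT leNgt; apply/negP => /P_supp; exact.
Qed.

Lemma P_gt0 i j : (0 < P i j) = (A i j != 0).
Proof. by rewrite lt_def P_ge0 andbT P_eq0. Qed.

Lemma P_weight i j : P i j * (A i j / P i j) = A i j.
Proof.
have [P0|P0] := eqVneq (P i j) 0; last by rewrite mulrC divfK.
by rewrite P0 mul0r; apply/esym/eqP; rewrite -P_eq0 P0.
Qed.

(** [Hhat] is the kernel of second moments of the one-step weight [A / P]. *)
Lemma HhatE i j : Hhat A P i j = P i j * (A i j / P i j) ^+ 2.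
Proof.
rewrite mxE; have [P0|P0] := eqVneq (P i j) 0; first by rewrite P0 mul0r.
by rewrite expr2 mulrA P_weight mulrA -expr2.
Qed.

Lemma Hhat_ge0 i j : 0 <= Hhat A P i j.
Proof. by rewrite HhatE mulr_ge0 ?P_ge0 ?sqr_ge0. Qed.

(* Cauchy-Schwarz with |A| = sqrt (P * Hhat) entrywise. *)
Lemma abs_subinvariant (h : 'I_d -> R) (r : R) : 0 < r -> (forall i, 0 < h i) ->
  (forall i, \sum_j Hhat A P i j * h j <= r * h i) ->
  forall i, \sum_j `|A i j| * Num.sqrt (h j) <= Num.sqrt r * Num.sqrt (h i).
Proof.
move=> r0 h0 Hh i; set c := Num.sqrt r * Num.sqrt (h i).
have c0 : 0 < c by rewrite mulr_gt0 // sqrtr_gt0.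
have cc : c ^+ 2 = r * h i by rewrite exprMn !sqr_sqrtr // ltW.
have -> : c = (c + c ^+ 2 / c) / 2 by field; rewrite gt_eqF.
apply: (@le_trans _ _ (\sum_j (c * P i j + Hhat A P i j * h j / c) / 2)).
  apply: ler_sum => j _.
  have [P0|P0] := eqVneq (P i j) 0.
    move: (P0) => /eqP; rewrite P_eq0 => /eqP ->; rewrite normr0 mul0r.
    by rewrite P0 mulr0 add0r mxE P0 eqxx /= !mul0r.
  rewrite mxE P0 -subr_ge0; set s := Num.sqrt (h j).
  have <- : s ^+ 2 = h j by rewrite sqr_sqrtr // ltW.
  rewrite -(real_normK (num_real (A i j))).
  have -> : (c * P i j + `|A i j| ^+ 2 / P i j * s ^+ 2 / c) / 2 - `|A i j| * s =
    (c * P i j - `|A i j| * s) ^+ 2 / (2 * c * P i j).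
    by field; rewrite P0 gt_eqF.
  by rewrite divr_ge0 ?sqr_ge0 // !mulr_ge0 // ?P_ge0 // ltW.
rewrite -mulr_suml ler_wpM2r // big_split /= -mulr_sumr P_sum1 mulr1.
by rewrite lerD2l -mulr_suml cc ler_wpM2r // invr_ge0 ltW.
Qed.

(** [F i] is the total weight of the walks from [i] stopped at their first arrival in [l]; deleting
    column [l] from [A] preserves the contraction weighted by [g]. *)
Lemma first_passage_solvable (g : 'I_d -> R) (r : R) (l : 'I_d) : r < 1 ->
  (forall i, 0 < g i) -> (forall i, \sum_j `|A i j| * g j <= r * g i) ->
  exists F : 'I_d -> R,
    forall i, F i = A i l + \sum_(j | j != l) A i j * F j.
Proof.
move=> r1 g0 Ag.
have [i|F HF] := contraction_solvable (T := fun i j => A i j * (j != l)%:R) r1 g0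
  _ (fun i => A i l).
  apply: le_trans (Ag i); apply: ler_sum => j _.
  by rewrite normrM normr_nat ler_wpM2r ?(ltW (g0 _)) // ler_piMr // lern1 leq_b1.
exists F => i; rewrite {1}HF; congr (_ + _); rewrite [RHS]big_mkcond /=.
by apply: eq_bigr => j _; case: eqP; rewrite ?mulr1 // mulr0 mul0r.
Qed.

Lemma resolvent_unit : spectral_radius A < 1 -> 1%:M - A \in unitmx.
Proof.
move=> rho1; rewrite unitmxE unitfE.
have := char_poly_neq0 rho1 (lexx 1).
rewrite /char_poly -horner_evalE -det_map_mx.
congr (\det _ != 0); apply/matrixP => i j.
rewrite !mxE /= /horner_eval hornerD hornerN hornerC.
by case: eqP => _; rewrite ?mulr1n ?mulr0n ?hornerX ?horner0.
Qed.

(* Decompose the walks from i to l at their first passage through l. *)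
Lemma first_passage_resolvent (g : 'I_d -> R) (r : R) (l : 'I_d)
    (F : 'I_d -> R) : spectral_radius A < 1 -> r < 1 ->
  (forall i, 0 < g i) -> (forall i, \sum_j `|A i j| * g j <= r * g i) ->
  (forall i, F i = A i l + \sum_(j | j != l) A i j * F j) ->
  forall i, invmx (1%:M - A) i l = (i == l)%:R + invmx (1%:M - A) l l * F i.
Proof.
move=> rho1 r1 g0 Ag HF; set C := invmx _.
have CE i : C i l = (i == l)%:R + \sum_j A i j * C j l.
  have /matrixP/(_ i l) : (1%:M - A) *m C = 1%:M.
    by rewrite mulmxV // resolvent_unit.
  rewrite mulmxBl mul1mx !mxE => /eqP; rewrite subr_eq => /eqP ->.
  by [].
pose e i := C i l - (i == l)%:R - C l l * F i.
have eE i : e i = \sum_j (A i j * (j != l)%:R) * e j.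
  have -> : \sum_j (A i j * (j != l)%:R) * e j =
    \sum_(j | j != l) A i j * e j.
    rewrite [RHS]big_mkcond /=.
    by apply: eq_bigr => j _; case: eqP; rewrite ?mulr1 // mulr0 mul0r.
  have -> : \sum_(j | j != l) A i j * e j =
    \sum_(j | j != l) A i j * C j l - C l l * \sum_(j | j != l) A i j * F j.
    rewrite mulr_sumr -sumrB; apply: eq_bigr => j /negbTE jl.
    by rewrite /e jl subr0; ring.
  rewrite /e {1}CE {1}HF (bigD1 l) //=; ring.
have e0 i : e i = 0.
  apply: (contraction_unique r1 g0 _ eE) => k.
  apply: le_trans (Ag k); apply: ler_sum => j _.
  by rewrite normrM normr_nat ler_wpM2r ?(ltW (g0 _)) // ler_piMr // lern1 leq_b1.
by move=> i; move/eqP: (e0 i); rewrite /e -addrA -opprD subr_eq0 => /eqP.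
Qed.
End Weights.

(** * The Poisson equation on a finite chain *)

Section Poisson.
Variables (R : realType) (J Z : finType) (p : Z -> J -> R) (nxt : Z -> J -> Z).
Hypothesis p_ge0 : forall z j, 0 <= p z j.
Hypothesis p_sum1 : forall z, \sum_j p z j = 1.

Lemma supermean_max (f : Z -> R) (b : R) (z : Z) : (forall y, f y <= b) ->
  b <= \sum_j p z j * f (nxt z j) -> forall j, 0 < p z j -> f (nxt z j) = b.
Proof.
move=> fb bz j pj.
have le0 k : 0 <= p z k * (b - f (nxt z k)) by rewrite mulr_ge0 // subr_ge0.
have : \sum_k p z k * (b - f (nxt z k)) <= 0.
  under eq_bigr do rewrite mulrBr.
  by rewrite sumrB -mulr_suml p_sum1 mul1r subr_le0.
rewrite (bigD1 j) //= => H.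
have : p z j * (b - f (nxt z j)) <= 0.
  by apply: le_trans H; rewrite lerDl sumr_ge0.
by rewrite pmulr_rle0 // subr_le0 => H1; apply/eqP; rewrite eq_le fb.
Qed.

Definition closed_states (C : Z -> Prop) :=
  forall z j, C z -> 0 < p z j -> C (nxt z j).

Hypothesis unichain : forall C1 C2 : Z -> Prop,
  closed_states C1 -> closed_states C2 ->
  (exists z, C1 z) -> (exists z, C2 z) -> exists z, C1 z /\ C2 z.

Lemma finite_max (f : Z -> R) (z0 : Z) : exists z, forall y, f y <= f z.
Proof.
have /= := @arg_maxP _ _ _ z0 xpredT f isT.
by case=> z _ H; exists z => y; exact: H.
Qed.

(** The sets where [f] attains its maximum and its minimum are both closed under the chain, so they
    share a point. *)
Lemma harmonic_constant (f : Z -> R) :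
  (forall z, f z = \sum_j p z j * f (nxt z j)) -> forall z y, f z = f y.
Proof.
move=> Hf z0 y0.
have [z1 m1] := finite_max f z0.
have [z2 m2] := finite_max (fun z => - f z) z0.
have [z [e1 e2]] : exists z, f z = f z1 /\ - f z = - f z2.
  apply: (unichain (C1 := fun z => f z = f z1) (C2 := fun z => - f z = - f z2)).
  - by move=> z j fz; apply: (supermean_max m1); rewrite -Hf fz.
  - move=> z j fz; apply: (supermean_max (f := fun z => - f z) m2).
    by under eq_bigr do rewrite mulrN; rewrite sumrN -Hf fz.
  - by exists z1.
  - by exists z2.
have e12 : f z1 = f z2 by rewrite -e1; apply: oppr_inj.
have cst y : f y = f z1.
  by apply/eqP; rewrite eq_le m1 e12 -lerN2 m2.
by rewrite !cst.
Qed.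

(** Constants lie in the kernel of the identity minus the transition operator. Adding the rank-one
    term [f z0] makes the operator injective, and the value of this term at the solution becomes the
    constant [c]. *)
Lemma poisson_solvable (z0 : Z) (v : Z -> R) : exists (w : Z -> R) (c : R),
  forall z, \sum_j p z j * w (nxt z j) = w z - v z + c.
Proof.
pose T z y : R := (y == z)%:R - \sum_j p z j * (nxt z j == y)%:R + (y == z0)%:R.
have TE f z : \sum_y T z y * f y =
    f z - \sum_j p z j * f (nxt z j) + f z0.
  have ind z1 : \sum_y (y == z1)%:R * f y = f z1.
    rewrite (bigD1 z1) //= eqxx mul1r big1 ?addr0 // => y /negbTE ->.
    by rewrite mul0r.
  under eq_bigr do rewrite 2!mulrDl mulNr.
  rewrite !big_split /= !ind sumrN; congr (_ - _ + _).
  under [LHS]eq_bigr => y _ do rewrite mulr_suml.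
  rewrite exchange_big /=; apply: eq_bigr => j _.
  rewrite -(ind (nxt z j)) mulr_sumr; apply: eq_bigr => y _.
  by rewrite eq_sym mulrA.
have [f Hf z|w Hw] := @finite_solvable R Z T _ v; last first.
  exists w, (w z0) => z; rewrite -Hw TE; ring.
(* A kernel element satisfies this identity; at a maximizer it forces [f z0 <= 0], at a minimizer
   [f z0 >= 0], and then [f] is harmonic. *)
have Qf y : \sum_j p y j * f (nxt y j) = f y + f z0.
  by have /eqP := Hf y; rewrite TE addrAC subr_eq0 => /eqP ->.
have f0 : f z0 = 0.
  apply/eqP; rewrite eq_le; apply/andP; split.
    have [z1 m1] := finite_max f z0.
    rewrite -(lerD2l (f z1)) -Qf addr0 -[leRHS]mul1r -(p_sum1 z1) mulr_suml.
    by apply: ler_sum => j _; rewrite ler_wpM2l.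
  have [z1 m1] := finite_max (fun z => - f z) z0.
  rewrite -(lerD2l (f z1)) -Qf addr0 -[leLHS]mul1r -(p_sum1 z1) mulr_suml.
  by apply: ler_sum => j _; rewrite ler_wpM2l // -lerN2.
by rewrite (harmonic_constant _ z z0) // => y; rewrite Qf f0 addr0.
Qed.

End Poisson.

(** * The finite chain of zero patterns and its coalescence *)

Section Flags.
Variables (R : realType) (d : nat) (P : 'M[R]_d).
Hypothesis P_stoch : stochastic P.
Hypothesis P_irr : irreducible_chain P.

Definition flag_state := ('I_d * {set 'I_d * 'I_d})%type.

Definition flag_start (z : flag_state) (q : 'I_d * 'I_d) : bool :=
  (z.1 == q.1) && (q \notin z.2).

Definition flag_step (z : flag_state) (j : 'I_d) : flag_state :=
  (j, [set q | (q.2 != j) && ((q \in z.2) || (z.1 == q.1))]%SET).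

Let p (z : flag_state) j := P z.1 j.

Lemma expmx_ge0 n i j : 0 <= (P ^+ n) i j.
Proof.
elim: n i j => [|n IH] i j; first by rewrite expr0 !mxE ler0n.
by rewrite exprS !mxE; apply: sumr_ge0 => k _; rewrite mulr_ge0 // P_stoch.1.
Qed.

(** At least one step is required, also when [i = j]: only an arrival in [j] erases the flags of
    column [j]. *)
Lemma positive_path i j : exists n, 0 < (P ^+ n.+1) i j.
Proof.
have [k Pik] : exists k, 0 < P i k.
  apply/not_existsP => H; have := P_stoch.2 i; apply/eqP.
  rewrite big1 ?(eq_sym 0) ?oner_eq0 // => k _.
  by apply/eqP; rewrite eq_le P_stoch.1 andbT leNgt; apply/negP/H.
have [n Pn] := P_irr k j; exists n; rewrite exprS !mxE.
rewrite (bigD1 k) //= ltr_pwDl ?mulr_gt0 //.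
by apply: sumr_ge0 => l _; rewrite mulr_ge0 ?expmx_ge0 ?P_stoch.1.
Qed.

Definition flag_diff (a b : {set 'I_d * 'I_d}) :=
  [set q | (q \in a) (+) (q \in b)]%SET.

(** A common step creates no disagreement: a start sets the same flags in both copies, and an
    arrival in [j] erases column [j] in both. *)
Lemma closed_flag_path (C1 C2 : flag_state -> Prop) :
  closed_states p flag_step C1 -> closed_states p flag_step C2 ->
  forall n i j a b, C1 (i, a) -> C2 (i, b) -> 0 < (P ^+ n) i j ->
  exists a' b', [/\ C1 (j, a'), C2 (j, b'),
    flag_diff a' b' \subset flag_diff a b &
    (0 < n)%N -> forall q, q \in flag_diff a' b' -> q.2 != j].
Proof.
move=> c1 c2; elim=> [|n IH] i j a b C1i C2i.
  rewrite expr0 !mxE; case: eqP => [<- _|_]; last by rewrite ltxx.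
  by exists a, b.
rewrite exprSr !mxE => Pn.
have [k Pk] : exists k, 0 < (P ^+ n) i k * P k j.
  apply/not_existsP => H; move: Pn; apply/negP; rewrite -leNgt.
  by apply: sumr_le0 => k _; rewrite leNgt; apply/negP/H.
have Pkj : 0 < P k j.
  rewrite lt_def P_stoch.1 andbT; apply/eqP => P0.
  by move: Pk; rewrite P0 mulr0 ltxx.
rewrite pmulr_lgt0 // in Pk.
have [a' [b' [C1k C2k ss _]]] := IH _ _ _ _ C1i C2i Pk.
exists (flag_step (k, a') j).2, (flag_step (k, b') j).2; split.
- exact: (c1 (k, a') j C1k Pkj).
- exact: (c2 (k, b') j C2k Pkj).
- apply: fintype.subset_trans ss; apply/fintype.subsetP => q; rewrite !inE /=.
  by case: (q.2 == j) => //=; case: (k == q.1); rewrite ?orbT ?orbF.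
- by move=> _ q; rewrite !inE /=; case: (q.2 == j).
Qed.

(** Induction on the number of flags on which two copies at the same state disagree: a path to [q.2]
    removes the disagreement at [q] and adds none. *)
Lemma flag_unichain (C1 C2 : flag_state -> Prop) :
  closed_states p flag_step C1 -> closed_states p flag_step C2 ->
  (exists z, C1 z) -> (exists z, C2 z) -> exists z, C1 z /\ C2 z.
Proof.
move=> c1 c2 [[x a] Ca] [[y b] Cb].
have {y b Cb} [b Cb] : exists b, C2 (x, b).
  have [n Pn] := P_irr y x.
  by have [_ [b' [_ ? _ _]]] := closed_flag_path c2 c2 Cb Cb Pn; exists b'.
have [m] := ubnP #|flag_diff a b|.
elim: m x a b Ca Cb => // m IH x a b Ca Cb; rewrite ltnS => dm.
have [d0|[q qd]] := set_0Vmem (flag_diff a b).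
  exists (x, a); split => //; suff -> : a = b by [].
  apply/setP => q; have := finset.in_set0 q; rewrite -d0 inE.
  by case: (q \in a); case: (q \in b).
have [n Pn] := positive_path x q.2.
have [a' [b' [Ca' Cb' ss /(_ isT) H]]] := closed_flag_path c1 c2 Ca Cb Pn.
apply: (IH _ _ _ Ca' Cb'); apply: leq_trans dm; apply: proper_card.
apply/properP; split => //; exists q => //.
by apply/negP => /H; rewrite eqxx.
Qed.

Lemma flag_poisson (x0 : 'I_d) (v : flag_state -> R) :
  exists (w : flag_state -> R) (c : R),
  forall z, \sum_j P z.1 j * w (flag_step z j) = w z - v z + c.
Proof.
apply: (@poisson_solvable R _ _ (fun z j => P z.1 j)) (x0, finset.set0) v => //.
- by move=> z j; exact: P_stoch.1.
- by move=> z; exact: P_stoch.2.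
- exact: flag_unichain.
Qed.

End Flags.

(** * A central limit theorem for additive functionals *)

Section TrigBounds.
Variable R : realType.
Implicit Types x y : R.

Lemma nonneg_of_nonneg_derive (f df : R -> R) :
  (forall x, is_derive x 1 f (df x)) -> (forall x, 0 <= x -> 0 <= df x) ->
  f 0 = 0 -> forall x, 0 <= x -> 0 <= f x.
Proof.
move=> fd df0 f0 x x0.
have fc : {within `[0, x], continuous f}.
  apply: continuous_subspaceT => y.
  by apply: differentiable_continuous; apply/derivable1_diffP; case: (fd y).
have [c c0x] := MVT_segment x0 (fun y _ => fd y) fc.
rewrite f0 !subr0 => ->; rewrite mulr_ge0 // df0 //.
by move: c0x; rewrite in_itv /= => /andP[].
Qed.

Lemma sin_le x : 0 <= x -> sin x <= x.
Proof.
move=> x0; rewrite -subr_ge0.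
apply: (@nonneg_of_nonneg_derive (fun x => x - sin x) (fun x => 1 - cos x)) => //.
by rewrite sin0 subr0.
Qed.

Lemma norm_sin_le x : `|sin x| <= `|x|.
Proof.
wlog x0 : x / 0 <= x.
  move=> H; have [/H//|/ltW x0] := leP 0 x.
  by rewrite -normrN -sinN -(normrN x) H // oppr_ge0.
rewrite (ger0_norm x0) ler_norml sin_le // andbT.
rewrite -subr_ge0 opprK.
apply: (@nonneg_of_nonneg_derive (fun x => sin x + x) (fun x => cos x + 1)) => //.
by rewrite sin0 addr0.
Qed.

Lemma one_sub_cosE x : 1 - cos x = 2 * sin (x / 2) ^+ 2.
Proof.
rewrite {1}(_ : x = (x / 2) *+ 2); last by rewrite -mulr_natr divfK.
rewrite cos_mulr2n cos2sin2; ring.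
Qed.

Lemma one_sub_cos_le x : 1 - cos x <= x ^+ 2 / 2.
Proof.
rewrite one_sub_cosE -(real_normK (num_real (sin _))).
apply: (@le_trans _ _ (2 * `|x / 2| ^+ 2)).
  by rewrite ler_pM2l // lerXn2r ?nnegrE // norm_sin_le.
by rewrite real_normK ?num_real // expr_div_n; lra.
Qed.

Lemma sub_sin_le x : 0 <= x -> x - sin x <= x ^+ 3 / 6.
Proof.
move=> x0; rewrite -subr_ge0.
apply: (@nonneg_of_nonneg_derive (fun x => x ^+ 3 / 6 - (x - sin x))
  (fun x => x ^+ 2 / 2 - (1 - cos x))) => //.
- move=> y; apply: is_derive_eq; rewrite /GRing.scale /=; by field.
- by move=> y _; rewrite subr_ge0; exact: one_sub_cos_le.
- by rewrite sin0 subr0 expr0n /= mul0r subr0.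
Qed.

Lemma norm_sin_sub_le x : `|sin x - x| <= `|x| ^+ 3 / 6.
Proof.
wlog x0 : x / 0 <= x.
  move=> H; have [/H//|/ltW x0] := leP 0 x.
  by move: (H (- x)); rewrite oppr_ge0 sinN -opprD !normrN => ->.
by rewrite distrC (ger0_norm x0) ger0_norm ?sub_sin_le // subr_ge0 sin_le.
Qed.

(** Truncation for two regimes at once: at most 1, so that errors need only second moments, and at
    most [|y|], so that they are small for small [y]. *)
Definition min1 (y : R) := Num.min 1 `|y|.

Lemma min1_ge0 y : 0 <= min1 y.
Proof. by rewrite le_min ler01 normr_ge0. Qed.

Lemma norm_sin_min1 y : `|sin y| <= min1 y.
Proof. by rewrite le_min sin_max norm_sin_le. Qed.

Lemma norm_cos1_min1 y : `|cos y - 1| <= 2 * min1 y.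
Proof.
rewrite distrC ger0_norm ?subr_ge0 ?cos_le1 //.
rewrite /min1; case: (leP 1 `|y|) => y1.
  by have := cos_geN1 y; lra.
apply: le_trans (one_sub_cos_le y) _.
rewrite -(real_normK (num_real y)); have := normr_ge0 y; nra.
Qed.

Lemma norm_sin_sub_min1 y : `|sin y - y| <= 2 * (y ^+ 2 * min1 y).
Proof.
rewrite -(real_normK (num_real y)) /min1; case: (leP 1 `|y|) => y1.
  apply: (@le_trans _ _ (`|y| + `|y|)).
    by apply: le_trans (ler_normB _ _) _; rewrite lerD2r norm_sin_le.
  nra.
apply: le_trans (norm_sin_sub_le y) _.
by rewrite -exprSr; have := exprn_ge0 3 (normr_ge0 y); lra.
Qed.

Lemma norm_cos_sub_min1 y : `|cos y - 1 + y ^+ 2 / 2| <= y ^+ 2 * min1 y.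
Proof.
have -> : cos y - 1 + y ^+ 2 / 2 = y ^+ 2 / 2 - (1 - cos y) by ring.
have H0 : 0 <= y ^+ 2 / 2 - (1 - cos y) by rewrite subr_ge0 one_sub_cos_le.
rewrite ger0_norm //; move: H0.
(* Half-angle formula: a difference of squares whose first factor is cubic in [|y|]. *)
have -> : y ^+ 2 / 2 - (1 - cos y) =
    2 * ((`|y| / 2) - sin (`|y| / 2)) * ((`|y| / 2) + sin (`|y| / 2)).
  have -> : 1 - cos y = 2 * sin (`|y| / 2) ^+ 2.
    by rewrite -one_sub_cosE cos_norm.
  by rewrite -(real_normK (num_real y)); field.
move=> _; rewrite -[in leRHS](real_normK (num_real y)).
have := normr_ge0 y; rewrite /min1; set t := `|y| => t0.
have t20 : 0 <= t / 2 by rewrite divr_ge0.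
have s1 := sin_le t20; have s2 := sub_sin_le t20.
have s3 : - (t / 2) <= sin (t / 2).
  by have := norm_sin_le (t / 2); rewrite ler_norml (ger0_norm t20) => /andP[].
case: (leP 1 t) => t1; first by nra.
apply: (@le_trans _ _ (2 * ((t / 2) ^+ 3 / 6) * (t / 2 + t / 2))).
  apply: ler_pM => //; [lra | lra | lra | lra].
rewrite -exprSr.
have -> : 2 * ((t / 2) ^+ 3 / 6) * (t / 2 + t / 2) = t ^+ 3 * (t / 24) by field.
by rewrite ler_piMr ?exprn_ge0 //; lra.
Qed.

End TrigBounds.

Section MeanFunctional.
Variables (R : realType) (S : Type).

(** Expectation without measurability conditions; this fits laws with finite support. *)
Record mean_functional (m : (S -> R) -> R) : Prop := MeanFunctional {
  meanD : forall f g, m (fun s => f s + g s) = m f + m g;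
  meanZ : forall c f, m (fun s => c * f s) = c * m f;
  mean_ge0 : forall f, (forall s, 0 <= f s) -> 0 <= m f;
  mean1 : m (fun=> 1) = 1 }.

Variable m : (S -> R) -> R.
Hypothesis mP : mean_functional m.

Lemma meanB f g : m (fun s => f s - g s) = m f - m g.
Proof.
rewrite (meanD mP f (fun s => - g s)); congr (_ + _).
rewrite -mulN1r -(meanZ mP); congr (m _).
by apply/funext => s; rewrite mulN1r.
Qed.

Lemma mean_le f g : (forall s, f s <= g s) -> m f <= m g.
Proof.
by move=> fg; rewrite -subr_ge0 -meanB (mean_ge0 mP) // => s; rewrite subr_ge0.
Qed.

Lemma mean_cst c : m (fun=> c) = c.
Proof.
rewrite -[RHS]mulr1 -(mean1 mP) -(meanZ mP); congr (m _).
by apply/funext => s; rewrite mulr1.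
Qed.

Lemma norm_mean_le f g : (forall s, `|f s| <= g s) -> `|m f| <= m g.
Proof.
move=> fg; rewrite ler_norml; apply/andP; split.
  rewrite -mulN1r -(meanZ mP); apply: mean_le => s; rewrite mulN1r.
  by have := fg s; rewrite ler_norml => /andP[].
by apply: mean_le => s; apply: le_trans (ler_norm _) (fg s).
Qed.

End MeanFunctional.

(** * Scalar central limit theorem for a chain with martingale correctors *)

Section MarkovCLT.
Variables (R : realType) (S : Type) (J : finType).
Variables (p : S -> J -> R) (nxt : S -> J -> S) (m : nat -> (S -> R) -> R).
Hypothesis p_ge0 : forall s j, 0 <= p s j.
Hypothesis p_sum1 : forall s, \sum_j p s j = 1.
Hypothesis mP : forall n, mean_functional (m n).
Hypothesis m_step : forall n f, m n.+1 f = m n (fun s => \sum_j p s j * f (nxt s j)).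

(** [T] is the observed sum, [U] its corrected version with constant drift [mu], [w] the Poisson
    solution for the conditional variance [v] with mean [sigma2], and [M] a majorant with bounded
    second moment; [c] is one constant for all bounds. *)
Variables (T U w M : S -> R) (mu sigma2 c c2 : R).
Let D s j := U (nxt s j) - U s - mu.
Let v s := \sum_j p s j * D s j ^+ 2.
Hypothesis T0 : forall f : R -> R, m 0 (fun s => f (T s)) = f 0.
Hypothesis TU : forall s, `|T s - U s| <= c * M s.
Hypothesis drift : forall s, \sum_j p s j * U (nxt s j) = U s + mu.
Hypothesis wE : forall s, \sum_j p s j * w (nxt s j) = w s - v s + sigma2.
Hypothesis c1 : 1 <= c.
Hypothesis M1 : forall s, 1 <= M s.
Hypothesis DM : forall s j, `|D s j| <= c * M s.
Hypothesis wM : forall s, `|w s| <= c * M s ^+ 2.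
Hypothesis wM' : forall s j, `|w (nxt s j)| <= c * M s ^+ 2.
Hypothesis M2 : forall n, m n (fun s => M s ^+ 2) <= c2.

Let c_gt0 : 0 < c. Proof. exact: lt_le_trans c1. Qed.
Let M_gt0 s : 0 < M s. Proof. exact: lt_le_trans (M1 s). Qed.

Let step_ge0 (f : J -> R) s : (forall j, 0 <= f j) -> 0 <= \sum_j p s j * f j.
Proof. by move=> f0; apply: sumr_ge0 => j _; rewrite mulr_ge0. Qed.

Let step_le (f g : J -> R) s : (forall j, f j <= g j) ->
  \sum_j p s j * f j <= \sum_j p s j * g j.
Proof. by move=> fg; apply: ler_sum => j _; rewrite ler_wpM2l. Qed.

Let step_cst (k : R) s : \sum_j p s j * k = k.
Proof. by rewrite -mulr_suml p_sum1 mul1r. Qed.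

Let step_norm_le (f : J -> R) (k : R) s : (forall j, `|f j| <= k) ->
  `|\sum_j p s j * f j| <= k.
Proof.
move=> fk; apply: le_trans (ler_norm_sum _ _ _) _.
rewrite -[leRHS](step_cst k s); apply: ler_sum => j _.
by rewrite normrM (ger0_norm (p_ge0 _ _)) ler_wpM2l.
Qed.

Let drift0 s : \sum_j p s j * D s j = 0.
Proof.
under eq_bigr do rewrite /D -addrA -opprD mulrBr.
by rewrite sumrB drift step_cst subrr.
Qed.

Let v_ge0 s : 0 <= v s.
Proof. by apply: step_ge0 => j; exact: sqr_ge0. Qed.

Let v_le s : v s <= c ^+ 2 * M s ^+ 2.
Proof.
rewrite -[leRHS](step_cst _ s); apply: step_le => j.
rewrite -exprMn -(real_normK (num_real (D s j))) lerXn2r ?nnegrE //.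
by rewrite mulr_ge0 // ltW.
Qed.

Let c2_ge0 : 0 <= c2.
Proof. by apply: le_trans (M2 0); apply: (mean_ge0 (mP _)) => s; exact: sqr_ge0. Qed.

(** As [v >= 0], the mean of [w] at time [n] is at most its initial value plus [n * sigma2]. It is
    also bounded, so [sigma2] cannot be negative. *)
Lemma asymptotic_variance_ge0 : 0 <= sigma2.
Proof.
have H n : - (2 * c * c2) <= n%:R * sigma2.
  have wb k : `|m k w| <= c * c2.
    apply: le_trans (norm_mean_le (mP k) wM) _.
    by rewrite (meanZ (mP k)) ler_pM2l.
  have : m n w <= m 0%N w + n%:R * sigma2.
    elim: n => [|n IH]; first by rewrite mul0r addr0.
    rewrite m_step -natr1 mulrDl mul1r addrA.
    apply: (@le_trans _ _ (m n w + sigma2)); last by rewrite lerD2r.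
    rewrite -[X in _ <= _ + X](mean_cst (mP n)) -(meanD (mP n)).
    apply: (mean_le (mP n)) => s; rewrite wE lerD2r lerBlDr lerDl; exact: v_ge0.
  have := wb n; have := wb 0%N; rewrite !ler_norml => /andP[_ h1] /andP[h2 _].
  lra.
rewrite leNgt; apply/negP => s0.
have [n Hn] : exists n, - sigma2 * n%:R > 2 * c * c2.
  exists (Num.Def.archi_bound (2 * c * c2 / - sigma2)).
  rewrite [ltRHS]mulrC -ltr_pdivrMr ?oppr_gt0 //; apply: archi_boundP.
  by rewrite divr_ge0 ?oppr_ge0 ?mulr_ge0 // ltW.
have := H n; move: Hn; rewrite mulNr mulrC; lra.
Qed.

(** Martingale increments are orthogonal, so each step adds only the mean of [v], at most
    [c ^ 2 * c2], to the centred second moment of [U]; passing between [T] and [U] costs factors 2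
    and bounded terms. *)
Lemma second_moment_bound n :
  m n (fun s => (T s - n%:R * mu) ^+ 2) <= (6 * c ^+ 2 * c2) * n.+1%:R.
Proof.
have sqTU (x y z : R) : `|x - y| <= c * z -> (x ^+ 2 <= 2 * y ^+ 2 + 2 * (c ^+ 2 * z ^+ 2)).
  move=> xyz; have H : (x - y) ^+ 2 <= c ^+ 2 * z ^+ 2.
    rewrite -exprMn -(real_normK (num_real (x - y))) lerXn2r ?nnegrE //.
    exact: le_trans xyz.
  have := sqr_ge0 (x - 2 * y); lra.
have U2 k : m k (fun s => (U s - k%:R * mu) ^+ 2) <= 2 * c ^+ 2 * c2 * k.+1%:R.
  elim: k => [|k IH].
    rewrite mulr1; apply: (@le_trans _ _ (m 0%N (fun s => 2 * T s ^+ 2 +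
        2 * c ^+ 2 * M s ^+ 2))).
      apply: (mean_le (mP _)) => s; rewrite mul0r subr0 -mulrA.
      by apply: sqTU; rewrite distrC.
    rewrite (meanD (mP _)) (T0 (fun t => 2 * t ^+ 2)) expr0n mulr0 add0r.
    by rewrite (meanZ (mP _)) ler_wpM2l // mulr_ge0 ?sqr_ge0.
  rewrite m_step.
  apply: (@le_trans _ _ (m k (fun s => (U s - k%:R * mu) ^+ 2 + c ^+ 2 * M s ^+ 2))).
    apply: (mean_le (mP _)) => s.
    have -> : \sum_j p s j * (U (nxt s j) - k.+1%:R * mu) ^+ 2 =
        (U s - k%:R * mu) ^+ 2 + v s.
      transitivity (\sum_j (p s j * (U s - k%:R * mu) ^+ 2 +
        2 * (U s - k%:R * mu) * (p s j * D s j) + p s j * D s j ^+ 2)).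
        by apply: eq_bigr => j _; rewrite /D -natr1; ring.
      rewrite !big_split /= -mulr_sumr drift0 mulr0 addr0; congr (_ + _).
      exact: step_cst.
    by rewrite lerD2l.
  rewrite (meanD (mP _)) (meanZ (mP _)) -[k.+2%:R]natr1 mulrDr mulr1.
  apply: lerD => //; rewrite -[in leRHS]mulrA mulr_natl mulr2n.
  apply: ler_wpDr; first by rewrite mulr_ge0 ?sqr_ge0.
  by rewrite ler_wpM2l ?sqr_ge0.
apply: (@le_trans _ _ (m n (fun s => 2 * (U s - n%:R * mu) ^+ 2 +
    2 * c ^+ 2 * M s ^+ 2))).
  apply: (mean_le (mP _)) => s; rewrite -mulrA; apply: sqTU.
  by rewrite opprB addrA subrK.
rewrite (meanD (mP _)) !(meanZ (mP _)).
rewrite -[n.+1%:R]natr1; move: (U2 n) (M2 n).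
rewrite -[n.+1%:R]natr1; set a := m n _; set b := m n _ => a2 b2.
have bK : c ^+ 2 * b <= c ^+ 2 * c2 by rewrite ler_wpM2l ?sqr_ge0.
have K0 : 0 <= c ^+ 2 * c2 by rewrite mulr_ge0 ?sqr_ge0.
have Kn : 0 <= c ^+ 2 * c2 * n%:R by rewrite mulr_ge0.
rewrite -/a -/b; lra.
Qed.

(** The first two terms bound the Taylor remainders, with coefficients rounded up; the last bounds
    the term of order [th ^ 4] left by the corrector. *)
Let kappa := 4 * c ^+ 3 + 4 * c ^+ 2 + sigma2 * c.

Let kappa_ge0 : 0 <= kappa.
Proof.
by rewrite !addr_ge0 // !mulr_ge0 ?exprn_ge0 ?asymptotic_variance_ge0 // ltW.
Qed.

Let err (th : R) (s : S) := th ^+ 2 * (M s ^+ 2 * min1 (th * M s)).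

(* Taylor expansion to second order; the corrector w turns the conditional
   variance v into the constant sigma2. *)
Let cos_step (th : R) (s : S) (a : R) : 0 < th <= 1 ->
  `|\sum_j p s j * (cos (a + th * D s j) * (1 - th ^+ 2 / 2 * w (nxt s j)))
    - (1 - th ^+ 2 * sigma2 / 2) * (cos a * (1 - th ^+ 2 / 2 * w s))|
  <= kappa * err th s.
Proof.
move=> /andP[th0 th1].
have m1D j : min1 (th * D s j) <= c * min1 (th * M s).
  rewrite /min1 (normrM th (M s)) (gtr0_norm (M_gt0 s)).
  rewrite minr_pMr ?(ltW c_gt0) // mulr1 le_min !ge_min c1 /=.
  by rewrite normrM mulrCA ler_pM2l ?normr_gt0 ?gt_eqF // DM orbT.
(* As [M >= 1] and [th <= 1], the same truncated factor absorbs the extra [th ^ 2] of the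
   fourth-order term. *)
have thm1 : th ^+ 2 <= min1 (th * M s).
  rewrite /min1 gtr0_norm ?mulr_gt0 // le_min expr2.
  rewrite mulr_ile1 ?(ltW th0) //= ler_pM2l //.
  exact: le_trans (M1 s).
have D2 j : D s j ^+ 2 <= c ^+ 2 * M s ^+ 2.
  rewrite -exprMn -(real_normK (num_real (D s j))) lerXn2r ?nnegrE //.
  by rewrite mulr_ge0 // ltW.
have m0 := min1_ge0 (th * M s).
have mD0 j := min1_ge0 (th * D s j).
set mm := min1 _ in thm1 m0 m1D.
have -> : \sum_j p s j * (cos (a + th * D s j) * (1 - th ^+ 2 / 2 * w (nxt s j)))
    - (1 - th ^+ 2 * sigma2 / 2) * (cos a * (1 - th ^+ 2 / 2 * w s)) =
  \sum_j p s j * (cos a * (cos (th * D s j) - 1 + (th * D s j) ^+ 2 / 2)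
     - sin a * (sin (th * D s j) - th * D s j)
     - cos a * (cos (th * D s j) - 1) * (th ^+ 2 / 2 * w (nxt s j))
     + sin a * sin (th * D s j) * (th ^+ 2 / 2 * w (nxt s j)))
  - cos a * (th ^+ 4 * sigma2 * w s / 4).
  (* The added terms are summed by total mass 1, zero drift and the Poisson equation for [w], where
     [v] cancels against the mean of [D ^ 2]. *)
  transitivity (\sum_j (p s j * (cos a * (cos (th * D s j) - 1 + (th * D s j) ^+ 2 / 2)
     - sin a * (sin (th * D s j) - th * D s j)
     - cos a * (cos (th * D s j) - 1) * (th ^+ 2 / 2 * w (nxt s j))
     + sin a * sin (th * D s j) * (th ^+ 2 / 2 * w (nxt s j)))
   + cos a * p s j - cos a * (th ^+ 2 / 2) * (p s j * w (nxt s j))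
   - cos a * (th ^+ 2 / 2) * (p s j * D s j ^+ 2)
   - sin a * th * (p s j * D s j))
   - (1 - th ^+ 2 * sigma2 / 2) * (cos a * (1 - th ^+ 2 / 2 * w s))).
    by congr (_ - _); apply: eq_bigr => j _; rewrite cosD; field.
  rewrite !big_split /= !sumrN -!mulr_sumr p_sum1 wE drift0 -/(v s).
  by field.
have term j : `|cos a * (cos (th * D s j) - 1 + (th * D s j) ^+ 2 / 2)
     - sin a * (sin (th * D s j) - th * D s j)
     - cos a * (cos (th * D s j) - 1) * (th ^+ 2 / 2 * w (nxt s j))
     + sin a * sin (th * D s j) * (th ^+ 2 / 2 * w (nxt s j))| <=
   (3 * c ^+ 3 + 3 / 2 * c ^+ 2) * (th ^+ 2 * (M s ^+ 2 * mm)).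
  have K1 : (th * D s j) ^+ 2 * min1 (th * D s j) <=
      c ^+ 3 * (th ^+ 2 * (M s ^+ 2 * mm)).
    have -> : c ^+ 3 * (th ^+ 2 * (M s ^+ 2 * mm)) =
       (th ^+ 2 * (c ^+ 2 * M s ^+ 2)) * (c * mm) by ring.
    rewrite exprMn; apply: ler_pM; [by rewrite mulr_ge0 ?sqr_ge0 | by []
      | by rewrite ler_wpM2l ?sqr_ge0 | exact: m1D].
  have K2 : `|th ^+ 2 / 2 * w (nxt s j)| * min1 (th * D s j) <=
      c ^+ 2 / 2 * (th ^+ 2 * (M s ^+ 2 * mm)).
    have -> : c ^+ 2 / 2 * (th ^+ 2 * (M s ^+ 2 * mm)) =
       (th ^+ 2 / 2 * (c * M s ^+ 2)) * (c * mm) by ring.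
    apply: ler_pM; [by [] | by [] | | exact: m1D].
    rewrite normrM ger0_norm ?divr_ge0 ?sqr_ge0 //.
    by rewrite ler_wpM2l ?divr_ge0 ?sqr_ge0.
  apply: le_trans (ler_normD _ _) _.
  apply: le_trans (lerD (ler_normB _ _) (lexx _)) _.
  apply: le_trans (lerD (lerD (ler_normB _ _) (lexx _)) (lexx _)) _.
  have le1M (x y : R) : `|x| <= 1 -> `|x * y| <= `|y|.
    by move=> x1; rewrite normrM ler_piMl.
  set q := th ^+ 2 / 2 * w (nxt s j) in K2 *.
  have N1 : `|cos a * (cos (th * D s j) - 1 + (th * D s j) ^+ 2 / 2)| <=
      c ^+ 3 * (th ^+ 2 * (M s ^+ 2 * mm)).
    apply: le_trans (le1M _ _ (cos_max a)) _.
    exact: le_trans (norm_cos_sub_min1 _) K1.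
  have N2 : `|sin a * (sin (th * D s j) - th * D s j)| <=
      2 * (c ^+ 3 * (th ^+ 2 * (M s ^+ 2 * mm))).
    apply: le_trans (le1M _ _ (sin_max a)) _.
    by apply: le_trans (norm_sin_sub_min1 _) _; rewrite ler_wpM2l.
  have N3 : `|cos a * (cos (th * D s j) - 1) * q| <=
      2 * (c ^+ 2 / 2 * (th ^+ 2 * (M s ^+ 2 * mm))).
    rewrite -mulrA; apply: le_trans (le1M _ _ (cos_max a)) _.
    rewrite normrM mulrC.
    apply: le_trans (ler_wpM2l (normr_ge0 _) (norm_cos1_min1 _)) _.
    by rewrite mulrCA ler_wpM2l.
  have N4 : `|sin a * sin (th * D s j) * q| <=
      c ^+ 2 / 2 * (th ^+ 2 * (M s ^+ 2 * mm)).
    rewrite -mulrA; apply: le_trans (le1M _ _ (sin_max a)) _.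
    rewrite normrM mulrC.
    by apply: le_trans (ler_wpM2l (normr_ge0 _) (norm_sin_min1 _)) K2.
  apply: le_trans (lerD (lerD (lerD N1 N2) N3) N4) _.
  by rewrite le_eqVlt; apply/orP; left; apply/eqP; field.
apply: le_trans (ler_normB _ _) _.
have sn := step_norm_le s term.
apply: le_trans (lerD sn (lexx _)) _.
have X0 : 0 <= th ^+ 2 * (M s ^+ 2 * mm).
  by apply: mulr_ge0; [exact: sqr_ge0 | apply: mulr_ge0; rewrite ?sqr_ge0].
have last : `|cos a * (th ^+ 4 * sigma2 * w s / 4)| <=
    sigma2 * c * (th ^+ 2 * (M s ^+ 2 * mm)).
  apply: (@le_trans _ _ `|th ^+ 4 * sigma2 * w s / 4|).
    by rewrite normrM ler_piMl // cos_max.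
  have -> : th ^+ 4 * sigma2 * w s / 4 = (sigma2 * th ^+ 2 * th ^+ 2 / 4) * w s.
    by field.
  have P0 : 0 <= sigma2 * th ^+ 2 by rewrite mulr_ge0 ?sqr_ge0 ?asymptotic_variance_ge0.
  have P1 : 0 <= sigma2 * th ^+ 2 * th ^+ 2 / 4.
    by rewrite divr_ge0 // mulr_ge0 ?sqr_ge0.
  rewrite normrM (ger0_norm P1).
  have -> : sigma2 * c * (th ^+ 2 * (M s ^+ 2 * mm)) =
    (sigma2 * th ^+ 2 * mm) * (c * M s ^+ 2) by ring.
  apply: ler_pM => //.
  apply: (@le_trans _ _ (sigma2 * th ^+ 2 * th ^+ 2)); last by rewrite ler_wpM2l.
  by rewrite (ler_piMr (mulr_ge0 P0 (sqr_ge0 th))) // invf_le1 ?ler1n ?ltr0n.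
apply: le_trans (lerD (lexx _) last) _.
rewrite /err -/mm /kappa.
have c30 : 0 <= c ^+ 3 by rewrite exprn_ge0 // ltW.
have c20 : 0 <= c ^+ 2 by exact: sqr_ge0.
rewrite -mulrDl ler_wpM2r // lerD2r; lra.
Qed.

(** Uniform integrability of [M ^ 2], in the role of the Lindeberg condition. *)
Hypothesis M_ui : forall e, 0 < e -> exists2 th0, 0 < th0 &
  forall th n, 0 < th <= th0 -> m n (fun s => M s ^+ 2 * min1 (th * M s)) <= e.

(** With [th = 1 / sqrt n], each of the [n] steps costs at most [kappa * th ^ 2 * e1], in total
    [kappa * e1]; replacing [T] by [U] and dropping the corrector costs [O(th)]. The free phase [b]
    covers sines as well. *)
Theorem markov_clt (b : R) :
  (m n (fun s => cos ((Num.sqrt n%:R)^-1 * (T s - n%:R * mu) + b))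
    - (1 - sigma2 / (2 * n%:R)) ^+ n * cos b) @[n --> \oo] --> (0 : R).
Proof.
pose Phi (th : R) n := m n (fun s => cos (b + th * (U s - n%:R * mu)) *
  (1 - th ^+ 2 / 2 * w s)).
have mw n : `|m n w| <= c * c2.
  apply: le_trans (norm_mean_le (mP n) wM) _.
  by rewrite (meanZ (mP n)) ler_pM2l.
have mM n : m n M <= c2.
  apply: le_trans (M2 n); apply: (mean_le (mP n)) => s.
  by rewrite expr2 ler_pMl.
have PhiS (e th : R) n : 0 < th <= 1 -> th ^+ 2 * sigma2 <= 2 ->
    (forall k, m k (fun s => M s ^+ 2 * min1 (th * M s)) <= e) ->
    `|Phi th n - (1 - th ^+ 2 * sigma2 / 2) ^+ n * Phi th 0%N|
      <= n%:R * (kappa * (th ^+ 2 * e)).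
  move=> th01 ths2 ui; elim: n => [|n IH]; first by rewrite expr0 mul1r subrr normr0 mul0r.
  set r := 1 - _ in IH *.
  have r1 : `|r| <= 1.
    have := mulr_ge0 (sqr_ge0 th) asymptotic_variance_ge0; rewrite ler_norml /r; lra.
  have -> : Phi th n.+1 - r ^+ n.+1 * Phi th 0%N =
      (Phi th n.+1 - r * Phi th n) + r * (Phi th n - r ^+ n * Phi th 0%N).
    by rewrite exprS; ring.
  apply: le_trans (ler_normD _ _) _; rewrite -natr1 [leRHS]mulrDl [in leRHS]mul1r [leRHS]addrC.
  apply: lerD; last by rewrite normrM; apply: le_trans (ler_piMl _ r1) IH.
  rewrite /Phi m_step -(meanZ (mP n)) -(meanB (mP n)).
  apply: (@le_trans _ _ (m n (fun s => kappa * err th s))).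
    apply: (norm_mean_le (mP n)) => s.
    apply: le_trans (cos_step s (b + th * (U s - n%:R * mu)) th01).
    rewrite le_eqVlt; apply/orP; left; apply/eqP; congr (`| _ - _ |).
    apply: eq_bigr => j _; congr (_ * (cos _ * _)).
    by rewrite /D -natr1; ring.
  by rewrite (meanZ (mP n)) (meanZ (mP n)) ler_wpM2l // ler_wpM2l ?sqr_ge0.
have cosL (x y : R) : `|cos x - cos y| <= `|x - y|.
  have -> : cos x - cos y = - 2 * sin ((x + y) / 2) * sin ((x - y) / 2).
    have -> : cos x = cos ((x + y) / 2 + (x - y) / 2) by congr cos; field.
    have -> : cos y = cos ((x + y) / 2 - (x - y) / 2) by congr cos; field.
    by rewrite cosD cosB; ring.
  have h1 := sin_max ((x + y) / 2).
  have h2 : `|sin ((x - y) / 2)| <= `|x - y| / 2.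
    by apply: le_trans (norm_sin_le _) _; rewrite normrM (ger0_norm (x := 2^-1)).
  have h3 := normr_ge0 (sin ((x - y) / 2)).
  rewrite !normrM normrN (ger0_norm (x := 2)) //.
  have h4 := ler_wpM2r h3 h1.
  move: h4 h2 => {h1 h3}; set a := `|sin _|; set a' := `|sin _|; set t := `|_|.
  lra.
have Tphi (th : R) n : 0 < th -> `|m n (fun s => cos (th * (T s - n%:R * mu) + b)) - Phi th n|
   <= th * (c * c2) + th ^+ 2 / 2 * (c * c2).
  move=> th0; rewrite /Phi -(meanB (mP n)).
  apply: (@le_trans _ _ (m n (fun s => th * c * M s + th ^+ 2 / 2 * c * M s ^+ 2))).
    apply: (norm_mean_le (mP n)) => s.
    set x := th * _ + b; set y := b + _.
    have -> : cos x - cos y * (1 - th ^+ 2 / 2 * w s) =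
      (cos x - cos y) + cos y * (th ^+ 2 / 2 * w s) by ring.
    apply: le_trans (ler_normD _ _) _; apply: lerD.
      apply: le_trans (cosL _ _) _.
      have -> : x - y = th * (T s - U s) by rewrite /x /y; ring.
      by rewrite normrM gtr0_norm // -mulrA ler_pM2l.
    rewrite normrM; apply: le_trans (ler_piMl _ (cos_max _)) _ => //.
    rewrite normrM ger0_norm ?divr_ge0 ?sqr_ge0 // -mulrA.
    by rewrite ler_wpM2l ?divr_ge0 ?sqr_ge0.
  rewrite (meanD (mP n)) !(meanZ (mP n)) -!mulrA.
  by rewrite lerD // !ler_wpM2l ?mulr_ge0 ?sqr_ge0 // ltW.
apply/cvgrPdist_le => e e0.
pose e1 := e / (2 * (kappa + 1)).
have e10 : 0 < e1 by rewrite divr_gt0 // mulr_gt0 // ltr_wpDl.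
have [th0 th0_gt0 ui] := M_ui e10.
pose K := 2 * (c * c2) + 2 * (c * c2).
have K0 : 0 <= K by rewrite addr_ge0 // !mulr_ge0 // ltW.
(* The four bounds serve, in this order, uniform integrability, the one-step expansion,
   [th ^ 2 * sigma2 <= 2], and the boundary terms. *)
pose th1 := Num.min (Num.min th0 1) (Num.min (1 / (sigma2 + 1)) (e / (2 * (K + 1)))).
have s0 := asymptotic_variance_ge0.
have th1_gt0 : 0 < th1.
  by rewrite !lt_min th0_gt0 ltr01 !divr_gt0 //= ?ltr_wpDl // mulr_gt0 // ltr_wpDl.
near=> n.
have n0 : (0 < n)%N by near: n; exact: nbhs_infty_gt.
set th := (Num.sqrt n%:R)^-1.
have thn : th ^+ 2 = n%:R^-1 by rewrite exprVn sqr_sqrtr.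
have th_gt0 : 0 < th by rewrite invr_gt0 sqrtr_gt0 ltr0n.
have : th <= th1.
  rewrite -(@ler_pXn2r _ 2%N) ?nnegrE ?(ltW th_gt0) ?(ltW th1_gt0) // thn invf_ple ?posrE ?ltr0n ?exprn_gt0 //.
  near: n; exact: nbhs_infty_ger.
rewrite !le_min => /andP[/andP[thth0 thle1] /andP[thsig thK]].
have th01 : 0 < th <= 1 by rewrite th_gt0.
have ths2 : th ^+ 2 * sigma2 <= 2.
  apply: (@le_trans _ _ (th * sigma2)).
    by rewrite ler_wpM2r // expr2 ler_piMr // ltW.
  move: thsig; rewrite ler_pdivlMr ?ltr_wpDl //; nra.
have HP : `|Phi th n - (1 - th ^+ 2 * sigma2 / 2) ^+ n * Phi th 0%N| <= e / 2.
  apply: le_trans (PhiS e1 th n th01 ths2 _) _.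
    by move=> k; apply: ui; rewrite th_gt0.
  rewrite thn mulrCA mulVKf ?pnatr_eq0 -?lt0n //.
  rewrite /e1 ; have -> : kappa * (e / (2 * (kappa + 1))) = kappa / (kappa + 1) * (e / 2).
    by field; rewrite gt_eqF // ltr_wpDl.
  by rewrite ler_piMl ?divr_ge0 ?(ltW e0) // ler_pdivrMr ?ltr_wpDl // mul1r lerDl.
have r1 : `|1 - th ^+ 2 * sigma2 / 2| <= 1.
  have := mulr_ge0 (sqr_ge0 th) s0; rewrite ler_norml; lra.
have H1 := Tphi th n th_gt0.
have H2 := Tphi th 0%N th_gt0.
rewrite (T0 (fun t => cos (th * (t - 0%:R * mu) + b))) mul0r subr0 mulr0 add0r in H2.
have -> : sigma2 / (2 * n%:R) = th ^+ 2 * sigma2 / 2.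
  by rewrite thn invfM; ring.
rewrite sub0r normrN.
set r := 1 - _ in HP r1 *; set x := m n _ in H1 *.
have -> : x - r ^+ n * cos b = (x - Phi th n) + (Phi th n - r ^+ n * Phi th 0%N)
   - r ^+ n * (cos b - Phi th 0%N) by ring.
have H3 : `|r ^+ n * (cos b - Phi th 0%N)| <= th * (c * c2) + th ^+ 2 / 2 * (c * c2).
  by rewrite normrM; apply: le_trans (ler_piMl _ _) H2; rewrite ?normrX ?exprn_ile1.
have cc0 : 0 <= c * c2 by rewrite mulr_ge0 // ltW.
have H4 : th * (c * c2) + th ^+ 2 / 2 * (c * c2) <= th * (2 * (c * c2)).
  have : th ^+ 2 * (c * c2) <= th * (c * c2).
    by rewrite ler_wpM2r // expr2 ler_piMr // ltW.
  have : 0 <= th ^+ 2 * (c * c2) by rewrite mulr_ge0 ?sqr_ge0.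
  lra.
have H5 : th * K <= e / 2.
  have : th * (2 * (K + 1)) <= e by rewrite -ler_pdivlMr // mulr_gt0 // ltr_wpDl.
  have := th_gt0; nra.
apply: le_trans (ler_normB _ _) _.
apply: le_trans (lerD (ler_normD _ _) (lexx _)) _.
move: H1 H3 HP H4 H5; rewrite /K.
set a1 := `|x - _|; set a2 := `|r ^+ n * _|; set a3 := `|_|; lra.
Unshelve. all: by end_near.
Qed.

End MarkovCLT.

(** * The state of the recursion as a Markov chain *)

Section UlamChain.
Variables (R : realType) (d : nat) (A P : 'M[R]_d).
Hypothesis P_stoch : stochastic P.
Hypothesis P_supp : forall i j, 0 < P i j <-> A i j <> 0.
Hypothesis P_irr : irreducible_chain P.

Local Notation state := (ulam_state R d).

Definition walk (s : state) (q : 'I_d * 'I_d) : R := us_Lambda s q.1 q.2.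
Definition walk_sum (s : state) (q : 'I_d * 'I_d) : R := us_Sigma s q.1 q.2.
Definition walk_ratio (i j : 'I_d) : R := A i j / P i j.

Definition flags (s : state) : flag_state d :=
  (us_cur s, [set q | walk s q != 0]%SET).

Definition started (z : flag_state d) q : R := (flag_start z q)%:R.

Definition step_mean (f : state -> R) (s : state) : R :=
  \sum_j P (us_cur s) j * f (ulam_step A P s j).

Let startE s q : (if (q.1 == us_cur s) && (walk s q == 0) then 1 else walk s q) =
  walk s q + started (flags s) q.
Proof.
rewrite /started /flag_start inE /= negbK eq_sym.
by case: eqP => //= _; rewrite ?addr0 //; case: eqP => [->|]; rewrite ?add0r ?addr0.
Qed.

Lemma walk_step s j q : walk (ulam_step A P s j) q =
  (q.2 != j)%:R * (walk_ratio (us_cur s) j * (walk s q + started (flags s) q)).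
Proof.
by rewrite -startE /walk /ulam_step /= !mxE; case: eqP; rewrite ?mul0r ?mul1r.
Qed.

Lemma walk_sum_step s j q : walk_sum (ulam_step A P s j) q = walk_sum s q +
  (q.2 == j)%:R * (walk_ratio (us_cur s) j * (walk s q + started (flags s) q)).
Proof.
rewrite -startE /walk_sum /walk /ulam_step /= !mxE.
by case: eqP; rewrite ?mul0r ?mul1r ?addr0.
Qed.

Lemma cur_step s j : us_cur (ulam_step A P s j) = j. Proof. by []. Qed.

(** The weight of a transition of positive probability is nonzero, so multiplication keeps the zero
    pattern and an entry vanishes only by an arrival in its column. *)
Lemma flags_step s j : 0 < P (us_cur s) j ->
  flags (ulam_step A P s j) = flag_step (flags s) j.
Proof.
move=> Pj; have Aj : A (us_cur s) j != 0 by rewrite -(P_gt0 P_stoch P_supp).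
congr (_, _); apply/setP => q; rewrite !inE walk_step.
rewrite mulf_eq0 negb_or pnatr_eq0 eqb0 negbK; congr (_ && _).
rewrite -startE /walk_ratio !mulf_eq0 invr_eq0 (negbTE Aj) (gt_eqF Pj) /=.
rewrite (eq_sym q.1); have [w0|w0] := eqVneq (walk s q) 0; last first.
  by rewrite andbF (negbTE w0).
by case: (_ == q.1); rewrite /= ?oner_eq0 ?w0 ?eqxx.
Qed.

(** A transition of probability 0 has weight 0 and would clear all of [Lambda], against the rule for
    the flags; it carries no mass in the mean. *)
Lemma step_mean_flags (W : flag_state d -> 'I_d -> R) (f : flag_state d -> R) s :
  \sum_j P (us_cur s) j * (W (flags s) j * f (flags (ulam_step A P s j))) =
  \sum_j P (us_cur s) j * (W (flags s) j * f (flag_step (flags s) j)).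
Proof.
apply: eq_bigr => j _.
have [P0|P0] := eqVneq (P (us_cur s) j) 0; first by rewrite P0 !mul0r.
by rewrite flags_step // lt_def P0 (P_ge0 P_stoch).
Qed.

Definition size_of (s : state) : R := 1 + \sum_q `|walk s q|.

Lemma size_of_ge1 s : 1 <= size_of s.
Proof. by rewrite lerDl sumr_ge0. Qed.

Lemma walk_le_size s q : `|walk s q| + 1 <= size_of s.
Proof. by rewrite addrC lerD2l (bigD1 q) //= lerDl sumr_ge0. Qed.

Definition ratio_bound : R := 1 + \sum_i \sum_j `|walk_ratio i j|.

Lemma ratio_bound_ge1 : 1 <= ratio_bound.
Proof. by rewrite lerDl sumr_ge0 // => i _; rewrite sumr_ge0. Qed.

Lemma ratio_le_bound i j : `|walk_ratio i j| <= ratio_bound.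
Proof.
apply: ler_wpDl => //; rewrite (bigD1 i) //= ler_wpDr ?sumr_ge0 //.
  by move=> k _; rewrite sumr_ge0.
by rewrite (bigD1 j) //= lerDl sumr_ge0.
Qed.

Lemma start_le_size s j q (b : bool) :
  `|b%:R * (walk_ratio (us_cur s) j * (walk s q + started (flags s) q))|
    <= ratio_bound * size_of s.
Proof.
rewrite normrM; apply: le_trans (ler_piMl _ _) _ => //.
  by rewrite normr_nat lern1 leq_b1.
rewrite normrM; apply: ler_pM => //; first exact: ratio_le_bound.
apply: le_trans (ler_normD _ _) (le_trans _ (walk_le_size s q)).
by rewrite lerD2l normr_nat lern1 leq_b1.
Qed.

Definition size_growth : R := 1 + #|{: 'I_d * 'I_d}|%:R * ratio_bound.

Lemma size_step s j : size_of (ulam_step A P s j) <= size_growth * size_of s.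
Proof.
rewrite mulrDl mul1r lerD ?size_of_ge1 // -mulrA mulr_natl -sumr_const.
by apply: ler_sum => q _; rewrite walk_step; exact: start_le_size.
Qed.

(** The quadratic growth bound is included so that second moments of [Lambda] control the mean of
    the solution. *)
Definition poisson (v w : state -> R) (e c : R) : Prop := 0 <= c /\
  forall s, step_mean w s = w s - v s + e /\ `|w s| <= c * size_of s ^+ 2.

Definition solvable v := exists w e c, poisson v w e c.

(** The induction on the degree in [Lambda]: a partial solution [w] trades [v] for a remainder [v'],
    of lower degree in the applications. *)
Lemma solvable_reduce (v v' w : state -> R) (c : R) : 0 <= c ->
  (forall s, step_mean w s = w s - v s + v' s) ->
  (forall s, `|w s| <= c * size_of s ^+ 2) -> solvable v' -> solvable v.
Proof.
move=> c0 Hw wc [w' [e' [c' [c'0 H']]]].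
exists (fun s => w s + w' s), e', (c + c'); split; first exact: addr_ge0.
move=> s; have [Hw' wc'] := H' s; split.
  rewrite /step_mean; under eq_bigr do rewrite mulrDr.
  by rewrite big_split /= -/(step_mean w s) -/(step_mean w' s) Hw Hw'; ring.
by rewrite mulrDl; apply: le_trans (ler_normD _ _) (lerD _ _).
Qed.

Lemma solvableD v v' : solvable v -> solvable v' ->
  solvable (fun s => v s + v' s).
Proof.
move=> [w [e [c [c0 H]]]] [w' [e' [c' [c'0 H']]]].
exists (fun s => w s + w' s), (e + e'), (c + c'); split; first exact: addr_ge0.
move=> s; have [Hw wc] := H s; have [Hw' wc'] := H' s; split.
  rewrite /step_mean; under eq_bigr do rewrite mulrDr.
  by rewrite big_split /= -/(step_mean w s) -/(step_mean w' s) Hw Hw'; ring.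
by rewrite mulrDl; apply: le_trans (ler_normD _ _) (lerD _ _).
Qed.

Lemma le_size_sqr s (x : R) : 0 <= x -> x <= x * size_of s ^+ 2.
Proof.
by move=> x0; rewrite ler_peMr // exprn_ege1 // size_of_ge1.
Qed.

Let norm_le_sum (Z : finType) (f : Z -> R) z : `|f z| <= \sum_y `|f y|.
Proof. by rewrite (bigD1 z) //= lerDl sumr_ge0. Qed.

Variable x0 : 'I_d.

Lemma solvable_flags (f : flag_state d -> R) : solvable (fun s => f (flags s)).
Proof.
have [w [c Hw]] := flag_poisson P_stoch P_irr x0 f.
exists (fun s => w (flags s)), c, (\sum_z `|w z|); split; first exact: sumr_ge0.
move=> s; split; last first.
  by apply: le_trans (le_size_sqr s (sumr_ge0 _ _)); rewrite ?norm_le_sum.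
rewrite -Hw; have := step_mean_flags (fun _ _ => 1) w s.
by under eq_bigr do rewrite mul1r; under [in RHS]eq_bigr do rewrite mul1r.
Qed.

(** The supersolution depends only on the current state, so collecting the signed weights along
    [flag_step] keeps the contraction on the flag chain. *)
Lemma flag_weights_solvable (h : 'I_d -> R) (r : R)
    (W : flag_state d -> 'I_d -> R) : r < 1 -> (forall i, 0 < h i) ->
  (forall z, \sum_j `|W z j| * h j <= r * h z.1) ->
  forall f : flag_state d -> R, exists g : flag_state d -> R,
    forall z, \sum_j W z j * g (flag_step z j) = g z - f z.
Proof.
move=> r1 h0 Wh f.
pose T z y := \sum_(j | flag_step z j == y) W z j.
have TE z (g : flag_state d -> R) : \sum_y T z y * g y =
    \sum_j W z j * g (flag_step z j).
  rewrite (partition_big (flag_step z) xpredT) //=; apply: eq_bigr => y _.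
  by rewrite mulr_suml; apply: eq_bigr => j /eqP ->.
have Th z : \sum_y `|T z y| * h y.1 <= r * h z.1.
  apply: le_trans (Wh z); rewrite [leRHS](partition_big (flag_step z) xpredT) //=.
  apply: ler_sum => y _; apply: (@le_trans _ _ (\sum_(j | flag_step z j == y)
    `|W z j| * h y.1)); last by apply: ler_sum => j /eqP <-.
  by rewrite -mulr_suml ler_wpM2r ?ler_norm_sum // ltW.
have [g Hg] := contraction_solvable r1 (fun z : flag_state d => h0 z.1) Th f.
by exists g => z; rewrite -TE [in RHS]Hg addrAC subrr add0r.
Qed.

Variables (h : 'I_d -> R) (r : R).
Hypothesis r01 : 0 < r < 1.
Hypothesis h_gt0 : forall i, 0 < h i.
Hypothesis Hh : forall i, \sum_j Hhat A P i j * h j <= r * h i.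

Let r_gt0 : 0 < r. Proof. by case/andP: r01. Qed.
Let r_lt1 : r < 1. Proof. by case/andP: r01. Qed.
Let sr_lt1 : Num.sqrt r < 1.
Proof. by rewrite -sqrtr1 ltr_sqrt. Qed.
Let sh_gt0 i : 0 < Num.sqrt (h i). Proof. by rewrite sqrtr_gt0. Qed.
Let Ah := abs_subinvariant P_stoch P_supp r_gt0 h_gt0 Hh.

(** In the mean a pending entry evolves with [A] without column [q.2], a contraction for the weight
    [sqrt h]. The remainder comes from walks that start now and has degree 0. *)
Lemma solvable_walk (f : flag_state d -> R) q :
  solvable (fun s => f (flags s) * walk s q).
Proof.
pose W (z : flag_state d) j := A z.1 j * (q.2 != j)%:R.
have Wh z : \sum_j `|W z j| * Num.sqrt (h j) <= Num.sqrt r * Num.sqrt (h z.1).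
  apply: le_trans (Ah z.1); apply: ler_sum => j _.
  rewrite /W normrM normr_nat ler_wpM2r ?(ltW (sh_gt0 _)) // ler_piMr //.
  by rewrite lern1 leq_b1.
have [g Hg] := flag_weights_solvable sr_lt1 sh_gt0 Wh f.
apply: (@solvable_reduce _ (fun s => (g (flags s) - f (flags s)) * started (flags s) q)
  (fun s => g (flags s) * walk s q) (\sum_z `|g z|)).
- exact: sumr_ge0.
- move=> s; transitivity ((g (flags s) - f (flags s)) *
    (walk s q + started (flags s) q)); last by ring.
  rewrite -Hg mulr_suml.
  have := step_mean_flags (fun z j => (q.2 != j)%:R * (walk_ratio z.1 j *
    (walk s q + started (flags s) q))) g s.
  rewrite /step_mean /=; under [in X in _ = X -> _]eq_bigr do rewrite -/(us_cur s).
  move=> H; transitivity (\sum_j P (us_cur s) j * ((q.2 != j)%:R * (walk_ratio (us_cur s) j *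
    (walk s q + started (flags s) q)) * g (flags (ulam_step A P s j)))).
    by apply: eq_bigr => j _; rewrite walk_step; ring.
  rewrite H; apply: eq_bigr => j _; rewrite /W /= -(P_weight P_stoch P_supp).
  by rewrite -/(walk_ratio _ _); ring.
- move=> s; rewrite normrM; apply: ler_pM => //.
  have := walk_le_size s q; have := size_of_ge1 s; have := normr_ge0 (walk s q).
  nra.
- exact: (solvable_flags (fun z => (g z - f z) * started z q)).
Qed.

(** Both entries receive the same random factor, so their product evolves with the kernel [Hhat],
    and [h] itself is the right weight. Starting walks leave terms of degrees 0 and 1. *)
Lemma solvable_walk2 (f : flag_state d -> R) q q' :
  solvable (fun s => f (flags s) * walk s q * walk s q').
Proof.
pose W (z : flag_state d) j :=
  P z.1 j * walk_ratio z.1 j ^+ 2 * ((q.2 != j) && (q'.2 != j))%:R.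
have Wh z : \sum_j `|W z j| * h j <= r * h z.1.
  apply: le_trans (Hh z.1); apply: ler_sum => j _.
  rewrite /W normrM normr_nat HhatE // -/(walk_ratio _ _) ger0_norm; last first.
    by rewrite mulr_ge0 ?sqr_ge0 ?(P_ge0 P_stoch).
  rewrite ler_wpM2r ?(ltW (h_gt0 _)) // ler_piMr ?lern1 ?leq_b1 //.
  by rewrite mulr_ge0 ?sqr_ge0 ?(P_ge0 P_stoch).
have [g Hg] := flag_weights_solvable r_lt1 h_gt0 Wh f.
pose k z := g z - f z.
apply: (@solvable_reduce _ (fun s =>
    (k (flags s) * started (flags s) q * started (flags s) q' +
    k (flags s) * started (flags s) q' * walk s q) +
    k (flags s) * started (flags s) q * walk s q')
  (fun s => g (flags s) * walk s q * walk s q') (\sum_z `|g z|)).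
- exact: sumr_ge0.
- move=> s; transitivity (k (flags s) *
    (walk s q + started (flags s) q) * (walk s q' + started (flags s) q')); last first.
    by rewrite /k; ring.
  rewrite /k -Hg !mulr_suml.
  have H := step_mean_flags (fun z j => ((q.2 != j) && (q'.2 != j))%:R *
    (walk_ratio z.1 j ^+ 2 * (walk s q + started (flags s) q) *
    (walk s q' + started (flags s) q'))) g s.
  rewrite /step_mean; transitivity (\sum_j P (us_cur s) j *
    (((q.2 != j) && (q'.2 != j))%:R *
    (walk_ratio (us_cur s) j ^+ 2 * (walk s q + started (flags s) q) *
    (walk s q' + started (flags s) q')) * g (flags (ulam_step A P s j)))).
    by apply: eq_bigr => j _; rewrite !walk_step -mulnb natrM; ring.
  by rewrite H; apply: eq_bigr => j _; rewrite /W /=; ring.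
- move=> s; rewrite -mulrA normrM; apply: ler_pM => //.
  have := walk_le_size s q; have := walk_le_size s q'.
  have := size_of_ge1 s; have := normr_ge0 (walk s q); have := normr_ge0 (walk s q').
  rewrite normrM expr2 => ? ? ? ? ?; apply: ler_pM => //; lra.
- apply: solvableD; first apply: solvableD.
  + exact: (solvable_flags (fun z => k z * started z q * started z q')).
  + exact: (solvable_walk (fun z => k z * started z q')).
  + exact: (solvable_walk (fun z => k z * started z q)).
Qed.

End UlamChain.

(** * Moments of order slightly above two *)

Lemma powR_subunit_exponent (R : realType) (B r : R) : 1 <= B -> 0 < r < 1 ->
  exists2 e : R, 0 < e <= 1 & B `^ e * r < 1.
Proof.
move=> B1 /andP[r0 r1].
have B0 : 0 < B by exact: lt_le_trans B1.
have lB : 0 <= ln B by rewrite ln_ge0.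
have lr : ln r < 0 by rewrite ln_lt0 // r0.
(* This makes [e * ln B] at most [- ln r / 2]; the [+ 1] covers [B = 1]. *)
pose e := Num.min 1 (- ln r / (2 * (ln B + 1))).
have e0 : 0 < e by rewrite lt_min ltr01 divr_gt0 ?oppr_gt0 // mulr_gt0 // ltr_wpDl.
exists e; first by rewrite e0 ge_min lexx.
rewrite /powR gt_eqF // -[X in _ * X](@lnK _ r) ?posrE // -expRD.
rewrite expR_lt1.
have : e * (2 * (ln B + 1)) <= - ln r.
  by rewrite -ler_pdivlMr ?mulr_gt0 ?ltr_wpDl // ge_min lexx orbT.
have := mulr_ge0 (ltW e0) lB; lra.
Qed.

Section Moments.
Variables (R : realType) (d : nat) (A P : 'M[R]_d).
Hypothesis P_stoch : stochastic P.
Hypothesis P_supp : forall i j, 0 < P i j <-> A i j <> 0.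
Variables (h : 'I_d -> R) (r : R).
Hypothesis r01 : 0 < r < 1.
Hypothesis h_gt0 : forall i, 0 < h i.
Hypothesis Hh : forall i, \sum_j Hhat A P i j * h j <= r * h i.
Variable m : nat -> (ulam_state R d -> R) -> R.
Hypothesis mP : forall n, mean_functional (m n).
Hypothesis m_step : forall n f, m n.+1 f = m n (step_mean A P f).
Hypothesis m_init : forall f c, (forall i, f (ulam_init R i) = c) -> m 0 f = c.

(** The power [2 + e] of [x >= 0], split so that the square can be matched with [Hhat]. *)
Let pw (e x : R) := x ^+ 2 * x `^ e.

Let pw_ge0 e x : 0 <= pw e x.
Proof. by rewrite mulr_ge0 ?sqr_ge0 ?powR_ge0. Qed.

Let pw_le (e x y : R) : 0 < e -> 0 <= x -> x <= y -> pw e x <= pw e y.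
Proof.
move=> e0 x0 xy; have y0 := le_trans x0 xy.
apply: ler_pM; rewrite ?sqr_ge0 ?powR_ge0 //; first by rewrite lerXn2r ?nnegrE.
by apply: ge0_ler_powR; rewrite ?nnegrE // ltW.
Qed.

Let pwM (e x y : R) : 0 <= x -> 0 <= y -> pw e (x * y) = pw e x * pw e y.
Proof. by move=> x0 y0; rewrite /pw powRM // exprMn; ring. Qed.

Let pw1 e : pw e 1 = 1. Proof. by rewrite /pw expr1n powR1 mulr1. Qed.

Let pw0 e : pw e 0 = 0. Proof. by rewrite /pw expr0n mul0r. Qed.

Let N : R := #|{: 'I_d * 'I_d}|%:R.

(** Since [|ratio| ^ (2 + e) <= B ^ e * ratio ^ 2], the weight [h] contracts moments of order
    [2 + e] at rate [B ^ e * r], still below 1; starting walks add a constant. *)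
Lemma size_of_moment : exists2 e : R, 0 < e <= 1 &
  exists c4, forall n, m n (fun s => size_of s ^+ 2 * size_of s `^ e) <= c4.
Proof.
pose B := ratio_bound A P; have B1 : 1 <= B := ratio_bound_ge1 A P.
have B0 : 0 <= B by apply: le_trans B1.
have [e /andP[e0 e1] Be] := powR_subunit_exponent B1 r01.
exists e; first by rewrite e0.
pose rho := B `^ e * r; have rho0 : 0 <= rho.
  by rewrite mulr_ge0 ?powR_ge0 // ltW //; case/andP: r01.
pose V (s : ulam_state R d) := \sum_q h (us_cur s) * pw e `|walk s q|.
pose K0 := rho * (\sum_i h i * N).
have K00 : 0 <= K0.
  by rewrite mulr_ge0 // sumr_ge0 // => i _; rewrite mulr_ge0 ?ler0n // ltW.
have QV s : step_mean A P V s <= rho * V s + K0.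
  apply: (@le_trans _ _ (\sum_q B `^ e * (pw e `|walk s q| + 1) *
      \sum_j Hhat A P (us_cur s) j * h j)).
    under [leRHS]eq_bigr do rewrite mulr_sumr.
    rewrite exchange_big /=; apply: ler_sum => j _.
    rewrite /V mulr_sumr; apply: ler_sum => q _.
    rewrite HhatE // cur_step -/(walk_ratio A P _ _).
    have -> : B `^ e * (pw e `|walk s q| + 1) * (P (us_cur s) j *
      walk_ratio A P (us_cur s) j ^+ 2 * h j) = P (us_cur s) j * (h j *
      (walk_ratio A P (us_cur s) j ^+ 2 * B `^ e * (pw e `|walk s q| + 1))) by ring.
    rewrite ler_wpM2l ?(P_ge0 P_stoch) // ler_wpM2l ?(ltW (h_gt0 _)) //.
    rewrite walk_step -(real_normK (num_real (walk_ratio _ _ _ _))).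
    set L := walk s q + _.
    (* A start replaces an entry 0 by 1 and never adds to a nonzero weight. *)
    have HL : pw e `|L| <= pw e `|walk s q| + 1.
      rewrite /L /started /flag_start inE /= negbK.
      case: (_ == q.1) => /=; last by rewrite addr0 lerDl.
      case: eqP => [->|_]; last by rewrite addr0 lerDl.
      by rewrite add0r normr1 normr0 pw1 pw0 add0r.
    apply: (@le_trans _ _ (pw e (`|walk_ratio A P (us_cur s) j| * `|L|))).
      apply: pw_le => //; rewrite !normrM ler_piMl ?mulr_ge0 //.
      by rewrite normr_nat lern1 leq_b1.
    rewrite pwM //; apply: ler_pM => //.
    rewrite ler_wpM2l ?sqr_ge0 //; apply: ge0_ler_powR; rewrite ?nnegrE ?(ltW e0) //.
    exact: ratio_le_bound.
  apply: (@le_trans _ _ (\sum_q rho * h (us_cur s) * (pw e `|walk s q| + 1))).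
    apply: ler_sum => q _.
    have -> : rho * h (us_cur s) * (pw e `|walk s q| + 1) =
      B `^ e * (pw e `|walk s q| + 1) * (r * h (us_cur s)) by rewrite /rho; ring.
    by rewrite ler_wpM2l // mulr_ge0 ?powR_ge0 // addr_ge0.
  under eq_bigr do rewrite mulrDr mulr1.
  rewrite big_split /= lerD //.
    by rewrite /V mulr_sumr; apply: ler_sum => q _; rewrite mulrA.
  rewrite sumr_const -mulr_natr -/N -mulrA ler_wpM2l //.
  by rewrite (bigD1 (us_cur s)) //= lerDl sumr_ge0 // => i _;
    rewrite mulr_ge0 ?ler0n // ltW.
(* The fixed point of [x -> rho * x + K0]. *)
pose K := K0 / (1 - rho).
have rho1 : 0 < 1 - rho by rewrite subr_gt0.
have mV n : m n V <= K.
  elim: n => [|n IH].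
    rewrite (@m_init _ 0) ?divr_ge0 ?(ltW rho1) // => i; rewrite /V big1 // => q _.
    by rewrite /walk mxE normr0 pw0 mulr0.
  rewrite m_step; apply: le_trans (mean_le (mP n) QV) _.
  rewrite (meanD (mP n)) (meanZ (mP n)) (mean_cst (mP n)).
  apply: (@le_trans _ _ (rho * K + K0)); first by rewrite lerD2r ler_wpM2l.
  rewrite /K le_eqVlt; apply/orP; left; apply/eqP; field.
  by rewrite gt_eqF.
pose c3 := pw e (1 + N).
exists (c3 * (1 + (\sum_i (h i)^-1) * K)) => n.
apply: (@le_trans _ _ (m n (fun s => c3 * (1 + (\sum_i (h i)^-1) * V s)))).
  apply: (mean_le (mP n)) => s.
  (* The sum of the entries is traded for their maximum, whose power is bounded by the sum of the
     powers. *)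
  pose b : R := \big[Num.max/1]_q `|walk s q|.
  have b1 : 1 <= b by apply: bigmax_ge_id.
  have b0 : 0 <= b by apply: le_trans b1.
  have sb : size_of s <= (1 + N) * b.
    rewrite /size_of mulrDl mul1r lerD // /N mulr_natl -sumr_const.
    by apply: ler_sum => q _; apply: le_bigmax.
  apply: (@le_trans _ _ (pw e ((1 + N) * b))).
    by apply: pw_le => //; apply: le_trans (size_of_ge1 s).
  rewrite pwM ?addr_ge0 ?ler0n // ler_wpM2l //.
  have y0 : 0 <= \sum_q pw e `|walk s q| by apply: sumr_ge0.
  apply: (@le_trans _ _ (1 + \sum_q pw e `|walk s q|)).
    rewrite /b; apply: (big_ind (fun x => pw e x <= 1 + \sum_q pw e `|walk s q|)).
    - by rewrite pw1 lerDl.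
    - by move=> x y; rewrite maxEle; case: ifP.
    - move=> q _; apply: ler_wpDl => //.
      by rewrite (bigD1 q) //= lerDl sumr_ge0.
  rewrite lerD2l /V -mulr_sumr mulrA ler_peMl //.
  rewrite -(mulVf (negbT (gt_eqF (h_gt0 (us_cur s))))) ler_wpM2r ?(ltW (h_gt0 _)) //.
  rewrite (bigD1 (us_cur s)) //= lerDl sumr_ge0 // => i _.
  by rewrite invr_ge0 ltW.
rewrite (meanZ (mP n)) (meanD (mP n)) (meanZ (mP n)) (mean1 (mP n)).
apply: ler_wpM2l; [exact: pw_ge0 | rewrite lerD2l].
apply: ler_wpM2l => //; apply: sumr_ge0 => i _.
by rewrite invr_ge0 ltW.
Qed.

Lemma size_of_sqr_moment : exists c2, forall n, m n (fun s => size_of s ^+ 2) <= c2.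
Proof.
have [e /andP[e0 _] [c4 Hc]] := size_of_moment; exists c4 => n.
apply: le_trans (Hc n); apply: (mean_le (mP n)) => s.
rewrite ler_peMr ?sqr_ge0 //.
have -> : (1 : R) = 1 `^ e by rewrite powR1.
apply: ge0_ler_powR.
- exact: ltW.
- by rewrite nnegrE.
- by rewrite nnegrE (le_trans _ (size_of_ge1 s)).
- exact: size_of_ge1.
Qed.

(** As [0 < e <= 1], [min1 y <= y ^ e] for [y > 0]; this extracts a factor [th ^ e] from the moment
    of order [2 + e]. *)
Lemma size_of_uniformly_integrable (eps : R) : 0 < eps -> exists2 th0, 0 < th0 &
  forall th n, 0 < th <= th0 ->
    m n (fun s => size_of s ^+ 2 * min1 (th * size_of s)) <= eps.
Proof.
move=> eps0; have [e /andP[e0 e1] [c4 Hc]] := size_of_moment.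
pose c := Num.max 1 c4; have c0 : 0 < c by rewrite lt_max ltr01.
exists ((eps / c) `^ (e^-1)); first by rewrite powR_gt0 // divr_gt0.
move=> th n /andP[th0 thle].
have the : th `^ e * c <= eps.
  rewrite -ler_pdivlMr //.
  apply: le_trans (ge0_ler_powR _ _ _ thle) _; rewrite ?nnegrE ?powR_ge0 ?(ltW e0) ?(ltW th0) //.
  by rewrite -powRrM mulVf ?gt_eqF // powRr1 // divr_ge0 ?(ltW eps0) // ltW.
apply: le_trans the.
apply: (@le_trans _ _ (m n (fun s => th `^ e * (size_of s ^+ 2 * size_of s `^ e)))).
  apply: (mean_le (mP n)) => s; rewrite mulrCA ler_wpM2l ?sqr_ge0 //.
  have s1 := size_of_ge1 s; have s0 : 0 < size_of s by apply: lt_le_trans s1.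
  rewrite -powRM ?(ltW th0) ?(ltW s0) //; set y := th * _.
  have y0 : 0 < y by rewrite mulr_gt0.
  rewrite /min1 gtr0_norm //; case: (leP 1 y) => y1.
    have {1}-> : (1 : R) = 1 `^ e by rewrite powR1.
    by apply: ge0_ler_powR; rewrite ?nnegrE ?(ltW e0) ?(ltW y0) //.
  by apply: ger1_powR => //; rewrite y0 ltW.
rewrite (meanZ (mP n)) ler_wpM2l ?powR_ge0 //.
by apply: le_trans (Hc n) _; rewrite le_max lexx orbT.
Qed.

End Moments.

(** * Corrected sums as martingales with drift *)

Section Corrector.
Variables (R : realType) (d : nat) (A P : 'M[R]_d).
Hypothesis P_stoch : stochastic P.
Hypothesis P_supp : forall i j, 0 < P i j <-> A i j <> 0.
Hypothesis P_irr : irreducible_chain P.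
Variable x0 : 'I_d.
Variables (h : 'I_d -> R) (r : R).
Hypothesis r01 : 0 < r < 1.
Hypothesis h_gt0 : forall i, 0 < h i.
Hypothesis Hh : forall i, \sum_j Hhat A P i j * h j <= r * h i.

Section Corrected.
Variables (F : 'I_d -> R) (u : flag_state d -> R) (gamma : R) (q : 'I_d * 'I_d).
Hypothesis HF : forall i, F i = A i q.2 + \sum_(j | j != q.2) A i j * F j.
Hypothesis Hu : forall z,
  \sum_j P z.1 j * u (flag_step z j) = u z - started R z q + gamma.

(* A walk of weight walk s q at the current state has expected final weight
   walk s q * F (us_cur s). *)
Definition corrected (s : ulam_state R d) : R :=
  walk_sum s q + walk s q * F (us_cur s) + F q.1 * u (flags s).

(** [gamma] is the long-run frequency of starts for [q], and [F q.1] the mean final weight of one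
    walk. *)
Definition walk_drift := gamma * F q.1.

Definition incr s j := corrected (ulam_step A P s j) - corrected s - walk_drift.

(** Along transitions of positive probability an increment is affine in the entry [q] of [Lambda],
    with constant term [incr0] and slope [incr1] determined by the flags and the next state;
    products of two increments then have degree two. *)
Definition incr0 (z : flag_state d) (j : 'I_d) : R :=
  started R z q * walk_ratio A P z.1 j * ((q.2 == j)%:R + (q.2 != j)%:R * F j)
  + F q.1 * (u (flag_step z j) - u z) - walk_drift.

Definition incr1 (z : flag_state d) (j : 'I_d) : R :=
  walk_ratio A P z.1 j * ((q.2 == j)%:R + (q.2 != j)%:R * F j) - F z.1.

Lemma incrE s j : 0 < P (us_cur s) j ->
  incr s j = incr0 (flags s) j + incr1 (flags s) j * walk s q.
Proof.
move=> Pj; rewrite /incr /corrected walk_step walk_sum_step flags_step //.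
rewrite cur_step /incr0 /incr1 /=; ring.
Qed.

(** The first-passage equation for [F] cancels the pending weight; a new walk contributes
    [started * F], which the Poisson solution [u] turns into the constant drift. *)
Lemma step_incr s : \sum_j P (us_cur s) j * incr s j = 0.
Proof.
have HFx : \sum_j A (us_cur s) j * ((q.2 == j)%:R + (q.2 != j)%:R * F j) =
    F (us_cur s).
  rewrite HF (bigD1 q.2) //= eqxx /= mul0r addr0 mulr1; congr (_ + _).
  by apply: eq_bigr => j; rewrite eq_sym => /negbTE -> /=; rewrite add0r mul1r.
transitivity (\sum_j ((walk s q + started R (flags s) q) * (A (us_cur s) j *
   ((q.2 == j)%:R + (q.2 != j)%:R * F j))
   + F q.1 * (P (us_cur s) j * u (flag_step (flags s) j))
   - P (us_cur s) j * (walk s q * F (us_cur s) + F q.1 * u (flags s) + walk_drift))).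
  apply: eq_bigr => j _; rewrite -(P_weight P_stoch P_supp) -/(walk_ratio _ _ _ _).
  have [P0|P0] := eqVneq (P (us_cur s) j) 0; first by rewrite P0; ring.
  rewrite incrE; last by rewrite lt_def P0 (P_ge0 P_stoch).
  by rewrite /incr0 /incr1 /=; ring.
have Hus : \sum_j P (us_cur s) j * u (flag_step (flags s) j) =
  u (flags s) - started R (flags s) q + gamma := Hu (flags s).
rewrite sumrB big_split /= -!mulr_sumr -mulr_suml HFx (P_sum1 P_stoch) Hus /walk_drift.
(* A walk for [q] starts only from the state [q.1]. *)
have startF : started R (flags s) q * F (us_cur s) = started R (flags s) q * F q.1.
  rewrite /started /flag_start /=; case: eqP => [->|] //=.
  by rewrite !mul0r.
rewrite mulrDl startF; ring.
Qed.

Lemma step_corrected s :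
  \sum_j P (us_cur s) j * corrected (ulam_step A P s j) = corrected s + walk_drift.
Proof.
have := step_incr s; rewrite /incr.
under eq_bigr do rewrite -addrA -opprD mulrBr.
by rewrite sumrB -mulr_suml (P_sum1 P_stoch) mul1r => /subr0_eq.
Qed.

Lemma corrected_bounds : exists2 c, 0 <= c & forall s,
  `|walk_sum s q - corrected s| <= c * size_of s /\
  forall j, `|incr s j| <= c * size_of s.
Proof.
pose CF := \sum_i `|F i|; pose Cu := \sum_z `|u z|.
have FC i : `|F i| <= CF by rewrite /CF (bigD1 i) //= lerDl sumr_ge0.
have uC z : `|u z| <= Cu by rewrite /Cu (bigD1 z) //= lerDl sumr_ge0.
have CF0 : 0 <= CF by apply: sumr_ge0.
have Cu0 : 0 <= Cu by apply: sumr_ge0.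
pose B := ratio_bound A P; have B1 : 1 <= B := ratio_bound_ge1 A P.
have B0 : 0 <= B by apply: le_trans B1.
exists (B + B * CF + CF + 2 * (CF * Cu) + `|walk_drift|).
  by have := mulr_ge0 B0 CF0; have := mulr_ge0 CF0 Cu0; have := normr_ge0 walk_drift; lra.
move=> s; have s1 := size_of_ge1 s; have s0 : 0 <= size_of s by apply: le_trans s1.
have wF s' c i : 0 <= c -> `|walk s' q| <= c * size_of s ->
    `|walk s' q * F i| <= c * CF * size_of s.
  by move=> c0 wc; rewrite normrM mulrAC ler_pM.
have Fu z : `|F q.1 * u z| <= CF * Cu * size_of s.
  rewrite normrM; apply: (@le_trans _ _ (CF * Cu)); first exact: ler_pM.
  by rewrite ler_peMr // mulr_ge0.
have ws : `|walk s q| <= 1 * size_of s.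
  by rewrite mul1r; have := walk_le_size s q; have := normr_ge0 (walk s q); lra.
split=> [|j].
  rewrite /corrected -addrA opprD addNKr normrN; apply: le_trans (ler_normD _ _) _.
  apply: le_trans (lerD (wF s 1 _ ler01 ws) (Fu _)) _.
  rewrite -mulrDl ler_wpM2r // mul1r.
  have := mulr_ge0 B0 CF0; have := mulr_ge0 CF0 Cu0; have := normr_ge0 walk_drift; lra.
have -> : incr s j = (walk_sum (ulam_step A P s j) q - walk_sum s q)
   + walk (ulam_step A P s j) q * F j - walk s q * F (us_cur s)
   + F q.1 * u (flags (ulam_step A P s j)) - F q.1 * u (flags s) - walk_drift.
  by rewrite /incr /corrected cur_step; ring.
have T1 : `|walk_sum (ulam_step A P s j) q - walk_sum s q| <= B * size_of s.
  by rewrite walk_sum_step addrAC subrr add0r; exact: start_le_size.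
have T2 : `|walk (ulam_step A P s j) q * F j| <= B * CF * size_of s.
  by apply: wF => //; rewrite walk_step; exact: start_le_size.
have T3 := wF s 1 (us_cur s) ler01 ws.
have T4 := Fu (flags (ulam_step A P s j)); have T5 := Fu (flags s).
have T6 : `|walk_drift| <= `|walk_drift| * size_of s by rewrite ler_peMr.
apply: le_trans (ler_normB _ _) _.
apply: le_trans (lerD (ler_normB _ _) (lexx _)) _.
apply: le_trans (lerD (lerD (ler_normD _ _) (lexx _)) (lexx _)) _.
apply: le_trans (lerD (lerD (lerD (ler_normB _ _) (lexx _)) (lexx _)) (lexx _)) _.
apply: le_trans (lerD (lerD (lerD (lerD (ler_normD _ _) (lexx _)) (lexx _)) (lexx _)) (lexx _)) _.
apply: le_trans (lerD (lerD (lerD (lerD (lerD T1 T2) T3) T4) T5) T6) _.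
rewrite le_eqVlt; apply/orP; left; apply/eqP; ring.
Qed.

End Corrected.

Lemma solvable_covariance F u gamma q F' u' gamma' q' :
  solvable A P (fun s => \sum_j P (us_cur s) j *
    (incr F u gamma q s j * incr F' u' gamma' q' s j)).
Proof.
pose b z j := incr0 F u gamma q z j; pose b' z j := incr0 F' u' gamma' q' z j.
pose e z j := incr1 F q z j; pose e' z j := incr1 F' q' z j.
pose f00 (z : flag_state d) := \sum_j P z.1 j * (b z j * b' z j).
pose f10 (z : flag_state d) := \sum_j P z.1 j * (e z j * b' z j).
pose f01 (z : flag_state d) := \sum_j P z.1 j * (b z j * e' z j).
pose f11 (z : flag_state d) := \sum_j P z.1 j * (e z j * e' z j).
have -> : (fun s => \sum_j P (us_cur s) j *
    (incr F u gamma q s j * incr F' u' gamma' q' s j)) =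
  (fun s => ((f00 (flags s) + f10 (flags s) * walk s q) + f01 (flags s) * walk s q')
    + f11 (flags s) * walk s q * walk s q').
  apply/funext => s; rewrite /f00 /f10 /f01 /f11 !mulr_suml -!big_split /=.
  apply: eq_bigr => j _.
  have [P0|P0] := eqVneq (P (us_cur s) j) 0; first by rewrite P0; ring.
  rewrite !incrE; try by rewrite lt_def P0 (P_ge0 P_stoch).
  by rewrite /b /b' /e /e'; ring.
apply: solvableD; first apply: solvableD; first apply: solvableD.
- exact: (solvable_flags P_stoch P_supp P_irr x0).
- exact: (solvable_walk P_stoch P_supp P_irr x0 r01 h_gt0 Hh).
- exact: (solvable_walk P_stoch P_supp P_irr x0 r01 h_gt0 Hh).
- exact: (solvable_walk2 P_stoch P_supp P_irr x0 r01 h_gt0 Hh).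
Qed.

End Corrector.

(** * Limit theorem for all linear combinations of the sums *)

Section UlamCLT.
Variables (R : realType) (d : nat) (A P : 'M[R]_d).
Hypothesis P_stoch : stochastic P.
Hypothesis P_supp : forall i j, 0 < P i j <-> A i j <> 0.
Hypothesis P_irr : irreducible_chain P.
Hypothesis rhoA : spectral_radius A < 1.
Hypothesis rhoH : spectral_radius (Hhat A P) < 1.
Variable x0 : 'I_d.

Definition ulam_mean (m : nat -> (ulam_state R d -> R) -> R) := [/\
  forall n, mean_functional (m n),
  forall n f, m n.+1 f = m n (step_mean A P f) &
  forall f c, (forall i, f (ulam_init R i) = c) -> m 0%N f = c].

(** [mu] and [sig] are chosen before [m], so one limit serves every initial law. Arbitrary
    coefficients [t] prepare a Cramer-Wold argument; by bilinearity it is enough to solve the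
    covariance equation for each pair of coordinates. *)
Theorem ulam_mean_clt : exists (mu : 'I_d * 'I_d -> R)
    (sig : 'I_d * 'I_d -> 'I_d * 'I_d -> R),
  (forall q, invmx (1%:M - A) q.1 q.2 = 0 -> mu q = 0) /\
  forall m, ulam_mean m ->
  (forall t : 'I_d * 'I_d -> R, exists K, forall n,
     m n (fun s => (\sum_q t q * walk_sum s q - n%:R * \sum_q t q * mu q) ^+ 2)
       <= K * n.+1%:R) /\
  forall t : 'I_d * 'I_d -> R, 0 <= \sum_p \sum_q t p * t q * sig p q /\
    forall b : R,
    (m n (fun s => cos ((Num.sqrt n%:R)^-1 *
       (\sum_q t q * walk_sum s q - n%:R * \sum_q t q * mu q) + b))
     - (1 - (\sum_p \sum_q t p * t q * sig p q) / (2 * n%:R)) ^+ n * cos b)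
       @[n --> \oo] --> (0 : R).
Proof.
have [h [r [r01 h0 Hh]]] := perron_subinvariant (Hhat_ge0 P_stoch P_supp) rhoH.
have [r0 r1] := andP r01.
have sr1 : Num.sqrt r < 1 by rewrite -sqrtr1 ltr_sqrt.
have sh0 i : 0 < Num.sqrt (h i) by rewrite sqrtr_gt0.
have Ah := abs_subinvariant P_stoch P_supp r0 h0 Hh.
have [F HF] := choice (fun l => first_passage_solvable l sr1 sh0 Ah).
have /choice[uc Huc] : forall q, exists uc : (flag_state d -> R) * R, forall z,
    \sum_j P z.1 j * uc.1 (flag_step z j) = uc.1 z - started R z q + uc.2.
  move=> q; have [u [c Hu]] := flag_poisson P_stoch P_irr x0 (fun z => started R z q).
  by exists (u, c).
pose mu q := walk_drift (F q.2) (uc q).2 q.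
pose U q s := corrected (F q.2) (uc q).1 q s.
pose D q s j := incr A P (F q.2) (uc q).1 (uc q).2 q s j.
have DE q s j : D q s j = U q (ulam_step A P s j) - U q s - mu q by [].
have /choice[wec Hwec] : forall pq : ('I_d * 'I_d) * ('I_d * 'I_d),
    exists wec : (ulam_state R d -> R) * R * R, poisson A P
     (fun s => \sum_j P (us_cur s) j * (D pq.1 s j * D pq.2 s j))
     wec.1.1 wec.1.2 wec.2.
  move=> pq; have [w [e [c H]]] := solvable_covariance P_stoch P_supp P_irr x0 r01 h0 Hh
    (F pq.1.2) (uc pq.1).1 (uc pq.1).2 pq.1 (F pq.2.2) (uc pq.2).1 (uc pq.2).2 pq.2.
  by exists (w, e, c).
have /choice[cb Hcb] : forall q, exists c : R, 0 <= c /\ forall s,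
  `|walk_sum s q - U q s| <= c * size_of s /\
  forall j, `|D q s j| <= c * size_of s.
  move=> q; have [c c0 H] := corrected_bounds A P (F q.2) (uc q).1 (uc q).2 q.
  by exists c.
exists mu, (fun p q => (wec (p, q)).1.2); split.
  move=> [k l] /= C0; rewrite /mu /walk_drift /=.
  have CF := first_passage_resolvent rhoA sr1 sh0 Ah (HF l).
  (* [C_ll = 0] would turn the decomposition at [k = l] into [0 = 1]. Hence [C_kl = 0] excludes
     [k = l] and leaves [F_k = 0]. *)
  have Cll : invmx (1%:M - A) l l != 0.
    apply/eqP => Z; have := CF l; rewrite Z mul0r addr0 eqxx.
    by move/eqP; rewrite eq_sym oner_eq0.
  have kl : k != l by apply: contra_neqN Cll => /eqP kl; rewrite -{1}kl.
  have := CF k; rewrite C0 (negbTE kl) add0r => /esym/eqP.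
  by rewrite mulf_eq0 (negbTE Cll) => /eqP ->; rewrite mulr0.
move=> m [mP mS m0].
have [c2 Hc2] := size_of_sqr_moment P_stoch P_supp r01 h0 Hh mP mS m0.
have ui := size_of_uniformly_integrable P_stoch P_supp r01 h0 Hh mP mS m0.
suff main (t : 'I_d * 'I_d -> R) :
    let T (s : ulam_state R d) := \sum_q t q * walk_sum s q in
    let w s := \sum_p \sum_q t p * t q * (wec (p, q)).1.1 s in
    let V s := \sum_q t q * U q s in
    exists2 c : R, 1 <= c & [/\
      forall f : R -> R, m 0%N (fun s => f (T s)) = f 0,
      forall s, `|T s - V s| <= c * size_of s,
      forall s, \sum_j P (us_cur s) j * V (ulam_step A P s j) =
         V s + \sum_q t q * mu q,
      forall s, \sum_j P (us_cur s) j * w (ulam_step A P s j) =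
        w s - \sum_j P (us_cur s) j *
         (V (ulam_step A P s j) - V s - \sum_q t q * mu q) ^+ 2 +
        \sum_p \sum_q t p * t q * (wec (p, q)).1.2 &
      [/\ forall s j, `|V (ulam_step A P s j) - V s - \sum_q t q * mu q| <= c * size_of s,
      forall s, `|w s| <= c * size_of s ^+ 2 &
      forall s j, `|w (ulam_step A P s j)| <= c * size_of s ^+ 2]].
  have p0 (s : ulam_state R d) j : 0 <= P (us_cur s) j by exact: P_stoch.1.
  have p1 (s : ulam_state R d) : \sum_j P (us_cur s) j = 1 by exact: P_stoch.2.
  split=> t; have /= [c c1 [T0 TV drift wE [DM wM wM']]] := main t.
    exists (6 * c ^+ 2 * c2).
    exact: (second_moment_bound p0 p1 mP mS T0 TV drift c1 (@size_of_ge1 R d) DM Hc2).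
  split.
    exact: (asymptotic_variance_ge0 p0 mP mS wE c1 wM Hc2).
  exact: (markov_clt p0 p1 mP mS T0 TV drift wE c1 (@size_of_ge1 R d) DM wM wM' Hc2 ui).
move=> T w V.
pose g := size_growth A P.
have g1 : 1 <= g by rewrite lerDl mulr_ge0 ?ler0n // (le_trans ler01) // ratio_bound_ge1.
pose ca := \sum_q `|t q| * cb q.
pose cw := \sum_p \sum_q `|t p * t q| * (wec (p, q)).2.
have ca0 : 0 <= ca by apply: sumr_ge0 => q _; rewrite mulr_ge0 //; exact: (Hcb q).1.
have cw0 : 0 <= cw.
  by do 2!(apply: sumr_ge0 => ? _); rewrite mulr_ge0 //; exact: (Hwec (_, _)).1.
have cwg : 0 <= cw * g ^+ 2 by rewrite mulr_ge0 ?sqr_ge0.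
have sz0 (s : ulam_state R d) : 0 <= size_of s by apply: le_trans (size_of_ge1 s).
have wM s : `|w s| <= cw * size_of s ^+ 2.
  apply: le_trans (ler_norm_sum _ _ _) _; rewrite mulr_suml; apply: ler_sum => p _.
  apply: le_trans (ler_norm_sum _ _ _) _; rewrite mulr_suml; apply: ler_sum => q _.
  by rewrite normrM -mulrA ler_wpM2l //; exact: ((Hwec (p, q)).2 s).2.
exists (1 + ca + cw * g ^+ 2); first by rewrite -addrA lerDl addr_ge0.
have cale : ca <= 1 + ca + cw * g ^+ 2 by rewrite addrAC lerDr addr_ge0.
have lin (x : R) (s : ulam_state R d) : `|x| <= ca * size_of s -> `|x| <= (1 + ca + cw * g ^+ 2) * size_of s.
  by move=> H; exact: le_trans H (ler_wpM2r (sz0 s) cale).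
have DV s j : V (ulam_step A P s j) - V s - \sum_q t q * mu q = \sum_q t q * D q s j.
  by rewrite /V -!sumrB; apply: eq_bigr => q _; rewrite DE; ring.
split.
- move=> f; apply: m0 => i; congr f; rewrite /T big1 // => q _.
  by rewrite /walk_sum mxE mulr0.
- move=> s; apply: lin; rewrite /T /V -sumrB.
  apply: le_trans (ler_norm_sum _ _ _) _; rewrite mulr_suml; apply: ler_sum => q _.
  by rewrite -mulrBr normrM -mulrA ler_wpM2l //; exact: ((Hcb q).2 s).1.
- move=> s; rewrite /V; under eq_bigr do rewrite mulr_sumr.
  rewrite exchange_big -big_split /=; apply: eq_bigr => q _.
  rewrite -mulrDr -(step_corrected P_stoch P_supp (HF q.2) (Huc q)) mulr_sumr.
  by apply: eq_bigr => j _; rewrite mulrCA.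
- move=> s; transitivity (\sum_p \sum_q t p * t q *
    step_mean A P (wec (p, q)).1.1 s).
    rewrite /w /step_mean; under eq_bigr do rewrite mulr_sumr.
    rewrite exchange_big; apply: eq_bigr => p _.
    under eq_bigr do rewrite mulr_sumr.
    rewrite exchange_big; apply: eq_bigr => q _; rewrite mulr_sumr.
    by apply: eq_bigr => j _; rewrite mulrCA.
  under eq_bigr => p _ do (under eq_bigr => q _ do
    rewrite ((Hwec (p, q)).2 s).1 mulrDr mulrBr).
  under eq_bigr do rewrite big_split /= sumrB.
  rewrite big_split /= sumrB; congr (_ - _ + _).
  transitivity (\sum_p \sum_j P (us_cur s) j * (t p * D p s j * \sum_q t q * D q s j)).
    apply: eq_bigr => p _; under eq_bigr do rewrite mulr_sumr.
    rewrite exchange_big; apply: eq_bigr => j _.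
    by rewrite !mulr_sumr; apply: eq_bigr => q _ /=; ring.
  rewrite exchange_big; apply: eq_bigr => j _.
  by rewrite -mulr_sumr DV expr2 mulr_suml.
- split.
  + move=> s j; apply: lin; rewrite DV.
    apply: le_trans (ler_norm_sum _ _ _) _; rewrite mulr_suml; apply: ler_sum => q _.
    by rewrite normrM -mulrA ler_wpM2l //; exact: ((Hcb q).2 s).2.
  + move=> s; apply: le_trans (wM s) _; rewrite ler_wpM2r ?sqr_ge0 //.
    apply: (@le_trans _ _ (cw * g ^+ 2)); last by rewrite lerDr addr_ge0.
    by rewrite ler_peMr // exprn_ege1.
  + move=> s j; apply: le_trans (wM _) _.
    apply: (@le_trans _ _ (cw * (g * size_of s) ^+ 2)).
      by rewrite ler_wpM2l // lerXn2r ?nnegrE ?mulr_ge0 ?(le_trans ler01 g1) // size_step.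
    by rewrite exprMn mulrA ler_wpM2r ?sqr_ge0 // lerDr addr_ge0.
Qed.

End UlamCLT.

(** * Expectations along the trajectory *)

Section Transfer.
Variables (R : realType) (d : nat) (A P : 'M[R]_d).
Variables (dO : measure_display) (Omega : measurableType dO).
Variables (Pr : probability Omega R) (X : nat -> Omega -> 'I_d).
Hypothesis X_markov : markov_chain Pr P X.
Variable x0 : 'I_d.

(* Trajectories up to time n are tuples listed backwards in time. *)
Definition traj (l : seq 'I_d) (k : nat) : 'I_d := nth x0 (rev l) k.

Definition cylinder n (l : n.+1.-tuple 'I_d) : set Omega :=
  [set w | forall k, (k <= n)%N -> X k w = traj l k].

Definition cylinder_prob n (l : n.+1.-tuple 'I_d) : R := fine (Pr (cylinder l)).

(** Only finitely many trajectories exist up to time [n], so this is a finite sum, defined for every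
    [f]. *)
Definition path_mean n (f : ulam_state R d -> R) : R :=
  \sum_(l : n.+1.-tuple 'I_d) cylinder_prob l * f (ulam_run A P (traj l) n).

Lemma ulam_run_ext (x y : nat -> 'I_d) n :
  (forall k, (k <= n)%N -> x k = y k) -> ulam_run A P x n = ulam_run A P y n.
Proof.
elim: n => [|n IH] xy /=; first by rewrite xy.
by rewrite xy // IH // => k kn; rewrite xy // ltnW.
Qed.

Lemma us_cur_run (x : nat -> 'I_d) n : us_cur (ulam_run A P x n) = x n.
Proof. by case: n. Qed.

Lemma cylinder_measurable n (l : n.+1.-tuple 'I_d) : measurable (cylinder l).
Proof.
have -> : cylinder l = \bigcap_(k in `I_n.+1) (X k @^-1` [set traj l k]).
  apply/seteqP; split=> w H k; first by move=> kn; apply: H.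
  by move=> kn; apply: H.
by apply: fin_bigcap_measurable => // k _; exact: X_markov.1.
Qed.

Lemma cylinderP n (l : n.+1.-tuple 'I_d) w :
  cylinder l w <-> l = [tuple X (n - i) w | i < n.+1].
Proof.
split=> [H|->].
  apply: eq_from_tnth => i; rewrite tnth_mktuple H ?leq_subr // /traj nth_rev size_tuple.
    by rewrite subSS subKn ?(tnth_nth x0) //; rewrite -ltnS.
  by rewrite ltnS leq_subr.
move=> k kn; rewrite /traj nth_rev size_tuple // subSS.
have nk : (n - k < n.+1)%N by rewrite ltnS leq_subr.
rewrite -[(n - k)%N]/(nat_of_ord (Ordinal nk)) -tnth_nth tnth_mktuple /=.
by rewrite subKn.
Qed.

(** The cylinders of a given length partition the space, and the state of the recursion is constant
    on each. *)
Lemma expectation_path n (f : ulam_state R d -> R) :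
  ('E_Pr[fun w => f (ulam_run A P (fun k => X k w) n)] = (path_mean n f)%:E)%E.
Proof.
rewrite unlock.
pose g (l : n.+1.-tuple 'I_d) w :=
  (f (ulam_run A P (traj l) n) * \1_(cylinder l) w)%:E.
transitivity (\int[Pr]_w \sum_l g l w)%E.
  apply: eq_integral => w _.
  rewrite (bigD1 [tuple X (n - i) w | i < n.+1]) //=.
  set l := [tuple _ | _ < _].
  have cl : cylinder l w by apply/cylinderP.
  rewrite big1 ?adde0 => [|l' /eqP l'l].
    rewrite /g indicE mem_set // mulr1; congr (f _)%:E.
    by apply: ulam_run_ext => k kn; rewrite cl.
  rewrite /g indicE memNset ?mulr0 // => /cylinderP; exact: l'l.
have ic l : Pr.-integrable setT (EFin \o \1_(cylinder l)).
  by apply: integrable_indic => //; exact: cylinder_measurable.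
rewrite integral_sum //; last first.
  move=> l; have -> : g l = (fun w => (f (ulam_run A P (traj l) n))%:E *
      (EFin \o \1_(cylinder l)) w)%E by apply/funext => w; rewrite /g EFinM.
  exact: integrableZl.
rewrite /path_mean -sumEFin; apply: eq_bigr => l _.
rewrite /g; under eq_integral do rewrite EFinM.
rewrite integralZl //; last exact: ic.
rewrite integral_indic //; last exact: cylinder_measurable.
rewrite setIT mulrC EFinM /cylinder_prob fineK //.
by apply: fin_num_measure; exact: cylinder_measurable.
Qed.

Lemma path_mean_functional n : mean_functional (path_mean n).
Proof.
split.
- by move=> f g; rewrite -big_split; apply: eq_bigr => l _; rewrite mulrDr.
- by move=> c f; rewrite mulr_sumr; apply: eq_bigr => l _; rewrite mulrCA.
- by move=> f f0; apply: sumr_ge0 => l _; rewrite mulr_ge0 ?fine_ge0.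
- apply: EFin_inj; rewrite -expectation_path.
  exact: expectation_cst.
Qed.

Lemma cylinder_prob_cons n j (l : n.+1.-tuple 'I_d) :
  cylinder_prob [tuple of j :: l] = cylinder_prob l * P (traj l n) j.
Proof.
have tk k : (k <= n)%N -> traj (j :: l) k = traj l k.
  by move=> kn; rewrite /traj rev_cons nth_rcons size_rev size_tuple ltnS kn.
have tn : traj (j :: l) n.+1 = j.
  by rewrite /traj rev_cons nth_rcons size_rev size_tuple ltnn eqxx.
rewrite /cylinder_prob /cylinder (X_markov.2 n (traj (j :: l))) fineM //; last first.
  have -> : [set w | forall k : nat, (k <= n)%N -> X k w = traj (j :: l) k] = cylinder l.
    apply/seteqP; split=> w H k kn; first by rewrite -tk // H.
    by rewrite tk // H.
  by apply: fin_num_measure; exact: cylinder_measurable.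
rewrite /= tn tk //; congr (fine (Pr _) * _).
apply/seteqP; split=> w H k kn; first by rewrite -tk // H.
by rewrite tk // H.
Qed.

Lemma path_mean_ulam : ulam_mean A P path_mean.
Proof.
split; first exact: path_mean_functional.
- move=> n f; rewrite /path_mean.
  rewrite (reindex (fun jl : 'I_d * n.+1.-tuple 'I_d => [tuple of jl.1 :: jl.2])) /=; last first.
    exists (fun l : n.+2.-tuple 'I_d => (thead l, [tuple of behead l])) => [[j l] _|l _] /=.
      by congr (_, _); apply: val_inj.
    by rewrite -tuple_eta.
  transitivity (\sum_(j : 'I_d) \sum_(l : n.+1.-tuple 'I_d)
    cylinder_prob [tuple of j :: l] * f (ulam_run A P (traj (j :: l)) n.+1)).
    by rewrite pair_bigA /=; apply: eq_bigr => -[].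
  rewrite exchange_big; apply: eq_bigr => l _; rewrite /step_mean mulr_sumr.
  apply: eq_bigr => j _; rewrite cylinder_prob_cons us_cur_run mulrA.
  have tn : traj (j :: l) n.+1 = j.
    by rewrite /traj rev_cons nth_rcons size_rev size_tuple ltnn eqxx.
  rewrite /= tn; congr (_ * f (ulam_step _ _ _ _)); apply: ulam_run_ext => k kn.
  by rewrite /traj rev_cons nth_rcons size_rev size_tuple ltnS kn.
- move=> f c fc; rewrite -[RHS](mean_cst (path_mean_functional 0)).
  by apply: eq_bigr => l _; rewrite /= fc.
Qed.

End Transfer.

(** * Weak convergence from characteristic functions *)

Section FejerKernel.
Variable R : realType.
Implicit Types (x a b : R).

Lemma sum_cos_telescope (N : nat) a b :
  2 * sin (a / 2) * \sum_(k < N) cos (b + k%:R * a) =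
  sin (b + (N%:R - 2^-1) * a) - sin (b - a / 2).
Proof.
elim: N => [|N IH].
  by rewrite big_ord0 mulr0 sub0r mulNr (mulrC 2^-1) subrr.
rewrite big_ord_recr mulrDr IH /= -[N.+1%:R]natr1.
have -> : b + (N%:R + 1 - 2^-1) * a = (b + N%:R * a) + a / 2 by field.
have -> : b + (N%:R - 2^-1) * a = (b + N%:R * a) - a / 2 by field.
by rewrite (sinD (b + N%:R * a) (a / 2)) (sinB (b + N%:R * a) (a / 2)); ring.
Qed.

Lemma sinD2pin x (k : nat) : sin (x + k%:R * (2 * pi)) = sin x.
Proof.
have -> : k%:R * (2 * pi) = (pi *+ 2) *+ k :> R by rewrite !mulr_natl.
exact: (periodicn (@sinD2pi R)).
Qed.

(** The two ends of the telescoped sum differ by a multiple of [2 pi], while [0 < |k - l| < N] keeps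
    the factor [sin (a / 2)] nonzero. *)
Lemma sum_cos_grid (N k l : nat) b : (k < N)%N -> (l < N)%N -> k != l ->
  \sum_(j < N) cos (b + j%:R * ((k%:R - l%:R) * (2 * pi / N%:R))) = 0.
Proof.
move=> kN lN kl; have N0 : (N%:R : R) != 0 by rewrite pnatr_eq0 -lt0n (leq_ltn_trans _ kN).
have N_gt0 : (0 : R) < N%:R by rewrite lt_def N0 ler0n.
set a := _ * (2 * pi / N%:R).
have spos (u v : nat) : (u < N)%N -> (v < u)%N -> 0 < sin ((u%:R - v%:R) * (pi / N%:R) : R).
  move=> uN vu; apply: sin_gt0_pi; apply/andP; split.
    by rewrite mulr_gt0 ?divr_gt0 ?pi_gt0 // subr_gt0 ltr_nat.
  rewrite mulrCA gtr_pMr ?pi_gt0 // ltr_pdivrMr // mul1r.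
  apply: (@le_lt_trans _ _ u%:R); last by rewrite ltr_nat.
  by rewrite gerBl ler0n.
have sa : sin (a / 2) != 0.
  have -> : a / 2 = (k%:R - l%:R) * (pi / N%:R) by rewrite /a; field.
  move: kl; rewrite neq_ltn => /orP[kl|lk].
    by rewrite -opprB mulNr sinN oppr_eq0 gt_eqF // spos.
  by rewrite gt_eqF // spos.
have s2 : 2 * sin (a / 2) != 0 by rewrite mulf_neq0.
apply: (mulfI s2); rewrite mulr0 sum_cos_telescope.
have <- : sin (b + (N%:R - 2^-1) * a + l%:R * (2 * pi)) = sin (b + (N%:R - 2^-1) * a).
  exact: sinD2pin.
have -> : b + (N%:R - 2^-1) * a + l%:R * (2 * pi) = b - a / 2 + k%:R * (2 * pi).
  by rewrite /a; field.
by rewrite sinD2pin subrr.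
Qed.

(** [|sum_k e^(i k x)|^2 / N^2]; with this normalization the translates over the grid of [N] points
    sum to 1, and finite sums replace integrals. *)
Definition fejer (N : nat) x : R :=
  ((\sum_(k < N) cos (k%:R * x)) ^+ 2 + (\sum_(k < N) sin (k%:R * x)) ^+ 2)
    / N%:R ^+ 2.

Lemma fejer_ge0 N x : 0 <= fejer N x.
Proof. by rewrite divr_ge0 ?addr_ge0 ?sqr_ge0. Qed.

Lemma fejerE N x : fejer N x =
  (\sum_(k < N) \sum_(l < N) cos (k%:R * x - l%:R * x)) / N%:R ^+ 2.
Proof.
congr (_ / _); rewrite !expr2 !big_distrlr -big_split /=; apply: eq_bigr => k _.
by rewrite -big_split; apply: eq_bigr => l _; rewrite cosB.
Qed.

Lemma fejer_grid N x : (0 < N)%N ->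
  \sum_(j < N) fejer N (x - j%:R * (2 * pi / N%:R)) = 1.
Proof.
move=> N0; have N0' : (N%:R : R) != 0 by rewrite pnatr_eq0 -lt0n.
under eq_bigr do rewrite fejerE; rewrite -mulr_suml exchange_big /=.
under eq_bigr do rewrite exchange_big.
have inner (k l : 'I_N) : \sum_(j < N)
   cos (k%:R * (x - j%:R * (2 * pi / N%:R)) - l%:R * (x - j%:R * (2 * pi / N%:R))) =
   (k == l)%:R * N%:R.
  have [->|kl] := eqVneq k l.
    under eq_bigr do rewrite subrr cos0.
    by rewrite sumr_const card_ord mul1r.
  rewrite mul0r -[RHS](@sum_cos_grid N l k ((k%:R - l%:R) * x)) //; last by rewrite eq_sym.
  by apply: eq_bigr => j _; congr cos; ring.
under eq_bigr => k _ do under eq_bigr do rewrite inner.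
have -> : \sum_(k < N) \sum_(l < N) (k == l)%:R * N%:R = N%:R ^+ 2 :> R.
  have inner1 (k : 'I_N) : \sum_(l < N) (k == l)%:R * N%:R = N%:R :> R.
    rewrite (bigD1 k) //= eqxx mul1r big1 ?addr0 // => l /negbTE.
    by rewrite eq_sym => ->; rewrite mul0r.
  by under eq_bigr do rewrite inner1; rewrite sumr_const card_ord -[LHS]mulr_natl -expr2.
by rewrite divff // expf_neq0.
Qed.

(** In complex form, [(1 - cos x) |sum_k e^(i k x)|^2 = |1 - e^(i N x)|^2 / 2], which is at most
    2. *)
Lemma fejer_concentration N x : (0 < N)%N ->
  (1 - cos x) * fejer N x <= 2 / N%:R ^+ 2.
Proof.
move=> N0; rewrite mulrA ler_pM2r ?invr_gt0 ?exprn_gt0 ?ltr0n //.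
set C := \sum_(k < N) cos _; set S := \sum_(k < N) sin _.
have HC : 2 * sin (x / 2) * C = sin ((N%:R - 2^-1) * x) + sin (x / 2).
  have := sum_cos_telescope N x 0; rewrite !add0r sinN opprK => <-.
  by congr (_ * _); apply: eq_bigr => k _; rewrite add0r.
have HS : 2 * sin (x / 2) * S = cos (x / 2) - cos ((N%:R - 2^-1) * x).
  have := sum_cos_telescope N x (- (pi / 2)).
  rewrite (addrC (- (pi / 2)) (_ * x)) -opprD sinN (addrC (pi / 2)) sinDpihalf sinBpihalf.
  rewrite opprK addrC => <-.
  by congr (_ * _); apply: eq_bigr => k _; rewrite addrC cosBpihalf.
have -> : (1 - cos x) * (C ^+ 2 + S ^+ 2) =
    ((2 * sin (x / 2) * C) ^+ 2 + (2 * sin (x / 2) * S) ^+ 2) / 2.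
  by rewrite one_sub_cosE; field.
rewrite HC HS; set u := (N%:R - 2^-1) * x; set v := x / 2.
have Hu := cos2Dsin2 u; have Hv := cos2Dsin2 v.
have -> : (sin u + sin v) ^+ 2 + (cos v - cos u) ^+ 2 =
   (cos u ^+ 2 + sin u ^+ 2) + (cos v ^+ 2 + sin v ^+ 2) - 2 * cos (u + v).
  by rewrite cosD; ring.
rewrite Hu Hv; have := cos_geN1 (u + v); lra.
Qed.

End FejerKernel.

(** * Approximation by bounded trigonometric polynomials *)

Section TrigPolynomials.
Variables (R : realType) (n : nat).
Implicit Types (x t : 'rV[R]_n) (g : 'rV[R]_n -> R).

Definition dotv t x : R := \sum_i t 0 i * x 0 i.

(** Each entry lists coefficient, frequency and phase; phases make the class closed under products
    without sines. *)
Definition trig_sum (s : seq (R * 'rV[R]_n * R)) x : R :=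
  \sum_(a <- s) a.1.1 * cos (dotv a.1.2 x + a.2).

Definition trigpoly g := exists s, g =1 trig_sum s.

Lemma trigpolyD g g' : trigpoly g -> trigpoly g' -> trigpoly (fun x => g x + g' x).
Proof.
by move=> [s gs] [s' gs']; exists (s ++ s') => x; rewrite /trig_sum big_cat gs gs'.
Qed.

Lemma trigpolyZ (c : R) g : trigpoly g -> trigpoly (fun x => c * g x).
Proof.
move=> [s gs]; exists [seq (c * a.1.1, a.1.2, a.2) | a <- s] => x.
rewrite gs /trig_sum big_map mulr_sumr.
by apply: eq_bigr => a _; rewrite mulrA.
Qed.

Lemma trigpoly_cos t (b : R) : trigpoly (fun x => cos (dotv t x + b)).
Proof.
by exists [:: (1, t, b)] => x; rewrite /trig_sum big_seq1 mul1r.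
Qed.

Lemma trigpoly_ext g g' : g =1 g' -> trigpoly g -> trigpoly g'.
Proof. by move=> gg' [s gs]; exists s => x; rewrite -gg' gs. Qed.

Lemma dotvDl t t' x : dotv (t + t') x = dotv t x + dotv t' x.
Proof. by rewrite /dotv -big_split; apply: eq_bigr => i _; rewrite mxE mulrDl. Qed.

Lemma dotvZl (a : R) t x : dotv (a *: t) x = a * dotv t x.
Proof. by rewrite /dotv mulr_sumr; apply: eq_bigr => i _; rewrite mxE mulrA. Qed.

Lemma dotv0 x : dotv 0 x = 0.
Proof. by rewrite /dotv big1 // => i _; rewrite mxE mul0r. Qed.

Lemma trigpoly_cst (c : R) : trigpoly (fun=> c).
Proof.
apply: trigpoly_ext (trigpolyZ c (trigpoly_cos 0 0)) => x.
by rewrite dotv0 addr0 cos0 mulr1.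
Qed.

Lemma trigpolyM g g' : trigpoly g -> trigpoly g' -> trigpoly (fun x => g x * g' x).
Proof.
move=> [s gs] [s' gs'].
apply: (@trigpoly_ext (fun x => trig_sum s x * trig_sum s' x)).
  by move=> x; rewrite gs gs'.
elim: s {gs} => [|[[c t] b] s IH].
  by apply: trigpoly_ext (trigpoly_cst 0) => x; rewrite /trig_sum big_nil mul0r.
apply: (@trigpoly_ext (fun x => c * cos (dotv t x + b) * trig_sum s' x +
   trig_sum s x * trig_sum s' x)).
  by move=> x; rewrite /trig_sum big_cons mulrDl.
apply: trigpolyD => //; elim: s' {gs' IH} => [|[[c' t'] b'] s' IH].
  by apply: trigpoly_ext (trigpoly_cst 0) => x; rewrite /trig_sum big_nil mulr0.
apply: (@trigpoly_ext (fun x => (c * c' / 2) * (cos (dotv (t + t') x + (b + b')) +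
  cos (dotv (t + -1 *: t') x + (b - b'))) + c * cos (dotv t x + b) * trig_sum s' x)).
  move=> x; rewrite /trig_sum big_cons /= [RHS]mulrDr; congr (_ + _).
  rewrite !dotvDl dotvZl.
  have -> : dotv t x + dotv t' x + (b + b') = (dotv t x + b) + (dotv t' x + b') by ring.
  have -> : dotv t x + -1 * dotv t' x + (b - b') =
    (dotv t x + b) - (dotv t' x + b') by ring.
  by rewrite cosD cosB; field.
apply: trigpolyD => //; apply: trigpolyZ; apply: trigpolyD; exact: trigpoly_cos.
Qed.

Lemma trigpoly_sum (I : Type) (s : seq I) (g : I -> 'rV[R]_n -> R) :
  (forall i, trigpoly (g i)) -> trigpoly (fun x => \sum_(i <- s) g i x).
Proof.
move=> gP; elim: s => [|i s IH].
  by apply: trigpoly_ext (trigpoly_cst 0) => x; rewrite big_nil.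
apply: trigpoly_ext (trigpolyD (gP i) IH) => x.
by rewrite big_cons.
Qed.

Lemma trigpoly_prod (I : Type) (s : seq I) (g : I -> 'rV[R]_n -> R) :
  (forall i, trigpoly (g i)) -> trigpoly (fun x => \prod_(i <- s) g i x).
Proof.
move=> gP; elim: s => [|i s IH].
  by apply: trigpoly_ext (trigpoly_cst 1) => x; rewrite big_nil.
apply: trigpoly_ext (trigpolyM (gP i) IH) => x.
by rewrite big_cons.
Qed.

Lemma trigpoly_fejer N i (a b : R) : trigpoly (fun x => fejer N (a * x 0 i + b)).
Proof.
apply: (@trigpoly_ext (fun x => (N%:R ^+ 2)^-1 * \sum_(k < N) \sum_(l < N)
   cos (dotv ((k%:R - l%:R) * a *: delta_mx 0 i) x + (k%:R - l%:R) * b))).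
  move=> x; rewrite fejerE mulrC; congr (_ / _); apply: eq_bigr => k _.
  apply: eq_bigr => l _; congr cos; rewrite dotvZl /dotv (bigD1 i) //= mxE !eqxx.
  rewrite big1 => [|j /negbTE ji]; last by rewrite mxE ji mul0r.
  rewrite addr0 mul1r; ring.
apply: trigpolyZ; apply: trigpoly_sum => k; apply: trigpoly_sum => l.
exact: trigpoly_cos.
Qed.

(** Only [x] is confined to the box while [y] may leave it, so continuity at box points is used on
    balls of half the radius. *)
Lemma continuous_box_uniform (f : 'rV[R]_n -> R) (L e : R) : continuous f -> 0 < e ->
  exists2 d : R, 0 < d & forall x y : 'rV[R]_n, (forall i, `|x 0 i| <= L) ->
    (forall i, `|x 0 i - y 0 i| < d) -> `|f x - f y| < e.
Proof.
move=> cf e0.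
pose K : set 'rV[R]_n := [set x | forall i, `|x 0 i| <= L].
have cK : compact K.
  have -> : K = [set x : 'rV[R]_n | forall i, `[- L, L]%classic (x 0 i)].
    by apply/seteqP; split=> x H i; have := H i; rewrite /= in_itv /= ler_norml.
  by apply: (@rV_compact R n (fun=> `[- L, L]%classic)) => i; exact: segment_compact.
have /compact_near_coveringP ncK := cK.
have : \forall d \near (0 : R)^'+, K `<=` [set x : 'rV[R]_n | forall y : 'rV[R]_n,
    (forall i, `|x 0 i - y 0 i| < d) -> `|f x - f y| < e].
  apply: ncK => x Kx.
  have /cvgrPdist_lt /(_ (e / 2)) : f y @[y --> x] --> f x by exact: cf.
  rewrite divr_gt0 // => /(_ isT) /nbhs_ballP [r /= r0 Hr].
  have r2 : 0 < r / 2 by rewrite divr_gt0.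
  exists (ball x (r / 2), [set d | 0 < d < r / 2]) => /=.
    split; first exact: nbhsx_ballx.
    by near=> z; rewrite /=; apply/andP; split; near: z; [exact: nbhs_right_gt | exact: nbhs_right_lt].
  move=> [y d] /= [[_ xy] /andP[d0 dr]] z yz.
  have xyr : ball x r y.
    by split => // i j; apply: le_ball (xy i j); rewrite ler_pdivrMr // ler_peMr // ?ler1n // ltW.
  have xzr : ball x r z.
    split => // i j; rewrite [r]splitr; apply: ball_triangle (xy i j) _.
    by rewrite (ord1 i) /ball /=; apply: lt_trans (yz j) dr.
  have -> : f y - f z = (f x - f z) - (f x - f y) by ring.
  apply: le_lt_trans (ler_normB _ _) _; rewrite [e]splitr.
  by apply: ltrD; exact: Hr.
move=> H; near (0 : R)^'+ => d; exists d; first by near: d; exact: nbhs_right_gt.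
have Hd := near H d.
by move=> x y xK xy; apply: Hd => //; near: d.
Unshelve. all: by end_near.
Qed.

(** Angles up to [3 pi / 2] occur because the grid fills a box of twice the size; they stay away
    from [2 pi], where the cosine returns to 1. *)
Lemma one_sub_cos_lower (a y : R) : 0 < a <= pi / 2 -> a <= `|y| <= 3 / 2 * pi ->
  1 - cos a <= 1 - cos y.
Proof.
move=> /andP[a0 api] /andP[ay ypi].
rewrite lerD2l lerN2 -cos_norm; set t := `|y| in ay ypi *.
have p0 := pi_gt0 R.
have ca : 0 <= cos a by apply: cos_ge0_pihalf; rewrite api andbT; lra.
have [tp|tp] := lerP t (pi / 2).
  rewrite leNgt ltr_cos ?in_itv /=; first by rewrite -leNgt.
  - by apply/andP; split; lra.
  - by apply/andP; split; lra.
apply: le_trans ca; rewrite -oppr_ge0.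
have -> : - cos t = cos (t - pi) by rewrite cosB sinpi cospi; ring.
by apply: cos_ge0_pihalf; apply/andP; split; lra.
Qed.

(** A Bernstein-type operator: [g] averages the values of [f] at grid nodes with products of Fejer
    kernels as weights. They are nonnegative with sum 1, so the bound [b] holds on the whole space,
    and they concentrate near [x]. *)
Lemma trig_approximation (f : 'rV[R]_n -> R) (b L e : R) :
  continuous f -> (forall x, `|f x| <= b) -> 0 < L -> 0 < e ->
  exists g, [/\ trigpoly g, forall x, `|g x| <= b &
    forall x, (forall i, `|x 0 i| <= L) -> `|f x - g x| <= e].
Proof.
move=> cf fb L0 e0.
have b0 : 0 <= b by apply: le_trans (fb 0).
have e20 : 0 < e / 2 by rewrite divr_gt0.
have [dl dl0 Hdl] := continuous_box_uniform L cf e20.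
have p0 := pi_gt0 R.
have L20 : 0 < 2 * L by rewrite mulr_gt0.
(* The modulus [dl] in angular scale, capped for the cosine comparison. *)
pose al : R := Num.min (dl * pi / (2 * L)) (pi / 2).
have al0 : 0 < al <= pi / 2.
  by rewrite lt_min !divr_gt0 ?mulr_gt0 //= ge_min lexx orbT.
pose c : R := 1 - cos al.
have c0 : 0 < c.
  rewrite subr_gt0 -cos0 ltr_cos ?in_itv /=; first by case/andP: al0.
  - by rewrite lexx ltW.
  - by case/andP: al0 => a1 a2; apply/andP; split; lra.
(* The error is [2 * b / c] times [n] coordinates times the concentration bound [2 / N]. *)
have [N N0 HN] : exists2 N : nat, (0 < N)%N & 4 * b * n%:R / c <= e / 2 * N%:R.
  exists (Num.Def.archi_bound (4 * b * n%:R / c / (e / 2))).+1 => //.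
  rewrite [leRHS]mulrC -ler_pdivrMr //; apply: ltW.
  apply: (@lt_le_trans _ _ (Num.Def.archi_bound (4 * b * n%:R / c / (e / 2)))%:R).
    by apply: archi_boundP; rewrite !divr_ge0 ?mulr_ge0 ?ler0n // ltW.
  by rewrite ler_nat.
have N0' : (N%:R : R) != 0 by rewrite pnatr_eq0 -lt0n.
have N_gt0 : (0 : R) < N%:R by rewrite ltr0n.
pose z (j : 'I_N) : R := 2 * L * (2 * j%:R / N%:R - 1).
pose zz (j : {ffun 'I_n -> 'I_N}) : 'rV[R]_n := \row_i z (j i).
pose ang (x : R) (j : 'I_N) := pi / (2 * L) * x + (pi - j%:R * (2 * pi / N%:R)).
have angE (x : R) j : ang x j = pi / (2 * L) * (x - z j).
  by rewrite /ang /z; field; rewrite N0' gt_eqF.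
have kap0 (x : R) j : 0 <= fejer N (ang x j) by exact: fejer_ge0.
have kap1 (x : R) : \sum_j fejer N (ang x j) = 1.
  rewrite -[RHS](fejer_grid (pi / (2 * L) * x + pi) N0); apply: eq_bigr => j _.
  by rewrite /ang addrA.
pose W (x : 'rV[R]_n) (j : {ffun 'I_n -> 'I_N}) := \prod_i fejer N (ang (x 0 i) (j i)).
have W0 x j : 0 <= W x j by apply: prodr_ge0.
have W1 x : \sum_j W x j = 1.
  rewrite /W -(bigA_distr_bigA (fun i j => fejer N (ang (x 0 i) j))).
  by apply: big1 => i _; exact: kap1.
have Wc x i : \sum_j W x j * (1 - cos (ang (x 0 i) (j i))) <= 2 / N%:R.
  pose G k (j : 'I_N) := fejer N (ang (x 0 k) j) *
    (if k == i then 1 - cos (ang (x 0 k) j) else 1).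
  have -> : \sum_j W x j * (1 - cos (ang (x 0 i) (j i))) =
      \sum_(j : {ffun 'I_n -> 'I_N}) \prod_k G k (j k).
    apply: eq_bigr => j _; rewrite /G big_split /=; congr (_ * _).
    rewrite (bigD1 i) //= eqxx big1 ?mulr1 // => k /negbTE ki.
    by rewrite ki.
  rewrite -(bigA_distr_bigA G) (bigD1 i) //= [X in _ * X]big1 => [|k /negbTE ki].
    rewrite mulr1 /G eqxx; apply: (@le_trans _ _ (\sum_(j < N) 2 / N%:R ^+ 2)).
      by apply: ler_sum => j _; rewrite mulrC fejer_concentration.
    rewrite sumr_const card_ord -[_ *+ N]mulr_natl.
    by rewrite le_eqVlt; apply/orP; left; apply/eqP; field.
  by rewrite /G ki -[RHS](kap1 (x 0 k)); apply: eq_bigr => j _; rewrite mulr1.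
exists (fun x => \sum_j f (zz j) * W x j); split.
- apply: trigpoly_sum => j; apply: trigpolyZ; apply: trigpoly_prod => i.
  exact: trigpoly_fejer.
- move=> x; apply: le_trans (ler_norm_sum _ _ _) _.
  rewrite -[leRHS]mulr1 -(W1 x) mulr_sumr; apply: ler_sum => j _.
  by rewrite normrM (ger0_norm (W0 _ _)) ler_wpM2r.
move=> x xL.
have -> : f x - \sum_j f (zz j) * W x j = \sum_j (f x - f (zz j)) * W x j.
  under [RHS]eq_bigr do rewrite mulrBl.
  by rewrite sumrB -mulr_sumr W1 mulr1.
apply: le_trans (ler_norm_sum _ _ _) _.
have term : \sum_j `|(f x - f (zz j)) * W x j| <=
  \sum_(j : {ffun 'I_n -> 'I_N}) (e / 2 + (2 * b / c) *
    \sum_i (1 - cos (ang (x 0 i) (j i)))) * W x j.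
  apply: ler_sum => j _; rewrite normrM (ger0_norm (W0 _ _)) ler_wpM2r //.
  have cs0 i : 0 <= 1 - cos (ang (x 0 i) (j i)) by rewrite subr_ge0 cos_le1.
  have css : 0 <= \sum_i (1 - cos (ang (x 0 i) (j i))) by apply: sumr_ge0.
  have bc0 : 0 <= 2 * b / c by rewrite divr_ge0 ?mulr_ge0 // ltW.
  have [xz|] := pselect (forall i, `|x 0 i - zz j 0 i| < dl).
    by apply: ler_wpDr; [rewrite mulr_ge0 | exact: ltW (Hdl _ _ xL xz)].
  move=> /existsNP[i /negP]; rewrite -leNgt mxE => xzi.
  apply: ler_wpDl; first exact: ltW.
  have f2b : `|f x - f (zz j)| <= 2 * b.
    by apply: le_trans (ler_normB _ _) _; rewrite mulr_natl mulr2n lerD.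
  apply: le_trans f2b _; rewrite -mulrA ler_peMr ?mulr_ge0 //.
  rewrite mulrC ler_pdivlMr // mul1r.
  apply: (@le_trans _ _ (1 - cos (ang (x 0 i) (j i)))); last first.
    by rewrite (bigD1 i) //= lerDl sumr_ge0.
  apply: one_sub_cos_lower => //.
  rewrite angE normrM gtr0_norm ?divr_gt0 //; apply/andP; split.
    rewrite ge_min; apply/orP; left.
    have -> : dl * pi / (2 * L) = pi / (2 * L) * dl by ring.
    by rewrite ler_wpM2l // divr_ge0 // ltW.
  have zL : `|z (j i)| <= 2 * L.
    rewrite /z normrM gtr0_norm // ler_piMr ?(ltW L20) // ler_norml.
    have j0 : (0 : R) <= (j i)%:R / N%:R by rewrite divr_ge0.
    have j1 : (j i)%:R / N%:R <= (1 : R).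
      by rewrite ler_pdivrMr // mul1r ler_nat ltnW.
    by rewrite -mulrA; apply/andP; split; lra.
  have : `|x 0 i - z (j i)| <= 3 * L.
    by apply: le_trans (ler_normB _ _) _; have := xL i; lra.
  move=> H; apply: le_trans (ler_wpM2l _ H) _; first by rewrite divr_ge0 // ltW.
  by rewrite le_eqVlt; apply/orP; left; apply/eqP; field; rewrite gt_eqF.
apply: le_trans term _; under eq_bigr do rewrite mulrDl.
rewrite big_split /= -mulr_sumr W1 mulr1 [leRHS]splitr lerD2l.
have -> : \sum_(j : {ffun 'I_n -> 'I_N}) 2 * b / c * (\sum_i (1 - cos (ang (x 0 i) (j i)))) * W x j =
  2 * b / c * \sum_i \sum_(j : {ffun 'I_n -> 'I_N}) W x j * (1 - cos (ang (x 0 i) (j i))).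
  rewrite exchange_big mulr_sumr; apply: eq_bigr => j _.
  by rewrite -mulrA -mulr_sumr mulrC (mulrC _ (W x j)); ring.
apply: (@le_trans _ _ (2 * b / c * \sum_(i < n) 2 / N%:R)).
  by rewrite ler_wpM2l ?divr_ge0 ?mulr_ge0 ?(ltW c0) //; apply: ler_sum.
rewrite sumr_const card_ord -[_ *+ n]mulr_natl.
rewrite -(ler_pM2r N_gt0); apply: le_trans HN.
by rewrite le_eqVlt; apply/orP; left; apply/eqP; field; rewrite N0' gt_eqF.
Qed.

End TrigPolynomials.

(** * Weak convergence from cosines and second moments *)

Lemma nbhs_infty_succ_ge (R : realType) (x : R) :
  \forall j \near \oo, x <= j.+1%:R.
Proof.
apply: filterS (nbhs_infty_ger x) => j xj.
by apply: le_trans xj _; rewrite ler_nat.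
Qed.

Section WeakConvergence.
Variables (R : realType) (dT : measure_display) (T : measurableType dT).
Variable (Q : probability T R).

Lemma bounded_integrable (f : T -> R) (b : R) : measurable_fun setT f ->
  (forall w, `|f w| <= b) -> Q.-integrable setT (EFin \o f).
Proof.
move=> mf fb; apply: measurable_bounded_integrable => //.
  by apply: le_lt_trans (probability_le1 Q measurableT) _; rewrite ltry.
exists b; split; first exact: num_real.
by move=> x bx w _ /=; apply: le_trans (fb w) (ltW bx).
Qed.

Variables (n : nat) (Y : T -> 'rV[R]_n).
Hypothesis mY : forall i, measurable_fun setT (fun w => Y w 0 i).

Lemma measurable_dotv (t : 'rV[R]_n) : measurable_fun setT (fun w => dotv t (Y w)).
Proof.
by apply: measurable_sum => i; apply: measurable_funM => //; exact: mY.
Qed.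

Lemma measurable_cos_dotv (t : 'rV[R]_n) (b : R) :
  measurable_fun setT (fun w => cos (dotv t (Y w) + b)).
Proof.
apply: (measurableT_comp (f := @cos R)); first exact: continuous_measurable_fun (@continuous_cos R).
by apply: measurable_funD => //; exact: measurable_dotv.
Qed.

Lemma measurable_trigpoly (g : 'rV[R]_n -> R) : trigpoly g ->
  measurable_fun setT (fun w => g (Y w)).
Proof.
move=> [s gs]; under eq_fun do rewrite gs.
apply: measurable_sum => -[[c t] b] /=; apply: measurable_funM => //.
exact: measurable_cos_dotv.
Qed.

Lemma trig_sequence (f : 'rV[R]_n -> R) (b : R) : continuous f ->
  (forall x, `|f x| <= b) -> exists g : nat -> 'rV[R]_n -> R,
  forall j, [/\ trigpoly (g j), forall x, `|g j x| <= b &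
    forall x : 'rV[R]_n, (forall i, `|x 0 i| <= j.+1%:R) -> `|f x - g j x| <= j.+1%:R^-1].
Proof.
move=> cf fb.
have /choice[g Hg] j := trig_approximation cf fb (ltr0Sn R j)
  (etrans (invr_gt0 _) (ltr0Sn R j) : 0 < j.+1%:R^-1).
by exists g.
Qed.

Lemma trig_sequence_cvg (f : 'rV[R]_n -> R) (g : nat -> 'rV[R]_n -> R) :
  (forall j (x : 'rV[R]_n), (forall i, `|x 0 i| <= j.+1%:R) -> `|f x - g j x| <= j.+1%:R^-1) ->
  forall x, g j x @[j --> \oo] --> f x.
Proof.
move=> fg x; apply/cvgrPdist_le => e e0.
near=> j; apply: le_trans (fg j x _) _.
  move=> i; apply: (@le_trans _ _ (\sum_k `|x 0 k|)).
    by rewrite (bigD1 i) //= lerDl sumr_ge0.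
  by near: j; exact: nbhs_infty_succ_ge.
rewrite invf_ple ?posrE ?ltr0n //.
by near: j; exact: nbhs_infty_succ_ge.
Unshelve. all: by end_near.
Qed.

(** [f (Y w)] is a pointwise limit of trigonometric polynomials in the coordinates, so measurability
    of each coordinate suffices. *)
Lemma measurable_continuous_rv (f : 'rV[R]_n -> R) (b : R) : continuous f ->
  (forall x, `|f x| <= b) -> measurable_fun setT (fun w => f (Y w)).
Proof.
move=> cf fb; have [g Hg] := trig_sequence cf fb.
apply: (@measurable_fun_cvg _ _ _ _ (fun j w => g j (Y w))).
  by move=> j; apply: measurable_trigpoly; case: (Hg j).
by move=> w _; apply: trig_sequence_cvg => j x; case: (Hg j) => _ _; exact.
Qed.

Local Notation I f := (\int[Q]_w f (Y w))%R.

Lemma Rintegral_trig_cvg (f : 'rV[R]_n -> R) (b : R) (g : nat -> 'rV[R]_n -> R) :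
  continuous f -> (forall x, `|f x| <= b) ->
  (forall j, [/\ trigpoly (g j), forall x, `|g j x| <= b &
    forall x : 'rV[R]_n, (forall i, `|x 0 i| <= j.+1%:R) -> `|f x - g j x| <= j.+1%:R^-1]) ->
  I (g j) @[j --> \oo] --> I f.
Proof.
move=> cf fb Hg.
have mf := measurable_continuous_rv cf fb.
have mg j : measurable_fun setT (fun w => g j (Y w)).
  by apply: measurable_trigpoly; case: (Hg j).
have ib : Q.-integrable setT (EFin \o cst b).
  by apply: (@bounded_integrable _ `|b|).
apply: fine_cvg; rewrite fineK; last first.
  apply: integrable_fin_num => //.
  exact: (bounded_integrable (f := fun w => f (Y w)) mf (b := b)).
have mg' j : measurable_fun setT (fun w => (g j (Y w))%:E) by exact/measurable_EFinP.
have mf' : measurable_fun setT (fun w => (f (Y w))%:E) by exact/measurable_EFinP.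
have gf : {ae Q, forall w, setT w -> (g j (Y w))%:E @[j --> \oo] --> (f (Y w))%:E}.
  apply: aeW => w _; apply: cvg_EFin; first by near=> j.
  by apply: trig_sequence_cvg => j x; case: (Hg j) => _ _; exact.
have gb : {ae Q, forall w j, setT w -> (`|(g j (Y w))%:E| <= (EFin \o cst b) w)%E}.
  by apply: aeW => w j _; rewrite /= lee_fin; case: (Hg j).
by have [] := dominated_convergence measurableT mg' mf' gf ib gb.
Unshelve. all: by end_near.
Qed.

(** Outside the box of half-side [j + 1] the approximation error is at most [2 b], and there
    [1 <= |x|^2 / (j + 1)^2]. This Chebyshev bound is uniform in [k] and takes the place of
    tightness. *)
Theorem weak_cvg_of_cos (m : nat -> ('rV[R]_n -> R) -> R) (C : R) :
  (forall k, mean_functional (m k)) ->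
  (forall k, m k (fun x => \sum_i x 0 i ^+ 2) <= C) ->
  (forall t b, m k (fun x => cos (dotv t x + b)) @[k --> \oo] -->
     I (fun x => cos (dotv t x + b))) ->
  forall f : 'rV[R]_n -> R, continuous f -> (exists b : R, forall x, `|f x| <= b) ->
  m k f @[k --> \oo] --> I f.
Proof.
move=> mP mC mcos f cf [b fb].
have b0 : 0 <= b by apply: le_trans (fb 0).
have C0 : 0 <= C.
  apply: le_trans (mC 0%N); apply: (mean_ge0 (mP _)) => x.
  by apply: sumr_ge0 => i _; exact: sqr_ge0.
have [g Hg] := trig_sequence cf fb.
have mtrig h : trigpoly h -> m k h @[k --> \oo] --> I h.
  move=> [s /funext ->] {h}; elim: s => [|[[c t] b'] s IH].
    have E x : trig_sum [::] x = 0 :> R by rewrite /trig_sum big_nil.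
    under [X in X @ _ --> _]eq_fun => k.
      rewrite (_ : trig_sum [::] = fun=> 0); last exact/funext/E.
      rewrite (mean_cst (mP k)); over.
    under eq_Rintegral do rewrite E.
    by rewrite Rintegral_cst // mul0r; exact: cvg_cst.
  have E x : trig_sum ((c, t, b') :: s) x = c * cos (dotv t x + b') + trig_sum s x.
    by rewrite /trig_sum big_cons.
  under [X in X @ _ --> _]eq_fun => k.
    rewrite (_ : trig_sum _ = fun x => c * cos (dotv t x + b') + trig_sum s x); last exact/funext/E.
    rewrite (meanD (mP k)) (meanZ (mP k)); over.
  have ic : Q.-integrable setT (EFin \o (fun w => cos (dotv t (Y w) + b'))).
    by apply: (@bounded_integrable _ 1) => [|w]; [exact: measurable_cos_dotv | exact: cos_max].
  under eq_Rintegral do rewrite E.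
  rewrite RintegralD //; last 2 first.
  - apply: (@bounded_integrable _ `|c|) => [|w].
      by apply: measurable_funM => //; exact: measurable_cos_dotv.
    by rewrite normrM ler_piMr // cos_max.
  - apply: (@bounded_integrable _ (\sum_(a <- s) `|a.1.1|)) => [|w].
      by apply: measurable_trigpoly; exists s.
    apply: le_trans (ler_norm_sum _ _ _) _; apply: ler_sum => a _.
    by rewrite normrM ler_piMr // cos_max.
  rewrite RintegralZl //; apply: cvgD => //; apply: cvgMr; exact: mcos.
have Ig := Rintegral_trig_cvg cf fb Hg.
have err j k : `|m k f - m k (g j)| <= j.+1%:R^-1 + 2 * b * C / j.+1%:R ^+ 2.
  have jp : (0 : R) < j.+1%:R ^+ 2 by rewrite exprn_gt0.
  rewrite -(meanB (mP k)).
  apply: (@le_trans _ _ (m k (fun x => j.+1%:R^-1 + (2 * b / j.+1%:R ^+ 2) *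
     \sum_i x 0 i ^+ 2))).
    apply: (norm_mean_le (mP k)) => x.
    have [_ gb gf] := Hg j.
    have sx0 : 0 <= \sum_i x 0 i ^+ 2 by apply: sumr_ge0 => i _; exact: sqr_ge0.
    have bj0 : 0 <= 2 * b / j.+1%:R ^+ 2 by rewrite divr_ge0 ?mulr_ge0 // ltW.
    have [xj|] := pselect (forall i, `|x 0 i| <= j.+1%:R).
      by apply: ler_wpDr; [rewrite mulr_ge0 | exact: gf].
    move=> /existsNP[i /negP]; rewrite -ltNge => xji.
    apply: ler_wpDl; first by rewrite invr_ge0.
    apply: (@le_trans _ _ (2 * b)).
      by apply: le_trans (ler_normB _ _) _; rewrite mulr_natl mulr2n lerD.
    rewrite -mulrA ler_peMr ?mulr_ge0 // mulrC ler_pdivlMr // mul1r.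
    apply: (@le_trans _ _ (x 0 i ^+ 2)).
      by rewrite -[leRHS]real_normK ?num_real // lerXn2r ?nnegrE // ltW.
    by rewrite (bigD1 i) //= lerDl sumr_ge0 // => l _; exact: sqr_ge0.
  rewrite (meanD (mP k)) (meanZ (mP k)) (mean_cst (mP k)) lerD2l.
  rewrite [leRHS]mulrAC ler_wpM2l //.
  by rewrite divr_ge0 ?mulr_ge0 // ltW.
apply/cvgrPdist_le => e e0.
have e30 : 0 < e / 3 by rewrite divr_gt0.
have [j Hj1 Hj2] : exists2 j, `|I f - I (g j)| <= e / 3 &
    j.+1%:R^-1 + 2 * b * C / j.+1%:R ^+ 2 <= e / 3.
  near \oo => j; exists j; first by near: j; move/cvgrPdist_le: Ig; exact.
  have jp : (0 : R) < j.+1%:R by [].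
  apply: (@le_trans _ _ ((1 + 2 * b * C) / j.+1%:R)).
    rewrite [leRHS]mulrDl mul1r lerD2l ler_wpM2l ?mulr_ge0 // lef_pV2 ?posrE ?exprn_gt0 //.
    by rewrite expr2 ler_peMr // ler1n.
  rewrite ler_pdivrMr // [leRHS]mulrC -ler_pdivrMr //.
  by near: j; exact: nbhs_infty_succ_ge.
have gj : trigpoly (g j) by case: (Hg j).
near=> k.
have -> : I f - m k f = (I f - I (g j)) + (I (g j) - m k (g j)) - (m k f - m k (g j)) by ring.
apply: le_trans (ler_normB _ _) _; apply: le_trans (lerD (ler_normD _ _) (lexx _)) _.
have H3 : `|I (g j) - m k (g j)| <= e / 3.
  by near: k; move/cvgrPdist_le: (mtrig _ gj); exact.
have := le_trans (err j k) Hj2; lra.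
Unshelve. all: by end_near.
Qed.

End WeakConvergence.

(** * Gaussian vectors *)

Section PsdFactor.
Variables (R : realType) (n : nat).
Implicit Types (M : 'M[R]_n) (s t : 'rV[R]_n).

Let qf M s t : R := (s *m M *m t^T) 0 0.

Let qfDl M s s' t : qf M (s + s') t = qf M s t + qf M s' t.
Proof. by rewrite /qf !mulmxDl mxE. Qed.

Let qfZl M a s t : qf M (a *: s) t = a * qf M s t.
Proof. by rewrite /qf -!scalemxAl mxE. Qed.

Let qfC M s t : M^T = M -> qf M s t = qf M t s.
Proof.
move=> sM; rewrite /qf -[in LHS]sM; transitivity (((t *m M *m s^T)^T) 0 0); last by rewrite mxE.
by rewrite !trmx_mul trmxK mulmxA.
Qed.

Let qf_delta M i s : qf M s (delta_mx 0 i) = (s *m M) 0 i.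
Proof. by rewrite /qf trmx_delta -colE mxE. Qed.

Let qf_expand M s t x : M^T = M ->
  qf M (s + x *: t) (s + x *: t) = qf M s s + 2 * x * qf M s t + x ^+ 2 * qf M t t.
Proof.
move=> sM; rewrite qfDl qfZl (qfC s _ sM) (qfC t _ sM) !qfDl !qfZl (qfC t s sM).
ring.
Qed.

(** Otherwise the form at [e_j + x e_i] is affine in [x] with nonzero slope; the chosen [x] gives it
    the value -1. *)
Lemma psd_diag0 M i j : symmetric_psd M -> M i i = 0 -> M j i = 0.
Proof.
move=> [sM pM] Mii.
have Mji k l : qf M (delta_mx 0 k) (delta_mx 0 l) = M k l.
  by rewrite qf_delta -rowE mxE.
apply/eqP; rewrite -sqrf_eq0 eq_le sqr_ge0 andbT leNgt; apply/negP => M2.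
pose x := - (M j j + 1) / (2 * M j i).
have Mn0 : M j i != 0 by apply: contraTneq M2 => ->; rewrite expr0n ltxx.
have := pM (delta_mx 0 j + x *: delta_mx 0 i).
rewrite -/(qf M _ _) qf_expand // !Mji Mii mulr0 addr0.
have -> : 2 * x * M j i = - (M j j + 1) by rewrite /x; field.
lra.
Qed.

(** Cholesky elimination for possibly singular matrices: subtracting [v^T v] annihilates the
    diagonal entry of a positive pivot. A zero diagonal entry stays zero since its column vanishes,
    so the number of nonzero diagonal entries drops. *)
Lemma psd_factor M : symmetric_psd M ->
  exists k (B : 'M[R]_(k, n)), M = B^T *m B.
Proof.
have [m] := ubnP #|[set i | M i i != 0]%SET|.
elim: m M => // m IH M; rewrite ltnS => cM psdM.
have [sM pM] := psdM.
have [D0|[i Mi0]] := set_0Vmem [set i | M i i != 0]%SET.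
  exists 0%N, 0; rewrite mulmx0; apply/matrixP => j i; rewrite [RHS]mxE.
  apply: psd_diag0 => //; apply/eqP; apply: contraT => Mi.
  by have := finset.in_set0 i; rewrite -D0 inE Mi.
rewrite inE in Mi0.
have Mii : qf M (delta_mx 0 i) (delta_mx 0 i) = M i i.
  by rewrite qf_delta -rowE mxE.
have Mi : 0 < M i i.
  by rewrite lt_def Mi0 -Mii; exact: pM.
pose v := (Num.sqrt (M i i))^-1 *: row i M.
have vv j k : (v^T *m v) j k = M i j * M i k / M i i.
  rewrite mxE big_ord1 !mxE.
  rewrite mulrACA -expr2 exprVn sqr_sqrtr ?(ltW Mi) //.
  by rewrite mulrC.
have M'E j k : (M - v^T *m v) j k = M j k - M i j * M i k / M i i.
  by rewrite -vv [LHS]mxE; congr (_ + _); rewrite mxE.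
have psd' : symmetric_psd (M - v^T *m v).
  split; first by rewrite raddfB /= sM trmx_mul trmxK.
  move=> t; rewrite mulmxBr mulmxBl mxE [X in _ + X]mxE.
  have -> : (t *m (v^T *m v) *m t^T) 0 0 = qf M t (delta_mx 0 i) ^+ 2 / M i i.
    have -> : t *m (v^T *m v) *m t^T = (t *m v^T) *m (t *m v^T)^T.
      by rewrite trmx_mul trmxK !mulmxA.
    rewrite mxE big_ord1 [(_^T) _ _]mxE -expr2.
    have -> : (t *m v^T) 0 0 = (Num.sqrt (M i i))^-1 * qf M t (delta_mx 0 i).
      rewrite qf_delta [LHS]mxE [in RHS]mxE mulr_sumr; apply: eq_bigr => k _.
      rewrite !mxE; have -> : M i k = M k i by rewrite -{1}sM mxE.
      by ring.
    by rewrite exprMn exprVn sqr_sqrtr ?(ltW Mi) // mulrC.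
  (* Nonnegativity of the Schur complement: the form of [M] at its minimizer along the direction
     [e_i]. *)
  have := pM (t + (- (qf M t (delta_mx 0 i) / M i i)) *: delta_mx 0 i).
  rewrite -/(qf M _ _) qf_expand // Mii -/(qf M t t); congr (_ <= _).
  by field.
have [|k [B HB]] := IH _ _ psd'.
  apply: leq_trans cM; apply: proper_card; apply/properP; split.
    apply/fintype.subsetP => j; rewrite !inE; apply: contra_neqN => /eqP Mj.
    by rewrite M'E (psd_diag0 i psdM Mj) Mj mul0r mul0r subr0.
  exists i; first by rewrite inE.
  by rewrite inE negbK M'E mulfK // subrr.
exists (1 + k)%N, (col_mx v B).
by rewrite tr_col_mx mul_row_col -HB addrC subrK.
Qed.

End PsdFactor.

(** * Normal densities under affine maps and convolution *)

Section NormalLaw.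
Variable R : realType.
Local Notation mu := (@lebesgue_measure R).
Local Open Scope ereal_scope.

Lemma ge0_integral_normal_prob (a s : R) (f : R -> \bar R) :
  measurable_fun setT f -> (forall x, 0 <= f x) ->
  \int[normal_prob a s]_x f x = \int[mu]_x (f x * (normal_pdf a s x)%:E).
Proof.
move=> mf f0; have dom := normal_prob_dominates a s.
rewrite -(@Radon_Nikodym_SigmaFinite.change_of_variables _ _ _ (normal_prob a s) mu) //.
apply: ae_eq_integral => //.
- apply: emeasurable_funM => //; apply: (measurable_int mu).
  exact: Radon_Nikodym_SigmaFinite.f_integrable.
- apply: emeasurable_funM => //; apply/measurable_EFinP.
  exact: measurable_normal_pdf.
- apply: ae_eqe_mul2l => /=; apply: integral_ae_eq => //=.
  + exact: Radon_Nikodym_SigmaFinite.f_integrable.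
  + by apply/measurable_EFinP; exact: measurable_normal_pdf.
  + by move=> E _ mE; rewrite -Radon_Nikodym_SigmaFinite.f_integral.
Qed.

Definition affine (a c x : R) : R := (a + c * x)%R.

Lemma measurable_affine (a c : R) :
  measurable_fun [set: measurableTypeR R] (affine a c : measurableTypeR R -> measurableTypeR R).
Proof. by apply: measurable_funD => //; apply: measurable_funM. Qed.

(** Lebesgue measure is determined by half-open intervals; for [c < 0] the preimage is closed at the
    other end, with the same length. *)
Lemma lebesgue_measure_affine (a c : R) (A : set R) : c != 0%R -> measurable A ->
  mu A = `|c|%:E * pushforward mu (affine a c : measurableTypeR R -> measurableTypeR R) A.
Proof.
move=> c0 mA.
have H := @lebesgue_measure_unique R (mscale (NngNum (normr_ge0 c))
  (pushforward mu (affine a c : measurableTypeR R -> measurableTypeR R))).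
apply: H => // [|mphi _ [[u v]] _ <-]; first exact: measurable_affine.
rewrite -[RHS]/(`|c|%:E * mu (affine a c @^-1` `]u, v])).
have [c_lt0|c_gt0] : (c < 0 \/ 0 < c)%R by move: c0; rewrite neq_lt => /orP.
- have -> : affine a c @^-1` `]u, v] = `[((v - a) / c)%R, ((u - a) / c)%R[%classic.
    apply/seteqP; split=> x /=; rewrite /affine !in_itv /= => /andP[h1 h2]; apply/andP;
      move: h1 h2; rewrite ler_ndivrMr // ltr_ndivlMr //; split; lra.
  rewrite !lebesgue_measure_itv /= !lte_fin ltr_nM2r ?invr_lt0 // ltrD2r.
  case: ifP => _; last by rewrite mule0.
  by rewrite -!EFinB -EFinM ltr0_norm //; congr EFin; field; rewrite lt_eqF.
- have -> : affine a c @^-1` `]u, v] = `]((u - a) / c)%R, ((v - a) / c)%R]%classic.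
    apply/seteqP; split=> x /=; rewrite /affine !in_itv /= => /andP[h1 h2]; apply/andP;
      move: h1 h2; rewrite ler_pdivlMr // ltr_pdivrMr //; split; lra.
  rewrite !lebesgue_measure_itv /= !lte_fin ltr_pM2r ?invr_gt0 // ltrD2r.
  case: ifP => _; last by rewrite mule0.
  by rewrite -!EFinB -EFinM gtr0_norm //; congr EFin; field; rewrite gt_eqF.
Qed.

Lemma normal_pdf_affine (a c x : R) : c != 0%R ->
  (`|c| * normal_pdf a c (affine a c x) = normal_pdf 0 1 x)%R.
Proof.
move=> c0; rewrite !normal_pdfE ?oner_eq0 // /normal_peak /normal_fun /affine.
rewrite mulrA; congr (_ * _)%R.
  rewrite -!mulrnAr expr1n mul1r sqrtrM ?sqr_ge0 // sqrtr_sqr invfM mulrA.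
  by rewrite mulfV ?normr_eq0 // mul1r.
congr expR; rewrite addrAC subrr add0r subr0 expr1n; field.
by [].
Qed.

Lemma normal_prob_affine (a c : R) (A : set R) : c != 0%R -> measurable A ->
  normal_prob 0 1 (affine a c @^-1` A) = normal_prob a c A.
Proof.
move=> c0 mA.
set B := _ @^-1` A.
have mB : measurable B by rewrite -[B]setTI; exact: measurable_affine.
rewrite /normal_prob.
transitivity (\int[mu]_(x in B) (`|c|%:E * (normal_pdf a c (affine a c x))%:E)).
  by apply: eq_integral => x _; rewrite -EFinM normal_pdf_affine.
rewrite ge0_integralZl_EFin //; last 2 first.
- by move=> x _; rewrite lee_fin normal_pdf_ge0.
- apply/measurable_EFinP/measurable_funTS.
  by apply: (measurableT_comp (measurable_normal_pdf a c)); exact: measurable_affine.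
transitivity (`|c|%:E * \int[pushforward mu (affine a c : measurableTypeR R -> measurableTypeR R)]_(y in A)
    (normal_pdf a c y)%:E).
  congr (_ * _); rewrite (ge0_integral_pushforward (measurable_affine a c)) //.
  - by apply/measurable_EFinP/measurable_funTS; exact: measurable_normal_pdf.
  - by move=> y _; rewrite lee_fin normal_pdf_ge0.
have mN : measurable_fun A (fun y => (normal_pdf a c y)%:E).
  by apply/measurable_EFinP/measurable_funTS; exact: measurable_normal_pdf.
pose nu : {measure set (measurableTypeR R) -> \bar R} :=
  measure_function_pushforward__canonical__measure_function_Measure mu (measurable_affine a c).
transitivity (\int[mscale (NngNum (normr_ge0 c)) nu]_(y in A) (normal_pdf a c y)%:E).
  by rewrite ge0_integral_mscale // => y _; rewrite lee_fin normal_pdf_ge0.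
by apply: eq_measure_integral => E mE _; apply/esym/lebesgue_measure_affine.
Qed.

End NormalLaw.

Section NormalConvolution.
Variable R : realType.
Local Notation mu := (@lebesgue_measure R).
Local Open Scope ereal_scope.

(* Completing the square in z. *)
Lemma normal_pdf_convolution (v c y z : R) : (0 < v)%R -> c != 0%R ->
  (normal_pdf z c y * normal_pdf 0 (Num.sqrt v) z =
   normal_pdf 0 (Num.sqrt (v + c ^+ 2)) y *
   normal_pdf (y * v / (v + c ^+ 2)) (Num.sqrt (v * c ^+ 2 / (v + c ^+ 2))) z)%R.
Proof.
move=> v0 c0; have c20 : (0 < c ^+ 2)%R by rewrite exprn_even_gt0.
have vc0 : (0 < v + c ^+ 2)%R by rewrite addr_gt0.
have t0 : (0 < v * c ^+ 2 / (v + c ^+ 2))%R by apply: divr_gt0 => //; apply: mulr_gt0.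
have sq0 (x : R) : (0 < x)%R -> Num.sqrt x != 0%R by move=> x0; rewrite gt_eqF ?sqrtr_gt0.
rewrite !normal_pdfE ?sq0 // /normal_peak /normal_fun !sqr_sqrtr ?(ltW v0) ?(ltW vc0) ?(ltW t0) //.
rewrite mulrACA [RHS]mulrACA -!expRD; congr (_ * expR _)%R; last first.
  by field; rewrite c0 !gt_eqF.
have p0 := pi_ge0 R.
have p2 (x : R) : (0 < x)%R -> (0 <= x * pi *+ 2)%R.
  by move=> x0; rewrite mulrn_wge0 // mulr_ge0 // ltW.
rewrite -!invfM -!sqrtrM ?p2 //; congr (Num.sqrt _)^-1%R.
by field; rewrite gt_eqF.
Qed.

Lemma measurable_normal_pdf2 (c : R) : c != 0%R ->
  measurable_fun [set: measurableTypeR R * measurableTypeR R]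
    (fun p : R * R => normal_pdf p.1 c p.2).
Proof.
move=> c0; under eq_fun do rewrite normal_pdfE // /normal_fun.
apply: measurable_funM => //; apply: measurableT_comp => //.
apply: measurable_funM => //; apply: measurableT_comp => //.
apply: measurable_funX; apply: measurable_funB; exact: measurable_snd || exact: measurable_fst.
Qed.

(** After Tonelli and completion of the square, the inner integrand is a normal density in [z], of
    integral 1. *)
Lemma normal_prob_convolution (v c : R) (B : set R) : (0 < v)%R -> c != 0%R ->
  measurable B ->
  \int[mu]_z (normal_prob z c B * (normal_pdf 0 (Num.sqrt v) z)%:E) =
  normal_prob 0 (Num.sqrt (v + c ^+ 2)) B.
Proof.
move=> v0 c0 mB.
have mpdf (a s : R) (D : set R) : measurable D -> measurable_fun D (fun y => (normal_pdf a s y)%:E).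
  by move=> mD; apply/measurable_EFinP/measurable_funTS; exact: measurable_normal_pdf.
pose f (p : R * R) := (normal_pdf p.1 c p.2 * normal_pdf 0 (Num.sqrt v) p.1 * \1_B p.2)%:E.
have f0 p : 0 <= f p by rewrite lee_fin !mulr_ge0 ?normal_pdf_ge0.
have mf : measurable_fun [set: measurableTypeR R * measurableTypeR R] f.
  apply/measurable_EFinP; apply: measurable_funM; first apply: measurable_funM.
  - exact: measurable_normal_pdf2.
  - by apply: (measurableT_comp (measurable_normal_pdf _ _)); exact: measurable_fst.
  - by apply: (measurableT_comp (measurable_indic mB)); exact: measurable_snd.
have indB (g : R -> R) : (forall y, 0 <= g y)%R -> measurable_fun setT g ->
   \int[mu]_(y in B) (g y)%:E = \int[mu]_y (g y * \1_B y)%:E.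
  move=> g0 mg; rewrite integral_mkcond; apply: eq_integral => y _.
  by rewrite epatch_indic EFinM.
transitivity (\int[mu]_z \int[mu]_y f (z, y)).
  apply: eq_integral => z _; rewrite /normal_prob muleC -ge0_integralZl_EFin //; last 3 first.
  - by move=> y _; rewrite lee_fin normal_pdf_ge0.
  - exact: mpdf.
  - exact: normal_pdf_ge0.
  under eq_integral do rewrite -EFinM; rewrite indB //.
  - by apply: eq_integral => y _; rewrite /f /= (mulrC (normal_pdf 0 _ _)).
  - by move=> y; rewrite mulr_ge0 ?normal_pdf_ge0.
  - by apply: measurable_funM => //; exact: measurable_normal_pdf.
rewrite (@fubini_tonelli _ _ (measurableTypeR R) (measurableTypeR R) R mu mu f mf f0) /normal_prob indB; last 2 first.
- by move=> y; exact: normal_pdf_ge0.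
- exact: measurable_normal_pdf.
apply: eq_integral => y _.
transitivity (\int[mu]_z ((normal_pdf 0 (Num.sqrt (v + c ^+ 2)) y * \1_B y)%:E *
   (normal_pdf (y * v / (v + c ^+ 2)) (Num.sqrt (v * c ^+ 2 / (v + c ^+ 2))) z)%:E)).
  by apply: eq_integral => z _; rewrite /f /= normal_pdf_convolution // -EFinM mulrAC.
rewrite ge0_integralZl_EFin //; last 3 first.
- by move=> z _; rewrite lee_fin normal_pdf_ge0.
- exact: mpdf.
- by rewrite mulr_ge0 ?normal_pdf_ge0.
by rewrite integral_normal_pdf mule1.
Qed.

End NormalConvolution.

(** * Families of independent normals *)

Section GaussianFamily.
Variable R : realType.
Local Notation N01 := (normal_prob (0 : R) 1).
Local Notation Rm := (measurableTypeR R).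

Lemma normal_prob_sqr (a s t : R) : s ^+ 2 = t ^+ 2 -> s != 0 ->
  normal_prob a s = normal_prob a t.
Proof.
move=> st s0; have t0 : t != 0 by rewrite -sqrf_eq0 -st sqrf_eq0.
apply/funext => A; apply: eq_integral => x _.
by rewrite !normal_pdfE // /normal_peak /normal_fun st.
Qed.

Lemma measurable_normal_prob_mean (c : R) (B : set R) : c != 0 -> measurable B ->
  measurable_fun [set: Rm] (fun z => normal_prob z c B).
Proof.
move=> c0 mB; pose A := [set p : Rm * Rm | B (affine p.1 c p.2)].
have mA : measurable A.
  have -> : A = setT `&` (fun p : Rm * Rm => p.1 + c * p.2) @^-1` B by rewrite setTI.
  apply: (_ : measurable_fun setT (fun p : Rm * Rm => p.1 + c * p.2 : Rm)) => //.
  apply: measurable_funD; first exact: measurable_fst.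
  by apply: measurable_funM => //; exact: measurable_snd.
have -> : (fun z => normal_prob z c B) = N01 \o xsection A.
  apply/funext => z /=; rewrite -normal_prob_affine //; congr N01.
  by apply/seteqP; split=> x; rewrite /xsection /= inE.
exact: measurable_fun_xsection.
Qed.

Definition normal_cf (c : R) : R := \int[N01]_x cos (c * x).

Lemma measurable_cosM (c b : R) : measurable_fun [set: Rm] (fun x : R => cos (b + c * x)).
Proof.
apply: (measurableT_comp (f := @cos R)); first exact: continuous_measurable_fun (@continuous_cos R).
exact: measurable_affine.
Qed.

Lemma measurable_sinM (c b : R) : measurable_fun [set: Rm] (fun x : R => sin (b + c * x)).
Proof.
apply: (measurableT_comp (f := @sin R)); first exact: continuous_measurable_fun (@continuous_sin R).
exact: measurable_affine.
Qed.

Lemma integrable_cosM (c : R) : N01.-integrable setT (EFin \o (fun x : Rm => cos (c * x))).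
Proof.
apply: (@bounded_integrable _ _ _ _ _ 1) => [|x]; last exact: cos_max.
by have := measurable_cosM c 0; under eq_fun do rewrite add0r.
Qed.

Lemma integrable_sinM (c : R) : N01.-integrable setT (EFin \o (fun x : Rm => sin (c * x))).
Proof.
apply: (@bounded_integrable _ _ _ _ _ 1) => [|x]; last exact: sin_max.
by have := measurable_sinM c 0; under eq_fun do rewrite add0r.
Qed.

Lemma Rintegral_law (d : measure_display) (T : measurableType d)
    (Q : probability T R) (Z : T -> Rm) (L : {measure set Rm -> \bar R})
    (g : Rm -> R) (b : R) : measurable_fun setT Z ->
  (forall A, measurable A -> Q (Z @^-1` A) = L A) ->
  measurable_fun setT g -> (forall x, `|g x| <= b) ->
  \int[Q]_w g (Z w) = \int[L]_x g x.
Proof.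
move=> mZ QL mg gb; congr fine.
pose nu : {measure set Rm -> \bar R} :=
  measure_function_pushforward__canonical__measure_function_Measure Q mZ.
transitivity (\int[nu]_x (g x)%:E)%E; last first.
  by apply: eq_measure_integral => A mA _; rewrite -QL.
rewrite (integral_pushforward mZ) //; first exact/measurable_EFinP.
apply: (bounded_integrable Q (f := fun w => g (Z w)) _ (b := b)) => //.
exact: measurableT_comp.
Qed.

(** The standard normal law is invariant under [x -> - x]. *)
Lemma normal_sin0 (c : R) : \int[N01]_x sin (c * x) = 0.
Proof.
have H : \int[N01]_x sin (c * (affine 0 (-1) x)) = \int[N01]_x sin (c * x).
  apply: (@Rintegral_law _ _ _ (affine 0 (-1) : Rm -> Rm) _ (fun x => sin (c * x)) 1).
  - exact: measurable_affine.
  - move=> A mA; apply: eq_trans (normal_prob_affine _ _ mA) _; rewrite ?oppr_eq0 ?oner_eq0 //.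
    by rewrite (@normal_prob_sqr 0 (-1) 1) ?oppr_eq0 ?oner_eq0 // sqrrN.
  - by have := measurable_sinM c 0; under eq_fun do rewrite add0r.
  - by move=> x; exact: sin_max.
have : \int[N01]_x sin (c * (affine 0 (-1) x)) = - \int[N01]_x sin (c * x).
  transitivity (\int[N01]_x (-1 * sin (c * x))).
    by apply: eq_Rintegral => x _; rewrite /affine add0r !mulN1r mulrN sinN.
  by rewrite RintegralZl ?mulN1r //; exact: integrable_sinM.
by rewrite H => /eqP; rewrite -subr_eq0 opprK -mulr2n mulrn_eq0 /= => /eqP.
Qed.

Let integrable_ZM (k : R) (f : Rm -> R) : N01.-integrable setT (EFin \o f) ->
  N01.-integrable setT (EFin \o (fun x => k * f x)).
Proof.
move=> fi; have -> : EFin \o (fun x => k * f x) = (fun x => k%:E * (EFin \o f) x)%E.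
  by apply/funext => x; rewrite /= EFinM.
exact: integrableZl.
Qed.

Lemma normal_cos_shift (z c : R) : \int[N01]_x cos (z + c * x) = normal_cf c * cos z.
Proof.
transitivity (\int[N01]_x (cos z * cos (c * x) + - sin z * sin (c * x))).
  by apply: eq_Rintegral => x _; rewrite cosD mulNr.
have ic := integrable_cosM c; have isn := integrable_sinM c.
rewrite RintegralD //; [|exact: integrable_ZM|exact: integrable_ZM].
by rewrite !RintegralZl // normal_sin0 mulr0 addr0 mulrC.
Qed.

Lemma normal_sin_shift (z c : R) : \int[N01]_x sin (z + c * x) = normal_cf c * sin z.
Proof.
transitivity (\int[N01]_x (sin z * cos (c * x) + cos z * sin (c * x))).
  by apply: eq_Rintegral => x _; rewrite sinD.
have ic := integrable_cosM c; have isn := integrable_sinM c.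
rewrite RintegralD //; [|exact: integrable_ZM|exact: integrable_ZM].
by rewrite !RintegralZl // normal_sin0 mulr0 addr0 mulrC.
Qed.

Lemma Rintegral_prod_normal (d : measure_display) (T : measurableType d)
    (Q : probability T R) (Z : T -> R) (c b : R) (g : R -> R) :
  measurable_fun setT Z -> continuous g -> (forall x, `|g x| <= b) ->
  \int[(Q \x N01)%E]_p g (Z p.1 + c * p.2) =
  \int[Q]_w (\int[N01]_x g (Z w + c * x)).
Proof.
move=> mZ cg gb; have mg := continuous_measurable_fun cg.
have msum : measurable_fun [set: T * Rm] (fun p : T * Rm => Z p.1 + c * p.2).
  apply: measurable_funD; first by apply: (measurableT_comp mZ); exact: measurable_fst.
  by apply: measurable_funM => //; exact: measurable_snd.
have ig := bounded_integrable (Q \x N01)%E (measurableT_comp mg msum) (fun p => gb _).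
rewrite {1}/Rintegral -(integral12_prod_meas1 ig) /=; congr fine.
apply: eq_integral => w _; rewrite fineK //.
apply: integrable_fin_num => //.
apply: (bounded_integrable N01 (f := fun x => g (Z w + c * x)) _ (b := b)) => //.
apply: (measurableT_comp mg); exact: measurable_affine.
Qed.

(** Adds an independent normal of variance [c ^ 2]. Either summand may be a Dirac mass, so [c = 0]
    and [v = 0] are treated apart. *)
Lemma normal_law_sum (d : measure_display) (T : measurableType d)
    (Q : probability T R) (Z : T -> R) (c v : R) (B : set R) :
  0 <= v -> measurable_fun setT Z ->
  (forall A : set R, measurable A -> Q (Z @^-1` A) = normal_law 0 v A) ->
  measurable B ->
  (Q \x N01)%E [set p | B (Z p.1 + c * p.2)] = normal_law 0 (v + c ^+ 2) B.
Proof.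
move=> v0 mZ lawZ mB.
have [->|c0] := eqVneq c 0.
  rewrite expr0n addr0 -lawZ //.
  have -> : [set p : T * Rm | B (Z p.1 + 0 * p.2)] = (Z @^-1` B) `*` setT.
    by apply/seteqP; split=> [p|p []] /=; rewrite mul0r addr0.
  rewrite product_measure1E //; last by rewrite -[_ @^-1` _]setTI; exact: mZ.
  by rewrite [X in (_ * X)%E](_ : _ = 1%E) ?mule1 //; exact: probability_setT.
transitivity (\int[Q]_w normal_prob (Z w) c B)%E.
  apply: eq_integral => w _; rewrite -normal_prob_affine //.
  apply: (congr1 (normal_prob 0 1)).
  by apply/seteqP; split=> x; rewrite /xsection /= inE.
pose f z := normal_prob z c B.
have mf := measurable_normal_prob_mean c0 mB.
have f0 z : (0 <= f z)%E by exact: measure_ge0.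
have mZ' : measurable_fun setT (Z : T -> Rm) by exact: mZ.
pose nu : {measure set Rm -> \bar R} :=
  measure_function_pushforward__canonical__measure_function_Measure Q mZ'.
transitivity (\int[nu]_z f z)%E; first by rewrite (ge0_integral_pushforward mZ').
have sc (x : R) : x ^+ 2 = (Num.sqrt (x ^+ 2)) ^+ 2 by rewrite sqr_sqrtr ?sqr_ge0.
rewrite [in RHS]/normal_law gt_eqF; last by rewrite ltr_wpDl // exprn_even_gt0.
have [v00|vn0] := eqVneq v 0.
  transitivity (\int[\d_((0%R : R) : Rm)]_z f z)%E.
    by apply: eq_measure_integral => A mA _; rewrite [LHS]lawZ // /normal_law v00 eqxx.
  rewrite integral_dirac // diracT mul1e v00 add0r /f.
  by rewrite (normal_prob_sqr 0 (sc c) c0).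
have v_gt0 : 0 < v by rewrite lt_def vn0.
transitivity (\int[normal_prob 0 (Num.sqrt v)]_z f z)%E.
  by apply: eq_measure_integral => A mA _; rewrite [LHS]lawZ // /normal_law (negbTE vn0).
by rewrite ge0_integral_normal_prob // normal_prob_convolution.
Qed.

(** Independence recorded through linear combinations: these facts are what linear images call for,
    and an induction by product spaces carries them along. *)
Definition independent_normals (n : nat) (dT : measure_display) (T : measurableType dT)
    (Q : probability T R) (G : nat -> T -> R) : Prop :=
  (forall i, measurable_fun setT (G i)) /\
  forall c : nat -> R,
    [/\ forall B : set R, measurable B ->
          Q ((fun w => \sum_(i < n) c i * G i w) @^-1` B) =
          normal_law 0 (\sum_(i < n) c i ^+ 2) B,
        \int[Q]_w cos (\sum_(i < n) c i * G i w) = \prod_(i < n) normal_cf (c i) &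
        \int[Q]_w sin (\sum_(i < n) c i * G i w) = 0].

Lemma independent_normals_exist n : exists (dT : measure_display)
  (T : measurableType dT) (Q : probability T R) (G : nat -> T -> R),
  independent_normals n Q G.
Proof.
elim: n => [|n [dT [T [Q [G [mG HG]]]]]].
  exists _, Rm, (N01 : probability Rm R), (fun _ _ => 0); split => // c; split.
  - move=> B mB; rewrite !big_ord0 /normal_law eqxx.
    rewrite preimage_cst diracE; case: ifP => _; last exact: measure0.
    exact: probability_setT.
  - under eq_Rintegral do rewrite big_ord0 cos0.
    rewrite big_ord0 Rintegral_cst //; transitivity (1 * fine (1%E : \bar R)); last by rewrite mulr1.
    by congr (_ * fine _); exact: probability_setT.
  - under eq_Rintegral do rewrite big_ord0 sin0.
    by rewrite Rintegral_cst // mul0r.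
pose G' (i : nat) (p : T * Rm) : R := if (i < n)%N then G i p.1 else p.2.
exists _, (T * Rm)%type, (Q \x N01)%E, G'; split.
  move=> i; rewrite /G'; case: (i < n)%N; last exact: measurable_snd.
  by apply: (measurableT_comp (mG i)); exact: measurable_fst.
move=> c; have [lawZ cosZ sinZ] := HG c.
pose Z w := \sum_(i < n) c i * G i w.
have mZ : measurable_fun setT Z by apply: measurable_sum => i; apply: measurable_funM.
have sumE p : \sum_(i < n.+1) c i * G' i p = Z p.1 + c n * p.2.
  rewrite big_ord_recr /= /G' ltnn; congr (_ + _).
  by apply: eq_bigr => i _; rewrite ltn_ord.
split.
- move=> B mB; rewrite big_ord_recr /= -(normal_law_sum (c n) _ mZ lawZ mB); last first.
    by apply: sumr_ge0 => i _; exact: sqr_ge0.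
  by congr (_ _); apply/funext => p; rewrite /preimage /= sumE.
- under eq_Rintegral do rewrite sumE.
  rewrite big_ord_recr /= -cosZ.
  rewrite (Rintegral_prod_normal Q (c n) mZ (@continuous_cos R) (@cos_max R)).
  under eq_Rintegral do rewrite normal_cos_shift.
  transitivity (normal_cf (c n) * \int[Q]_w cos (Z w)); last exact: mulrC.
  apply: RintegralZl => //.
  apply: (bounded_integrable Q (f := fun w => cos (Z w)) _ (fun w => cos_max _)).
  exact: (measurableT_comp (continuous_measurable_fun (@continuous_cos R))).
- under eq_Rintegral do rewrite sumE.
  rewrite (Rintegral_prod_normal Q (c n) mZ (@continuous_sin R) (@sin_max R)).
  under eq_Rintegral do rewrite normal_sin_shift.
  transitivity (normal_cf (c n) * \int[Q]_w sin (Z w)); last by rewrite sinZ mulr0.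
  apply: RintegralZl => //.
  apply: (bounded_integrable Q (f := fun w => sin (Z w)) _ (fun w => sin_max _)).
  exact: (measurableT_comp (continuous_measurable_fun (@continuous_sin R))).
Qed.

End GaussianFamily.

(** * Second-order expansion of the normal characteristic function *)

Section NormalCf.
Variable R : realType.
Local Notation N01 := (normal_prob (0 : R) 1).
Local Notation Rm := (measurableTypeR R).

Implicit Types (x y z l : R).

(** Hyperbolic cosine and sine: their normal means follow from exponential moments, and
    [cos + ch - 2] has no term of order two, so the mean of the cosine is controlled by explicit
    quantities. *)
Let ch (y : R) : R := 2^-1 * expR y + 2^-1 * expR (- y).
Let sh (y : R) : R := 2^-1 * expR y - 2^-1 * expR (- y).

Let chN y : ch (- y) = ch y. Proof. by rewrite /ch opprK addrC. Qed.

Let ch_double y : ch (2 * y) = 2 * ch y ^+ 2 - 1.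
Proof.
have H : expR y * expR (- y) = 1 by rewrite -expRD subrr expR0.
have -> : 2 * ch y ^+ 2 - 1 = 2^-1 * expR y ^+ 2 + 2^-1 * expR (- y) ^+ 2 +
   (expR y * expR (- y) - 1) by rewrite /ch; field.
by rewrite H subrr addr0 -!expRM_natl mulrN.
Qed.

Let der_ch y : is_derive y 1 ch (sh y).
Proof.
by apply: is_derive_eq; rewrite /GRing.scale /= /sh; ring.
Qed.

Let der_sh y : is_derive y 1 sh (ch y).
Proof.
by apply: is_derive_eq; rewrite /GRing.scale /= /ch; ring.
Qed.

#[local] Existing Instance der_ch.
#[local] Existing Instance der_sh.

Let ch0 : ch 0 = 1. Proof. by rewrite /ch oppr0 expR0; field. Qed.
Let sh0 : sh 0 = 0. Proof. by rewrite /sh oppr0 expR0 subrr. Qed.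

Let ch_ge1 y : 1 <= ch y.
Proof.
have := expR_ge1Dx y; have := expR_ge1Dx (- y); rewrite /ch; lra.
Qed.

Let sh_ge y : 0 <= y -> y <= sh y.
Proof.
move=> y0; rewrite -subr_ge0.
apply: (@nonneg_of_nonneg_derive R (fun y => sh y - y) (fun y => ch y - 1)) => //.
- by move=> x _; rewrite subr_ge0.
- by rewrite sh0 subr0.
Qed.

Let ch_ge y : 1 + y ^+ 2 / 2 <= ch y.
Proof.
wlog y0 : y / 0 <= y.
  move=> H; have [/H//|/ltW y0] := leP 0 y.
  by rewrite -sqrrN -chN H // oppr_ge0.
rewrite -subr_ge0.
apply: (@nonneg_of_nonneg_derive R (fun y => ch y - (1 + y ^+ 2 / 2)) (fun y => sh y - y)) => //.
- move=> x; apply: is_derive_eq; rewrite /GRing.scale /=; by field.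
- by move=> x x0; rewrite subr_ge0; exact: sh_ge.
- by rewrite ch0 expr0n /=; ring.
Qed.

Let ch_le y : ch y - 1 - y ^+ 2 / 2 <= (ch y - 1) ^+ 2.
Proof.
wlog y0 : y / 0 <= y.
  move=> H; have [/H//|/ltW y0] := leP 0 y.
  by rewrite -sqrrN -chN H // oppr_ge0.
rewrite -subr_ge0.
apply: (@nonneg_of_nonneg_derive R (fun y => (ch y - 1) ^+ 2 - (ch y - 1 - y ^+ 2 / 2))
  (fun y => 2 * (ch y - 1) * sh y - sh y + y)) => //.
- move=> x; apply: is_derive_eq; rewrite /GRing.scale /=; by field.
- move=> x x0.
  apply: (@nonneg_of_nonneg_derive R (fun y => 2 * (ch y - 1) * sh y - sh y + y)
    (fun y => 2 * sh y ^+ 2 + (ch y - 1) * (2 * ch y - 1))) => //.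
  + move=> z; apply: is_derive_eq; rewrite /GRing.scale /=; by field.
  + move=> z _; have := ch_ge1 z; have := sqr_ge0 (sh z); nra.
  + by rewrite sh0 ch0; ring.
- by rewrite ch0 expr0n /=; ring.
Qed.

Let cos_le4 y : cos y - 1 + y ^+ 2 / 2 <= y ^+ 4 / 24.
Proof.
wlog y0 : y / 0 <= y.
  move=> H; have [/H//|/ltW y0] := leP 0 y.
  have -> : y ^+ 4 = (- y) ^+ 4 by ring.
  by rewrite -sqrrN -cosN H // oppr_ge0.
rewrite -subr_ge0.
apply: (@nonneg_of_nonneg_derive R (fun y => y ^+ 4 / 24 - (cos y - 1 + y ^+ 2 / 2))
  (fun y => y ^+ 3 / 6 - (y - sin y))) => //.
- move=> x; apply: is_derive_eq; rewrite /GRing.scale /=; by field.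
- by move=> x x0; rewrite subr_ge0; exact: sub_sin_le.
- by rewrite cos0 !expr0n /=; ring.
Qed.

Let cos_ch y : 0 <= cos y + ch y - 2 <= 2 * (ch y - 1) ^+ 2.
Proof.
apply/andP; split; first by have := one_sub_cos_le y; have := ch_ge y; lra.
have h1 := cos_le4 y; have h2 := ch_le y; have h3 := ch_ge y.
have h4 : (y ^+ 2 / 2) ^+ 2 <= (ch y - 1) ^+ 2.
  by rewrite lerXn2r ?nnegrE ?subr_ge0 ?ch_ge1 ?divr_ge0 ?sqr_ge0 // lerBrDl.
have -> : cos y + ch y - 2 = (cos y - 1 + y ^+ 2 / 2) + (ch y - 1 - y ^+ 2 / 2) by ring.
move: h4; have -> : (y ^+ 2 / 2) ^+ 2 = y ^+ 4 / 4 by field.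
move=> h4; have := sqr_ge0 (ch y - 1); lra.
Qed.

Lemma normal_mgf (l : R) :
  (\int[N01]_x (expR (l * x))%:E = (expR (l ^+ 2 / 2))%:E)%E.
Proof.
rewrite ge0_integral_normal_prob; last 2 first.
- apply/measurable_EFinP.
  apply: (measurableT_comp (continuous_measurable_fun (@continuous_expR R))).
  exact: measurable_funM.
- by move=> x; rewrite lee_fin expR_ge0.
transitivity (\int[lebesgue_measure]_x ((expR (l ^+ 2 / 2))%:E * (normal_pdf l 1 x)%:E))%E.
  apply: eq_integral => x _; rewrite -!EFinM !normal_pdfE ?oner_eq0 // /normal_fun.
  congr EFin; rewrite mulrCA [RHS]mulrCA -!expRD; congr (_ * expR _).
  by field.
rewrite ge0_integralZl_EFin ?expR_ge0 //; last 2 first.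
- by move=> x _; rewrite lee_fin normal_pdf_ge0.
- by apply/measurable_EFinP; exact: measurable_normal_pdf.
by rewrite integral_normal_pdf mule1.
Qed.

Let int_exp l : N01.-integrable setT (EFin \o (fun x : Rm => expR (l * x))).
Proof.
have me : measurable_fun setT (fun x : Rm => expR (l * x)).
  apply: (measurableT_comp (continuous_measurable_fun (@continuous_expR R))).
  exact: measurable_funM.
apply/integrableP; split; first exact/measurable_EFinP.
rewrite (eq_integral (fun x : Rm => (expR (l * x))%:E)); first by rewrite normal_mgf ltry.
by move=> x _; rewrite /= ger0_norm ?expR_ge0.
Qed.

Let intD (f g : Rm -> R) : N01.-integrable setT (EFin \o f) ->
  N01.-integrable setT (EFin \o g) ->
  N01.-integrable setT (EFin \o (fun x => f x + g x)).
Proof.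
move=> fi gi; have -> : EFin \o (fun x => f x + g x) = ((EFin \o f) \+ (EFin \o g))%E.
  by apply/funext => x; rewrite /= EFinD.
exact: integrableD.
Qed.

Let intZ (k : R) (f : Rm -> R) : N01.-integrable setT (EFin \o f) ->
  N01.-integrable setT (EFin \o (fun x => k * f x)).
Proof.
move=> fi; have -> : EFin \o (fun x => k * f x) = (fun x => k%:E * (EFin \o f) x)%E.
  by apply/funext => x; rewrite /= EFinM.
exact: integrableZl.
Qed.

Let int_cst (k : R) : N01.-integrable setT (EFin \o (fun _ : Rm => k)).
Proof. by apply: (@bounded_integrable _ _ _ _ _ `|k|). Qed.

Let int_ch l : N01.-integrable setT (EFin \o (fun x : Rm => ch (l * x))).
Proof.
rewrite /ch; under eq_fun do rewrite -mulNr.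
by apply: intD; apply: intZ.
Qed.

Let mean_ch l : \int[N01]_x ch (l * x) = expR (l ^+ 2 / 2).
Proof.
transitivity (\int[N01]_x (2^-1 * expR (l * x) + 2^-1 * expR (- l * x))).
  by apply: eq_Rintegral => x _; rewrite /ch mulNr.
rewrite RintegralD //; [|exact: intZ|exact: intZ].
rewrite RintegralZl // RintegralZl // /Rintegral !normal_mgf /= sqrrN.
by field.
Qed.

Let mean_cst_N (k : R) : \int[N01]_x k = k :> R.
Proof.
have e : fine (N01 setT) = 1 by rewrite (_ : N01 setT = 1%E) //; exact: probability_setT.
by rewrite Rintegral_cst // e mulr1.
Qed.

Let expR_le (v : R) : 0 <= v <= 2^-1 -> expR v <= 1 + v + 2 * v ^+ 2.
Proof.
move=> /andP[v0 v2].
have h1 : 1 - v <= (expR v)^-1 by rewrite -expRN; exact: expR_ge1Dx.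
have h2 : expR v <= (1 - v)^-1.
  by rewrite -[leLHS]invrK lef_pV2 ?posrE ?invr_gt0 ?expR_gt0 //; lra.
apply: le_trans h2 _; rewrite -[leLHS]mul1r ler_pdivrMr; last by lra.
have -> : (1 + v + 2 * v ^+ 2) * (1 - v) = 1 + v ^+ 2 * (1 - 2 * v) by ring.
by rewrite lerDl mulr_ge0 ?sqr_ge0 //; lra.
Qed.

(** With [v = s ^ 2 / 2], the mean of [cos + ch - 2] lies between 0 and twice the mean of
    [(ch - 1) ^ 2], that is [exp (4 v) + 3 - 4 exp v], which is of order [v ^ 2]. The bound on [s]
    keeps [4 v] within the range of [expR_le]. *)
Lemma normal_cf_expansion (s : R) : s ^+ 2 <= 4^-1 ->
  `|normal_cf s - (1 - s ^+ 2 / 2)| <= 8 * s ^+ 4.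
Proof.
move=> s4; pose v := s ^+ 2 / 2; have v0 : 0 <= v by rewrite divr_ge0 ?sqr_ge0.
have v8 : v <= 8^-1 by rewrite /v; lra.
have A : \int[N01]_x (cos (s * x) + (ch (s * x) + - 2)) = normal_cf s + (expR v + - 2).
  have i1 := integrable_cosM s; have i2 := int_ch s; have i3 := intD i2 (int_cst (- 2)).
  by rewrite RintegralD // RintegralD // mean_ch mean_cst_N.
have X : \int[N01]_x (2 * (ch (s * x) - 1) ^+ 2) =
    2 * (2^-1 * expR (4 * v) + (3 / 2 + - 2 * expR v)).
  transitivity (\int[N01]_x (2 * (2^-1 * ch (2 * s * x) + (3 / 2 + - 2 * ch (s * x))))).
    apply: eq_Rintegral => x _; rewrite -mulrA ch_double; congr (_ * _).
    by field.
  have i1 := int_ch (2 * s); have i2 := int_ch s.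
  have j1 := intZ 2^-1 i1; have j2 := intZ (- 2) i2; have j3 := intD (int_cst (3 / 2)) j2.
  have j4 := intD j1 j3.
  rewrite RintegralZl // RintegralD // RintegralD // mean_cst_N RintegralZl // RintegralZl //.
  rewrite !mean_ch; congr (_ * (_ * expR _ + _)).
  by rewrite /v; field.
have iA : N01.-integrable setT (EFin \o (fun x : Rm => cos (s * x) + (ch (s * x) + - 2))).
  by apply: intD; [exact: integrable_cosM | apply: intD => //; exact: int_ch].
have A0 : 0 <= normal_cf s + (expR v + - 2).
  rewrite -A; apply: Rintegral_ge0 => x _.
  by have /andP[] := cos_ch (s * x); lra.
have AX : normal_cf s + (expR v + - 2) <= 2 * (2^-1 * expR (4 * v) + (3 / 2 + - 2 * expR v)).
  rewrite -A -X; apply: le_Rintegral => //; last first.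
    by move=> x _; have /andP[] := cos_ch (s * x); lra.
  have -> : (fun x : Rm => 2 * (ch (s * x) - 1) ^+ 2) =
     (fun x => 2 * (2^-1 * ch (2 * s * x) + (3 / 2 + - 2 * ch (s * x)))).
    apply/funext => x; rewrite -mulrA ch_double; congr (_ * _); by field.
  apply: intZ; apply: intD; first by apply: intZ; exact: int_ch.
  by apply: intD => //; apply: intZ; exact: int_ch.
have e1 := expR_ge1Dx v.
have e2 : expR v <= 1 + v + 2 * v ^+ 2 by apply: expR_le; apply/andP; split; lra.
have e4 : expR (4 * v) <= 1 + 4 * v + 2 * (4 * v) ^+ 2 by apply: expR_le; apply/andP; split; lra.
have -> : s ^+ 4 = 4 * v ^+ 2 by rewrite /v; field.
have vv := sqr_ge0 v.
rewrite -/v ler_norml; move: e4; have -> : (4 * v) ^+ 2 = 16 * v ^+ 2 by ring.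
move=> e4; apply/andP; split; lra.
Qed.

Lemma normal_cf_le1 (s : R) : `|normal_cf s| <= 1.
Proof.
apply: le_trans (le_normr_Rintegral _ _) _ => //; first exact: integrable_cosM.
rewrite -[leRHS](mean_cst_N 1); apply: le_Rintegral => //.
- have ic := integrable_cosM s.
  have -> : EFin \o (fun x : Rm => `|cos (s * x)|) = (abse \o (EFin \o (fun x : Rm => cos (s * x))))%E.
    by apply/funext.
  exact: integrable_abse.
- by move=> x _; exact: cos_max.
Qed.

End NormalCf.

Lemma normrXB_le (R : realDomainType) (a b : R) n : `|a| <= 1 -> `|b| <= 1 ->
  `|a ^+ n - b ^+ n| <= n%:R * `|a - b|.
Proof.
move=> a1 b1; elim: n => [|n IH]; first by rewrite !expr0 subrr normr0 mul0r.
have -> : a ^+ n.+1 - b ^+ n.+1 = a * (a ^+ n - b ^+ n) + (a - b) * b ^+ n.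
  by rewrite !exprS; ring.
apply: le_trans (ler_normD _ _) _.
rewrite -natr1 [leRHS]mulrDl mul1r !normrM; apply: lerD.
  by apply: le_trans IH; rewrite ler_piMl.
by rewrite normrX ler_piMr // exprn_ile1.
Qed.

(** * Gaussian vectors with prescribed covariance *)

Section GaussianVector.
Variable R : realType.
Local Notation Rm := (measurableTypeR R).

(** The law determines the mean of the cosine, and a family of one normal realizes this law,
    including the Dirac mass for [c = 0]. *)
Lemma normal_cf_law (d : measure_display) (T : measurableType d)
    (Q : probability T R) (Z : T -> Rm) (c : R) : measurable_fun setT Z ->
  (forall B, measurable B -> Q (Z @^-1` B) = normal_law 0 (c ^+ 2) B) ->
  \int[Q]_w cos (Z w) = normal_cf c.
Proof.
move=> mZ lawZ.
have [d1 [T1 [Q1 [G [mG HG]]]]] := independent_normals_exist R 1.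
have [lawG cosG _] := HG (fun=> c); rewrite big_ord1 in cosG.
pose Z1 w : Rm := \sum_(i < 1) c * G i w.
have mZ1 : measurable_fun setT Z1.
  by apply: measurable_sum => i; apply: measurable_funM.
pose L : {measure set Rm -> \bar R} :=
  measure_function_pushforward__canonical__measure_function_Measure Q1 mZ1.
have mcos : measurable_fun setT (@cos R : Rm -> R).
  exact: continuous_measurable_fun (@continuous_cos R).
have LE B : measurable B -> Q1 (Z1 @^-1` B) = L B by [].
rewrite -cosG (Rintegral_law (L := L) mZ _ mcos (@cos_max R)); last first.
  move=> B mB; transitivity (normal_law 0 (c ^+ 2) B); first exact: lawZ.
  transitivity (Q1 (Z1 @^-1` B)); last exact: LE.
  by apply: eq_trans (esym (lawG B mB)); rewrite big_ord1.
by rewrite -(Rintegral_law mZ1 LE mcos (@cos_max R)).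
Qed.

Lemma normal_cf_root (s : R) n : (0 < n)%N ->
  normal_cf s = normal_cf (s / Num.sqrt n%:R) ^+ n.
Proof.
move=> n0; have [d1 [T1 [Q1 [G [mG HG]]]]] := independent_normals_exist R n.
have [lawG cosG _] := HG (fun=> s / Num.sqrt n%:R).
rewrite prodr_const card_ord in cosG; rewrite -cosG; apply/esym/normal_cf_law.
  by apply: measurable_sum => i; apply: measurable_funM.
have E : \sum_(i < n) (s / Num.sqrt n%:R) ^+ 2 = s ^+ 2.
  rewrite sumr_const card_ord expr_div_n sqr_sqrtr ?ler0n // -[LHS]mulr_natr mulfVK //.
  by rewrite pnatr_eq0 -lt0n.
by move=> B mB; apply: eq_trans (lawG B mB) _; rewrite E.
Qed.

(** The expansion at [s / sqrt n] has an error of order [1 / n ^ 2], and taking [n]-th powers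
    multiplies it by at most [n]. *)
Lemma normal_cf_cvg (s : R) :
  (1 - s ^+ 2 / (2 * n%:R)) ^+ n @[n --> \oo] --> normal_cf s.
Proof.
have bound n : (0 < n)%N -> 4 * s ^+ 2 <= n%:R ->
    `|normal_cf s - (1 - s ^+ 2 / (2 * n%:R)) ^+ n| <= 8 * s ^+ 4 * n%:R^-1.
  move=> n0 sn; have n0' : 0 < n%:R :> R by rewrite ltr0n.
  have n00 := lt0r_neq0 n0'.
  pose r : R := s / Num.sqrt n%:R.
  have r2 : r ^+ 2 = s ^+ 2 / n%:R by rewrite expr_div_n sqr_sqrtr // ltW.
  have r4 : r ^+ 4 = s ^+ 4 / n%:R ^+ 2.
    have -> : r ^+ 4 = (r ^+ 2) ^+ 2 by ring.
    by rewrite r2; field.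
  have r2le : r ^+ 2 <= 4^-1 by rewrite r2 ler_pdivrMr //; lra.
  have -> : s ^+ 2 / (2 * n%:R) = r ^+ 2 / 2 by rewrite r2; field.
  rewrite (normal_cf_root s n0) -/r.
  have r20 := sqr_ge0 r.
  have b1 : `|1 - r ^+ 2 / 2| <= 1 by rewrite ler_norml; apply/andP; split; lra.
  apply: le_trans (normrXB_le _ (normal_cf_le1 _) b1) _.
  apply: le_trans (ler_wpM2l (ltW n0') (normal_cf_expansion r2le)) _.
  by rewrite r4 le_eqVlt; apply/orP; left; apply/eqP; field.
apply/cvgrPdist_le => e e0.
near=> n; have n0 : (0 < n)%N by near: n; exact: nbhs_infty_gt.
apply: le_trans (bound n n0 _) _; first by near: n; exact: nbhs_infty_ger.
rewrite ler_pdivrMr ?ltr0n // -ler_pdivrMl //.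
by near: n; exact: nbhs_infty_ger.
Unshelve. all: by end_near.
Qed.

(** [Y] is the image of [k] independent normals under a factor [B] with [M = B^T B]; the combination
    with coefficients [t] then has coefficients [t B^T], of squared length [t M t^T]. *)
Lemma gaussian_vector N (M : 'M[R]_N) : symmetric_psd M ->
  exists (dT : measure_display) (T : measurableType dT) (Q : probability T R)
    (Y : T -> 'rV[R]_N), multivariate_normal Q Y 0 M /\
    forall (t : 'rV[R]_N) (b : R),
      (1 - (t *m M *m t^T) 0 0 / (2 * n%:R)) ^+ n * cos b @[n --> \oo] -->
        \int[Q]_w cos (dotv t (Y w) + b).
Proof.
move=> /psd_factor[k [B MB]].
have [dT [T [Q [G [mG HG]]]]] := independent_normals_exist R k.
pose Y w : 'rV[R]_N := \row_i \sum_(l < k) B l i * G l w.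
(* The family is indexed by [nat], hence the default 0 outside ['I_k]. *)
pose c (t : 'rV[R]_N) (l : nat) : R :=
  if insub l is Some l' then (t *m B^T) 0 l' else 0.
have cE t (l : 'I_k) : c t l = (t *m B^T) 0 l by rewrite /c valK.
have vE t : \sum_(l < k) c t l ^+ 2 = (t *m M *m t^T) 0 0.
  rewrite MB mulmxA -[t *m B^T *m B *m t^T]mulmxA -[in B *m t^T](trmxK B) -trmx_mul mxE.
  by apply: eq_bigr => l _; rewrite cE [_^T l 0]mxE expr2.
have tY (t : 'rV[R]_N) (w : T) : \sum_i t 0 i * Y w 0 i = \sum_(l < k) c t l * G l w.
  under eq_bigr do rewrite mxE mulr_sumr.
  rewrite exchange_big /=; apply: eq_bigr => l _; rewrite cE mxE mulr_suml.
  by apply: eq_bigr => i _; rewrite mxE mulrA.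
have mZ (t : 'rV[R]_N) : measurable_fun setT (fun w => \sum_(l < k) c t l * G l w : Rm).
  by apply: measurable_sum => l; apply: measurable_funM.
exists dT, T, Q, Y; split.
  split => [i|t D mD].
    under eq_fun do rewrite mxE.
    by apply: measurable_sum => l; apply: measurable_funM.
  have [lawG _ _] := HG (c t).
  rewrite (_ : \sum_i _ = 0); last by apply: big1 => i _; rewrite mxE mulr0.
  transitivity (Q ((fun w => \sum_(l < k) c t l * G l w) @^-1` D)).
    by congr (_ _); apply/funext => w; rewrite /preimage /= tY.
  by rewrite -vE; exact: lawG.
move=> t b; have [lawG cosG sinG] := HG (c t).
pose s := Num.sqrt ((t *m M *m t^T) 0 0).
have s2 : s ^+ 2 = (t *m M *m t^T) 0 0.
  by rewrite sqr_sqrtr // -vE; apply: sumr_ge0 => l _; exact: sqr_ge0.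
have -> : \int[Q]_w cos (dotv t (Y w) + b) = normal_cf s * cos b.
  have mcos : measurable_fun setT (fun w => cos (\sum_(l < k) c t l * G l w)).
    exact: (measurableT_comp (continuous_measurable_fun (@continuous_cos R)) (mZ t)).
  have msin : measurable_fun setT (fun w => sin (\sum_(l < k) c t l * G l w)).
    exact: (measurableT_comp (continuous_measurable_fun (@continuous_sin R)) (mZ t)).
  have icos := bounded_integrable Q mcos (fun w => cos_max _).
  have isin := bounded_integrable Q msin (fun w => sin_max _).
  transitivity (\int[Q]_w (cos b * cos (\sum_(l < k) c t l * G l w) -
                            sin b * sin (\sum_(l < k) c t l * G l w))).
    by apply: eq_Rintegral => w _; rewrite /dotv tY cosD mulrC [X in _ - X]mulrC.
  have iZ (x : R) (f : T -> R) : Q.-integrable setT (EFin \o f) ->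
      Q.-integrable setT (EFin \o (fun w => x * f w)).
    move=> fi; have -> : EFin \o (fun w => x * f w) = (fun w => x%:E * (EFin \o f) w)%E.
      by apply/funext => w; rewrite /= EFinM.
    exact: integrableZl.
  rewrite RintegralB //; [|exact: iZ|exact: iZ].
  rewrite RintegralZl // RintegralZl // sinG mulr0 subr0 mulrC; congr (_ * _).
  by apply: normal_cf_law => // D mD; apply: eq_trans (lawG D mD) _; rewrite s2 vE.
by apply: cvgMr_tmp; rewrite -s2; exact: normal_cf_cvg.
Qed.

End GaussianVector.

(** * The rescaled sums *)

Lemma mean_sum (R : realType) (S : Type) (m : (S -> R) -> R) (I : finType)
    (F : I -> S -> R) : mean_functional m ->
  m (fun s => \sum_i F i s) = \sum_i m (F i).
Proof.
move=> mP; elim: (index_enum I) => [|i r IH].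
  rewrite big_nil -[RHS](mean_cst mP 0); congr (m _).
  by apply/funext => s; rewrite big_nil.
rewrite big_cons -IH -(meanD mP); congr (m _).
by apply/funext => s; rewrite big_cons.
Qed.

(** Only the quadratic form of [sig] is known; its symmetric part has the same form. *)
Lemma psd_of_form (R : realType) (I : finType) N (h : I -> 'I_N) (sig : I -> I -> R) :
  bijective h ->
  (forall t : I -> R, 0 <= \sum_p \sum_q t p * t q * sig p q) ->
  exists M : 'M[R]_N, symmetric_psd M /\ forall t : 'rV[R]_N,
    (t *m M *m t^T) 0 0 = \sum_p \sum_q t 0 (h p) * t 0 (h q) * sig p q.
Proof.
move=> h_bij sig_ge0; have [g hK gK] := h_bij.
pose M : 'M[R]_N := \matrix_(k, l) (2^-1 * (sig (g k) (g l) + sig (g l) (g k))).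
have ME (t : 'rV[R]_N) :
    (t *m M *m t^T) 0 0 = \sum_p \sum_q t 0 (h p) * t 0 (h q) * sig p q.
  pose F p q := t 0 (h p) * t 0 (h q) * sig p q.
  transitivity (\sum_p \sum_q 2^-1 * (F p q + F q p)).
    rewrite mxE (reindex h) /=; last exact: onW_bij.
    transitivity (\sum_q \sum_p 2^-1 * (F p q + F q p)); last exact: exchange_big.
    apply: eq_bigr => q _; rewrite [t^T _ _]mxE mxE mulr_suml.
    rewrite (reindex h) /=; last exact: onW_bij.
    by apply: eq_bigr => p _; rewrite mxE !hK /F; ring.
  under eq_bigr do rewrite -mulr_sumr big_split /=.
  rewrite -mulr_sumr big_split /= [X in _ + X]exchange_big /=.
  by field.
exists M; split=> //; split=> [|t]; last by rewrite ME.
by apply/matrixP => k l; rewrite !mxE addrC.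
Qed.

Section RescaledSum.
Variables (R : realType) (d : nat) (mu : 'I_d * 'I_d -> R).

Let h (q : 'I_d * 'I_d) : 'I_(d * d) := mxvec_index q.1 q.2.

Lemma mxvec_index_bij : bijective h.
Proof.
have -> : h = uncurry (@mxvec_index d d) by apply/funext => -[].
by have [g gK Kg] := curry_mxvec_bij d d; exists g => q; [apply: gK|apply: Kg].
Qed.

Definition rescaled (n : nat) (S : 'M[R]_d) : 'rV[R]_(d * d) :=
  mxvec (Num.sqrt (n%:R : R) *: (n%:R^-1 *: S - \matrix_(i, j) mu (i, j))).

(** At [n = 0] both sides vanish because [0^-1 = 0]. *)
Lemma rescaledE n S (q : 'I_d * 'I_d) :
  rescaled n S 0 (h q) = (Num.sqrt n%:R)^-1 * (S q.1 q.2 - n%:R * mu q).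
Proof.
rewrite /rescaled /h mxvecE !mxE; case: q => i j /=.
have [->|n0] := posnP n; first by rewrite sqrtr0 invr0 !mul0r.
have n0' : 0 < n%:R :> R by rewrite ltr0n.
have s0 : Num.sqrt (n%:R : R) != 0 by rewrite gt_eqF // sqrtr_gt0.
rewrite -[X in X^-1 * S _ _](sqr_sqrtr (ltW n0')) -[X in _ - X * mu _](sqr_sqrtr (ltW n0')).
by field.
Qed.

Lemma dotv_rescaled n S (t : 'rV[R]_(d * d)) :
  dotv t (rescaled n S) = (Num.sqrt n%:R)^-1 *
    (\sum_q t 0 (h q) * S q.1 q.2 - n%:R * \sum_q t 0 (h q) * mu q).
Proof.
rewrite /dotv (reindex h) /=; last exact: onW_bij mxvec_index_bij.
rewrite mulr_sumr -sumrB mulr_sumr; apply: eq_bigr => q _.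
by rewrite rescaledE; ring.
Qed.

Lemma sqr_rescaled n S :
  \sum_i rescaled n S 0 i ^+ 2 = n%:R^-1 * \sum_q (S q.1 q.2 - n%:R * mu q) ^+ 2.
Proof.
rewrite (reindex h) /=; last exact: onW_bij mxvec_index_bij.
rewrite mulr_sumr; apply: eq_bigr => q _.
by rewrite rescaledE exprMn exprVn sqr_sqrtr.
Qed.

End RescaledSum.

(** * From limits of cosines to convergence in distribution *)

Theorem theorem4p2 (R : realType) (d : nat) (A C P : 'M[R]_d)
  (A_unit : A \in unitmx)
  (rhoA_lt1 : spectral_radius A < 1)
  (C_def : C = invmx (1%:M - A))
  (P_stochastic : stochastic P)
  (P_support : forall i j, 0 < P i j <-> A i j <> 0)
  (P_irreducible : irreducible_chain P)
  (P_aperiodic : aperiodic_chain P)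
  (rhoH_lt1 : spectral_radius (Hhat A P) < 1)
  (dO : measure_display) (Omega : measurableType dO)
  (Pr : probability Omega R)
  (X : nat -> Omega -> 'I_d)
  (X_markov : markov_chain Pr P X) :
  exists (Gamma_s : 'M[R]_d) (M_a : 'M[R]_(d * d)),
    symmetric_psd M_a /\
    let Gamma_hat : 'M[R]_d := \matrix_(i, j) (Gamma_s i j * C i j) in
    let Sigma (K : nat) (w : Omega) : 'M[R]_d :=
      us_Sigma (ulam_run A P (fun n => X n w) K) in
    cvg_to_normal Pr
      (fun (K : nat) (w : Omega) =>
         mxvec (Num.sqrt (K%:R : R) *: (K%:R^-1 *: Sigma K w - Gamma_hat)))
      0 M_a.
Proof.
(* A probability space is nonempty, which provides a state [x0]. *)
have [w0 _] : [set: Omega] !=set0.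
  apply/set0P/eqP => T0; have := probability_setT Pr.
  by rewrite T0 measure0 => /esym/eqP; rewrite onee_eq0.
pose x0 := X 0%N w0.
have [mu [sig [mu0 clt]]] :=
  ulam_mean_clt P_stochastic P_support P_irreducible rhoA_lt1 rhoH_lt1 x0.
pose m := path_mean A P Pr X x0.
have mP n : mean_functional (m n) := path_mean_functional A X_markov x0 n.
have [moment cosm] := clt m (path_mean_ulam A X_markov x0).
pose h (q : 'I_d * 'I_d) : 'I_(d * d) := mxvec_index q.1 q.2.
have [M [M_psd ME]] := psd_of_form (@mxvec_index_bij d) (fun t => (cosm t).1).
(* Where [C i j = 0] the quotient is 0 by convention, and there [mu] vanishes as well. *)
exists (\matrix_(i, j) (mu (i, j) / C i j)), M; split=> //.
have -> : \matrix_(i, j) ((\matrix_(i, j) (mu (i, j) / C i j)) i j * C i j) =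
    \matrix_(i, j) mu (i, j).
  apply/matrixP => i j; rewrite !mxE.
  have [C0|C0] := eqVneq (C i j) 0; last by rewrite divfK.
  by rewrite C0 mulr0 (mu0 (i, j)) //= -C_def.
have [dT [T [Q [Y [Y_normal Y_cos]]]]] := gaussian_vector M_psd.
exists dT, T, Q, Y; split=> // f f_cont f_bounded.
have [mY _] := Y_normal; have [b fb] := f_bounded.
pose m' n (g : 'rV[R]_(d * d) -> R) := m n (fun s => g (rescaled mu n (us_Sigma s))).
have m'P n : mean_functional (m' n).
  split => [g1 g2|c g|g g0|]; rewrite /m'.
  - exact: (meanD (mP n)).
  - exact: (meanZ (mP n)).
  - by apply: (mean_ge0 (mP n)).
  - exact: (mean1 (mP n)).
have [K HK] : exists K, forall n, m' n (fun x => \sum_i x 0 i ^+ 2) <= K.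
  have /choice[K HK] : forall q : 'I_d * 'I_d, exists K, forall n,
      m n (fun s => (us_Sigma s q.1 q.2 - n%:R * mu q) ^+ 2) <= K * n.+1%:R.
    move=> q; have [K HK] := moment (fun p => (p == q)%:R); exists K => n.
    apply: le_trans (HK n); apply: mean_le => // s.
    have E (g : 'I_d * 'I_d -> R) : \sum_p (p == q)%:R * g p = g q.
      rewrite (bigD1 q) //= eqxx mul1r big1 ?addr0 // => p /negPf ->.
      by rewrite mul0r.
    by rewrite !E.
  (* The factor 2 bounds [(n + 1) / n] for [n >= 1]; at [n = 0] the rescaled sum is 0. *)
  exists (2 * \sum_q `|K q|) => n; rewrite /m'.
  under eq_fun do rewrite sqr_rescaled.
  rewrite (meanZ (mP n)) (mean_sum _ (mP n)).
  have [->|n0] := posnP n.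
    by rewrite invr0 mul0r mulr_ge0 // sumr_ge0.
  have n0' : 0 < n%:R :> R by rewrite ltr0n.
  rewrite mulrC ler_pdivrMr // mulrAC mulr_sumr; apply: ler_sum => q _.
  apply: le_trans (HK q n) _; rewrite mulrC.
  apply: le_trans (ler_wpM2l (ler0n _ _) (ler_norm (K q))) _.
  by rewrite ler_wpM2r // -natrM ler_nat mul2n -addnn -addn1 leq_add2l.
have cos_cvg t c : m' n (fun x => cos (dotv t x + c)) @[n --> \oo] -->
    \int[Q]_w cos (dotv t (Y w) + c).
  have [_ /(_ c) H] := cosm (fun q => t 0 (h q)).
  rewrite -[X in _ --> X]add0r.
  (* The powers [(1 - s2 / (2 n)) ^ n * cos c] link the two limits: the chain approaches them, and
     they converge to the Gaussian mean. *)
  apply: cvg_trans (cvgD H (Y_cos t c)); apply: near_eq_cvg; near=> n.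
  rewrite /= ME subrK; congr (m n _); apply/funext => s.
  by rewrite dotv_rescaled.
have f_cvg := weak_cvg_of_cos mY m'P HK cos_cvg f_cont f_bounded.
have -> : ('E_Q[fun w => f (Y w)] = (\int[Q]_w f (Y w))%:E)%E.
  have fi := bounded_integrable Q (measurable_continuous_rv mY f_cont fb) (fun w => fb (Y w)).
  by rewrite unlock /Rintegral fineK //; exact: integrable_fin_num.
have -> : (fun n => 'E_Pr[fun w => f (mxvec (Num.sqrt (n%:R : R) *: (n%:R^-1 *:
      us_Sigma (ulam_run A P (fun k => X k w) n) - \matrix_(i, j) mu (i, j))))]%E) =
    (fun n => (m' n f)%:E).
  apply/funext => n.
  exact: (expectation_path A X_markov x0 n (fun s => f (rescaled mu n (us_Sigma s)))).
by apply: cvg_EFin => //; apply: nearW.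
Unshelve. all: by end_near.
Qed.
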